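(* (ZO-PAGE-GT, pure coordinate-wise estimators, finite-sum case.) Consider ZOMA with pure CW estimators and the ATC-GT matrices (context), $W$ positive semidefinite, under the PL, expected-smoothness, bounded-variance and network assumptions of the context. Set $$B=N,\ b=b_0=\sqrt{\tfrac NK},\ p=\tfrac1{\sqrt{NK}},\ \beta=0,\ \eta_x=\mathcal O\Big(\tfrac{(1-\lambda)^{2}}{\kappa^2}\Big),\ \eta_y=\mathcal O\big((1-\lambda)^{2}\big),\ \delta_x=\mathcal O\Big(\tfrac1{d_1^{1/2}(1-\lambda)T^{1/2}}\Big),\ \delta_y=\mathcal O\Big(\tfrac1{d_2^{1/2}(1-\lambda)T^{1/2}}\Big).$$ Then $$\frac1T\sum_{i=0}^{T-1}\big(\mathbb E\|\nabla_xJ(x_{c,i},y_{c,i})\|^2+\mathbb E\|\nabla_yJ(x_{c,i},y_{c,i})\|^2\big)\le\mathcal O\Big(\frac{\kappa^2(\Delta_0'+1)}{(1-\lambda)^{2}T}+\frac{\kappa^2(1-\lambda)\zeta_0^2}T+\frac{\kappa^2\lambda^4\sqrt K\sigma^2}{\sqrt NT}+\frac{\kappa^2\sigma^2}T\Big).$$ The communication complexity and per-agent function query complexity for accuracy $\varepsilon$ are $$CC\approx\mathcal O\Big(\frac{\kappa^2\varepsilon^{-2}}{(1-\lambda)^{2}}+\kappa^2\varepsilon^{-2}\Big),\qquad FC\approx(CC\times p\times B+b_0)\times2d+CC\times(1-p)\times b\times4d\approx\mathcal O\Big(\frac{d\kappa^2\sqrt N\varepsilon^{-2}}{\sqrt K(1-\lambda)^{2}}+d\sqrt{\tfrac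 NK}\Big).$$
   Context: Problem. $K\ge2$ agents; $d=d_1+d_2$; $z=(x,y)\in\mathbb R^{d_1}\times\mathbb R^{d_2}$; $J=\frac1K\sum_{k=1}^KJ_k$, $J_k(z)=\frac1N\sum_{s=1}^NQ_k(z;\zeta_k(s))$ (finite-sum case); $\xi_k$ denotes a uniform draw from $\{\zeta_k(1),\dots,\zeta_k(N)\}$. $P(x)=\max_yJ(x,y)$, $P^\star=\inf_xP(x)$. PL assumption: $\|\nabla_yJ(x,y)\|^2\ge2\nu(\max_{y'}J(x,y')-J(x,y))$ for all $x,y$, $\nu>0$; $P^\star>-\infty$ ($J$ nonconvex in $x$, nonconcave in $y$). Expected smoothness: $Q_k(\cdot;\xi)$ is $C^1$, $\mathbb E\|\nabla_wQ_k(z;\xi_k)-\nabla_wQ_k(z';\xi_k)\|^2\le L_f^2\|z-z'\|^2$, $w\in\{x,y\}$. $\kappa=L_f/\nu$. Bounded variance: $\mathbb E\nabla_wQ_k(z;\xi_k)=\nabla_wJ_k(z)$, $\mathbb E\|\nabla_wQ_k(z;\xi_k)-\nabla_wJ_k(z)\|^2\le\sigma^2$; samples are spatially and temporally i.i.d. CW estimators: $q_k^x(z;\xi,0)=\sum_{j=1}^{d_1}\frac{Q_k(x+\delta_xe_j,y;\xi)-Q_k(x-\delta_xe_j,y;\xi)}{2\delta_x}e_j$, with $e_j$ the canonical basis vectors; $q_k^y(z;\xi,0)$ analogously, perturbing $y\in\mathbb R^{d_2}$ with $\delta_y$. ZOMA (pure CW). Parameters $p,\beta\in[0,1]$, learning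 rates $\eta_x,\eta_y$, batch sizes $b,B,b_0$, number of rounds $T$. For $w\in\{x,y\}$: $g^w_{k,0}=\frac1{b_0}\sum_{j=1}^{b_0}q^w_k(z_{k,0};\xi^j_{k,0},0)$; for $i\ge1$, with $\pi_i\sim\mathrm{Bernoulli}(p)$ common to all agents, $g^w_{k,i}=\frac1B\sum_{j=1}^Bq^w_k(z_{k,i};\xi^j_{k,i},0)$ if $\pi_i=1$ (samples drawn uniformly without replacement) and $g^w_{k,i}=(1-\beta)[g^w_{k,i-1}-\frac1b\sum_{j=1}^bq^w_k(z_{k,i-1};\xi^j_{k,i},0)]+\frac1b\sum_{j=1}^bq^w_k(z_{k,i};\xi^j_{k,i},0)$ if $\pi_i=0$; except when $\pi_i=1$, samples are i.i.d. With stacked vectors $\mathcal X_i=\mathrm{col}\{x_{k,i}\}$, $\mathcal Y_i=\mathrm{col}\{y_{k,i}\}$, $\mathcal G_{w,i}=\mathrm{col}\{g^w_{k,i}\}$: $\mathcal X_{i+1}=\mathcal A_x(\mathcal C_x\mathcal X_i-\eta_x\mathcal G_{x,i})-\mathcal B_x\mathcal D_{x,i}$, $\mathcal D_{x,i+1}=\mathcal D_{x,i}+\mathcal B_x\mathcal X_{i+1}$, $\mathcal Y_{i+1}=\mathcal A_y(\mathcal C_y\mathcal Y_i+\eta_y\mathcal G_{y,i})-\mathcal B_y\mathcal D_{y,i}$, $\mathcal D_{y,i+1}=\mathcal D_{y,i}+\mathcal B_y\mathcal Y_{i+1}$, with identical initial points at all agents and $\mathcal B_x\mathcal D_{x,0}=0$,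 $\mathcal B_y\mathcal D_{y,0}=0$. $x_{c,i},y_{c,i}$ are the averages of $x_{k,i},y_{k,i}$ over agents. Network assumption and ATC-GT: $W\in\mathbb R^{K\times K}$ symmetric, doubly stochastic, primitive; $\lambda$ is its second largest eigenvalue in magnitude. ATC-GT (gradient tracking): $\mathcal A_x=(W\otimes I_{d_1})^2$, $\mathcal B_x=I-W\otimes I_{d_1}$, $\mathcal C_x=I$ (same for $y$ with $d_2$). Quantities and conventions. $\Delta_0'=\mathbb E[(P(x_{c,0})-P^\star)+(P(x_{c,0})-J(x_{c,0},y_{c,0}))]$; $\zeta_0^2=\frac1K\mathbb E\|(\mathcal A_x-\frac1K\mathbf 1\mathbf 1^\top\otimes I_{d_1})\mathcal G_{x,0}\|^2+\frac1K\mathbb E\|(\mathcal A_y-\frac1K\mathbf 1\mathbf 1^\top\otimes I_{d_2})\mathcal G_{y,0}\|^2$. ''$h=\mathcal O(e)$'' for a hyperparameter means $h$ is chosen of order $e$, with a suitable constant (integer rounding of batch sizes ignored). The $\mathcal O$ in the bound suppresses numerical constants, $L_f$, and the norms of the matrices $\widehat{\mathcal Q},\widehat{\mathcal Q}^{-1}$ in a factorization $\begin{bmatrix}\widehat\Lambda_a\widehat\Lambda_c-\widehat\Lambda_b^2&-\widehat\Lambda_b\\ \widehat\Lambda_b&I\end{bmatrix}=\widehat{\mathcal Q}\mathcal T\widehat{\mathcal Q}^{-1}$, $\|\mathcal T\|<1$, where $\widehat\Lambda_a,\widehat\Lambda_b,\widehat\Lambda_c$ are the diagonal matrices of eigenvalues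 of $\mathcal A,\mathcal B,\mathcal C$ on the orthogonal complement of the consensus space (for $x$ and $y$). $CC$ is the number $T$ of rounds for the averaged squared gradient norm to reach order $\varepsilon^2$, and $FC$ the corresponding number of function evaluations per agent: a CW gradient pair costs $2d$ evaluations per sample at one point, $4d$ at two points; $\sigma,\Delta_0',\zeta_0$ are treated as constants in $CC,FC$.
   Formalization: The formal theorem assumes ν ≤ L_f (κ ≥ 1). This is automatic unless J does not depend on y; in that case PL holds for every ν, and as ν → ∞ the right side of the bound tends to 0 while the left side at T = 1 is fixed, so the claim fails. *)

(* Defs.v *)
From HB Require Import structures.
From mathcomp Require Import all_boot all_order all_algebra.
From mathcomp Require Import all_classical all_reals all_analysis.

Set Implicit Arguments.
Unset Strict Implicit.
Unset Printing Implicit Defensive.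

Import Order.TTheory GRing.Theory Num.Theory numFieldNormedType.Exports.

Local Open Scope classical_set_scope.
Local Open Scope ring_scope.

(* The norm of the library on matrices is the sup norm; this is the square of
   the Euclidean (Frobenius) norm. *)
Definition sqnorm (R : realType) (m n : nat) (A : 'M[R]_(m, n)) : R :=
  \sum_(i < m) \sum_(j < n) A i j ^+ 2.

(* The finite-valued random variables below are all bounded, so that [fine]
   never acts on an infinite expectation. *)
Definition Ex (R : realType) (disp : measure_display)
    (Om : measurableType disp) (Pr : probability Om R) (f : Om -> R) : R :=
  fine ('E_Pr[f])%E.

Definition mean (R : realType) (V : lmodType R) (m : nat) (v : 'I_m -> V) : V :=
  m%:R^-1 *: \sum_(j < m) v j.

Definition rmean (R : realType) (m : nat) (v : 'I_m -> R) : R :=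
  m%:R^-1 * \sum_(j < m) v j.

Definition grad (R : realType) (n : nat) (f : 'rV[R]_n -> R) (x : 'rV[R]_n) :
  'rV[R]_n := \row_(j < n) 'D_(delta_mx 0 j) f x.

Definition gradx (R : realType) (d1 d2 : nat)
    (f : 'rV[R]_d1 -> 'rV[R]_d2 -> R) (x : 'rV[R]_d1) (y : 'rV[R]_d2) :=
  grad (f ^~ y) x.

Definition grady (R : realType) (d1 d2 : nat)
    (f : 'rV[R]_d1 -> 'rV[R]_d2 -> R) (x : 'rV[R]_d1) (y : 'rV[R]_d2) :=
  grad (f x) y.

Definition continuously_differentiable (R : realType) (d1 d2 : nat)
    (f : 'rV[R]_d1 -> 'rV[R]_d2 -> R) : Prop :=
  let F := fun z : 'rV[R]_d1 * 'rV[R]_d2 => f z.1 z.2 in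
  (forall z, differentiable F z) /\
  (forall v, continuous (fun z => 'D_v F z : R)).

(* [Q k s x y] is the loss of agent [k] at [(x, y)] on its [s]-th sample. *)
Definition losses (R : realType) (K N d1 d2 : nat) : Type :=
  'I_K -> 'I_N -> 'rV[R]_d1 -> 'rV[R]_d2 -> R.

Definition local_risk (R : realType) (K N d1 d2 : nat)
    (Q : losses R K N d1 d2) (k : 'I_K) (x : 'rV[R]_d1) (y : 'rV[R]_d2) : R :=
  rmean (fun s => Q k s x y).

Definition risk (R : realType) (K N d1 d2 : nat)
    (Q : losses R K N d1 d2) (x : 'rV[R]_d1) (y : 'rV[R]_d2) : R :=
  rmean (fun k => local_risk Q k x y).

Definition max_attained (R : realType) (d1 d2 : nat)
    (J : 'rV[R]_d1 -> 'rV[R]_d2 -> R) : Prop :=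
  forall x, exists y, forall y', J x y' <= J x y.

Definition primal (R : realType) (d1 d2 : nat)
    (J : 'rV[R]_d1 -> 'rV[R]_d2 -> R) (x : 'rV[R]_d1) : R :=
  sup (range (J x)).

Definition primal_inf (R : realType) (d1 d2 : nat)
    (J : 'rV[R]_d1 -> 'rV[R]_d2 -> R) : R :=
  inf (range (primal J)).

Definition PL_in_y (R : realType) (d1 d2 : nat)
    (J : 'rV[R]_d1 -> 'rV[R]_d2 -> R) (nu : R) : Prop :=
  forall x y, 2 * nu * (primal J x - J x y) <= sqnorm (grady J x y).

(* Expectations over a uniformly drawn sample are averages over ['I_N]. *)
Definition expected_smoothness (R : realType) (K N d1 d2 : nat)
    (Q : losses R K N d1 d2) (L : R) : Prop :=
  (forall k s, continuously_differentiable (Q k s)) /\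
  forall k x y x' y',
    rmean (fun s => sqnorm (gradx (Q k s) x y - gradx (Q k s) x' y'))
      <= L ^+ 2 * (sqnorm (x - x') + sqnorm (y - y')) /\
    rmean (fun s => sqnorm (grady (Q k s) x y - grady (Q k s) x' y'))
      <= L ^+ 2 * (sqnorm (x - x') + sqnorm (y - y')).

Definition bounded_variance (R : realType) (K N d1 d2 : nat)
    (Q : losses R K N d1 d2) (sigma : R) : Prop :=
  forall k x y,
    [/\ mean (fun s => gradx (Q k s) x y) = gradx (local_risk Q k) x y,
        mean (fun s => grady (Q k s) x y) = grady (local_risk Q k) x y,
        rmean (fun s => sqnorm (gradx (Q k s) x y - gradx (local_risk Q k) x y))
          <= sigma ^+ 2 &
        rmean (fun s => sqnorm (grady (Q k s) x y - grady (local_risk Q k) x y))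
          <= sigma ^+ 2].

Definition doubly_stochastic (R : realType) (K : nat) (W : 'M[R]_K) : Prop :=
  [/\ forall i j, 0 <= W i j,
      forall i, \sum_(j < K) W i j = 1 &
      forall j, \sum_(i < K) W i j = 1].

Definition primitive (R : realType) (K : nat) (W : 'M[R]_K) : Prop :=
  exists m : nat, forall i j, 0 < (W ^+ m) i j.

(* Eigenvalues are listed with multiplicity, by decreasing magnitude. *)
Definition second_largest_eigenvalue (R : realType) (K : nat) (W : 'M[R]_K)
    (lambda : R) : Prop :=
  exists s : seq R,
    [/\ char_poly W = \prod_(a <- s) ('X - a%:P),
        sorted (fun a b : R => `|b| <= `|a|) s &
        lambda = s`_1].

Definition network_assumption (R : realType) (K : nat) (W : 'M[R]_K)
    (lambda : R) : Prop :=
  [/\ W^T = W, doubly_stochastic W, primitive W &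
      second_largest_eigenvalue W lambda].

Definition possemidef (R : realType) (K : nat) (W : 'M[R]_K) : Prop :=
  forall v : 'rV[R]_K, 0 <= (v *m W *m v^T) 0 0.

(* A stacked vector col{x_1, ..., x_K} of vectors in R^d is the K x d matrix
   whose k-th row is x_k; then M (x) I_d acts as left multiplication by M. *)
Record network (R : realType) (K : nat) := Network {
  netA : 'M[R]_K;
  netB : 'M[R]_K;
  netC : 'M[R]_K }.

Definition atc_gt (R : realType) (K : nat) (W : 'M[R]_K) : network R K :=
  Network (W *m W) (1%:M - W) 1%:M.

Definition average (R : realType) (K d : nat) (X : 'M[R]_(K, d)) : 'rV[R]_d :=
  mean (fun k => row k X).

(* (A - 1/K 11^T (x) I) G *)
Definition mix_deviation (R : realType) (K d : nat) (A : 'M[R]_K)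
    (G : 'M[R]_(K, d)) : 'M[R]_(K, d) :=
  (A - const_mx K%:R^-1) *m G.

(* [coin i] is the coin of round [i], shared by all agents; [draw k i j] is the
   [j]-th i.i.d. sample of agent [k] in round [i]; [batch k i] is the tuple of
   samples that agent [k] draws without replacement in round [i]. *)
Record sampler (K N B : nat) (Om : Type) := Sampler {
  coin : nat -> Om -> bool;
  draw : 'I_K -> nat -> nat -> Om -> 'I_N;
  batch : 'I_K -> nat -> Om -> {ffun 'I_B -> 'I_N} }.

Definition events_of (Om V : Type) (X : Om -> V) : set (set Om) :=
  [set X @^-1` A | A in setT].

Definition sampler_events (K N B : nat) (Om : Type) (S : sampler K N B Om)
    (t : nat + 'I_K * nat * nat + 'I_K * nat) : set (set Om) :=
  match t with
  | inl (inl i) => events_of (coin S i)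
  | inl (inr (k, i, j)) => events_of (draw S k i j)
  | inr (k, i) => events_of (batch S k i)
  end.

Definition mutually_independent (R : realType) (disp : measure_display)
    (Om : measurableType disp) (Pr : probability Om R) (I : eqType)
    (F : I -> set (set Om)) : Prop :=
  forall (r : seq I) (A : I -> set Om), uniq r ->
    (forall t, t \in r -> F t (A t)) ->
    Pr (\bigcap_(t in [set` r]) A t) = (\prod_(t <- r) Pr (A t))%E.

Definition injections (N B : nat) : {set {ffun 'I_B -> 'I_N}} :=
  [set f : {ffun 'I_B -> 'I_N} | injectiveb f].

Record sampling_scheme (R : realType) (disp : measure_display)
    (Om : measurableType disp) (Pr : probability Om R) (p : R) (K N B : nat)
    (S : sampler K N B Om) : Prop := SamplingScheme {
  sampling_measurable : forall t A, sampler_events S t A -> measurable A;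
  sampling_independent : mutually_independent Pr (sampler_events S);
  coin_law : forall i, Pr [set w | coin S i w = true] = p%:E;
  draw_law : forall k i j s, Pr [set w | draw S k i j w = s] = (N%:R^-1)%:E;
  batch_law : forall k i f, Pr [set w | batch S k i w = f] =
    (if f \in injections N B then #|injections N B|%:R^-1 else 0)%:E }.

Definition cw (R : realType) (n : nat) (delta : R) (f : 'rV[R]_n -> R)
    (x : 'rV[R]_n) : 'rV[R]_n :=
  \row_(j < n) ((f (x + delta *: delta_mx 0 j) - f (x - delta *: delta_mx 0 j))
                / (2 * delta)).

Definition cwx (R : realType) (K N d1 d2 : nat) (Q : losses R K N d1 d2)
    (delta : R) k s (x : 'rV[R]_d1) (y : 'rV[R]_d2) : 'rV[R]_d1 :=
  cw delta (Q k s ^~ y) x.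

Definition cwy (R : realType) (K N d1 d2 : nat) (Q : losses R K N d1 d2)
    (delta : R) k s (x : 'rV[R]_d1) (y : 'rV[R]_d2) : 'rV[R]_d2 :=
  cw delta (Q k s x) y.

(* The batch size B of the rounds with coin 1 is a parameter of [sampler]. *)
Record params (R : realType) := Params {
  prob : R;
  momentum : R;
  etax : R;
  etay : R;
  deltax : R;
  deltay : R;
  bsize : nat;
  bsize0 : nat }.

Section Algorithm.
Variables (R : realType) (K N d1 d2 B : nat) (Om : Type).
Variables (Q : losses R K N d1 d2) (netx nety : network R K) (h : params R).
Variable S : sampler K N B Om.

Definition estimator_init (n : nat)
    (q : 'I_K -> 'I_N -> 'rV[R]_d1 -> 'rV[R]_d2 -> 'rV[R]_n)
    (X : 'M[R]_(K, d1)) (Y : 'M[R]_(K, d2)) (w : Om) : 'M[R]_(K, n) :=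
  \matrix_(k < K)
    mean (fun j : 'I_(bsize0 h) => q k (draw S k 0 j w) (row k X) (row k Y)).

(* [X], [Y], [G] are the quantities of round [i - 1]; [X'], [Y'] are those of
   round [i]. *)
Definition estimator_step (n : nat)
    (q : 'I_K -> 'I_N -> 'rV[R]_d1 -> 'rV[R]_d2 -> 'rV[R]_n)
    (i : nat) (X X' : 'M[R]_(K, d1)) (Y Y' : 'M[R]_(K, d2))
    (G : 'M[R]_(K, n)) (w : Om) : 'M[R]_(K, n) :=
  \matrix_(k < K)
    if coin S i w then
      mean (fun j : 'I_B => q k (batch S k i w j) (row k X') (row k Y'))
    else
      (1 - momentum h) *:
        (row k G - mean (fun j : 'I_(bsize h) =>
                           q k (draw S k i j w) (row k X) (row k Y)))
      + mean (fun j : 'I_(bsize h) =>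
                q k (draw S k i j w) (row k X') (row k Y')).

Record state := State {
  stX : 'M[R]_(K, d1);
  stY : 'M[R]_(K, d2);
  stDx : 'M[R]_(K, d1);
  stDy : 'M[R]_(K, d2);
  stGx : 'M[R]_(K, d1);
  stGy : 'M[R]_(K, d2) }.

Fixpoint zoma (x0 : 'rV[R]_d1) (y0 : 'rV[R]_d2) (Dx0 : 'M[R]_(K, d1))
    (Dy0 : 'M[R]_(K, d2)) (i : nat) (w : Om) : state :=
  match i with
  | 0%N =>
      let X := \matrix_(k < K) x0 in
      let Y := \matrix_(k < K) y0 in
      State X Y Dx0 Dy0
        (estimator_init (cwx Q (deltax h)) X Y w)
        (estimator_init (cwy Q (deltay h)) X Y w)
  | i'.+1 =>
      let st := zoma x0 y0 Dx0 Dy0 i' w in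
      let X := netA netx *m (netC netx *m stX st - etax h *: stGx st)
               - netB netx *m stDx st in
      let Y := netA nety *m (netC nety *m stY st + etay h *: stGy st)
               - netB nety *m stDy st in
      State X Y (stDx st + netB netx *m X) (stDy st + netB nety *m Y)
        (estimator_step (cwx Q (deltax h)) i (stX st) X (stY st) Y (stGx st) w)
        (estimator_step (cwy Q (deltay h)) i (stX st) X (stY st) Y (stGy st) w)
  end.

(* Evaluations of the loss per agent during the initialization and the rounds
   1, ..., T. *)
Definition evaluations (T : nat) (w : Om) : nat :=
  bsize0 h * (2 * (d1 + d2)) +
  \sum_(1 <= i < T.+1)
    (if coin S i w then B * (2 * (d1 + d2)) else bsize h * (4 * (d1 + d2))).

End Algorithm.

Section Quantities.
Variables (R : realType) (K d1 d2 : nat) (disp : measure_display).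
Variables (Om : measurableType disp) (Pr : probability Om R).
Variable J : 'rV[R]_d1 -> 'rV[R]_d2 -> R.
Variable traj : nat -> Om -> state R K d1 d2.

Definition xc (i : nat) (w : Om) : 'rV[R]_d1 := average (stX (traj i w)).
Definition yc (i : nat) (w : Om) : 'rV[R]_d2 := average (stY (traj i w)).

Definition avg_sqgrad (T : nat) : R :=
  T%:R^-1 * \sum_(i < T)
    (Ex Pr (fun w => sqnorm (gradx J (xc i w) (yc i w))) +
     Ex Pr (fun w => sqnorm (grady J (xc i w) (yc i w)))).

Definition Delta0 : R :=
  Ex Pr (fun w => (primal J (xc 0 w) - primal_inf J) +
                  (primal J (xc 0 w) - J (xc 0 w) (yc 0 w))).

Definition zeta0_sq (netx nety : network R K) : R :=
  K%:R^-1 * Ex Pr (fun w => sqnorm (mix_deviation (netA netx) (stGx (traj 0 w))))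
  + K%:R^-1 *
    Ex Pr (fun w => sqnorm (mix_deviation (netA nety) (stGy (traj 0 w)))).

End Quantities.

(* [b] is a positive integer rounding of [r]. *)
Definition rounding (R : realType) (r : R) (b : nat) : Prop :=
  (0 < b)%N /\ `|b%:R - r| < 1.

Definition page_gt_params (R : realType) (K N d1 d2 : nat)
    (kappa lambda cx cy dx dy : R) (b T : nat) : params R :=
  {| prob := (Num.sqrt (N%:R * K%:R))^-1;
     momentum := 0;
     etax := cx * ((1 - lambda) ^+ 2 / kappa ^+ 2);
     etay := cy * (1 - lambda) ^+ 2;
     deltax := dx / (Num.sqrt d1%:R * (1 - lambda) * Num.sqrt T%:R);
     deltay := dy / (Num.sqrt d2%:R * (1 - lambda) * Num.sqrt T%:R);
     bsize := b;
     bsize0 := b |}.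

Definition comm_order (R : realType) (kappa lambda eps : R) : R :=
  kappa ^+ 2 * eps ^- 2 / (1 - lambda) ^+ 2 + kappa ^+ 2 * eps ^- 2.

Definition query_cost (R : realType) (d : nat) (p B b b0 CC : R) : R :=
  (CC * p * B + b0) * (2 * d%:R) + CC * (1 - p) * b * (4 * d%:R).

Definition query_order (R : realType) (K N d : nat) (kappa lambda eps : R) : R :=
  d%:R * kappa ^+ 2 * Num.sqrt N%:R * eps ^- 2
    / (Num.sqrt K%:R * (1 - lambda) ^+ 2)
  + d%:R * Num.sqrt (N%:R / K%:R).

(* Main.v *)
Require Import Defs.
From HB Require Import structures.
From mathcomp Require Import all_boot all_order all_algebra.
From mathcomp Require Import all_classical all_reals all_analysis.
From mathcomp Require Import ring lra complex.

Set Implicit Arguments.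
Unset Strict Implicit.
Unset Printing Implicit Defensive.

Import Order.TTheory GRing.Theory Num.Theory numFieldNormedType.Exports.

Local Open Scope classical_set_scope.
Local Open Scope ring_scope.

(** Eliminating the dual variable, the iterates of ATC-GT satisfy
    [X'' - W X' = W (X' - W X) - eta W^2 (G' - G)].  Off the consensus space
    [W] contracts by [lambda] (this is where the spectral theorem and
    primitivity are used), so consensus errors are driven, through two cascaded
    contractions, by the increments [G' - G] only; with [eta] of order
    [(1 - lambda)^2] both factors [1/(1 - lambda)] are absorbed.

    With [B = N] a round with coin 1 computes the full (coordinate-wise)
    gradient.  Hence the mean square error of [average G] contracts by [1 - p]
    in each round, up to [1/(K b)] times the squared displacement of the
    iterates, and [K b p >= 1/2]; the error of each agent obeys the same
    recursion with [1/b], but enters the increments [G' - G] with the factor [p].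

    The potential is [Phi = P - P* + (P - J)/16].  The smoothness of [P] is
    replaced by the PL inequality at points of a gradient ascent path in [y],
    whose length is bounded by the gap [P - J].  Summing the recursions and
    absorbing the displacements bounds the averaged squared gradients.  As
    [b >= 1], the error of each agent at the first round is bounded by [sigma^2],
    and the third term of the bound is not needed; this makes the complexity
    estimates uniform in [K] and [N].

    Only finitely many finite-valued random variables matter in each round, so
    expectations are finite sums over the outcomes of the rounds: [law] is the
    law of the outcome of one round, [Elaw] its expectation, and [Est i f] the
    expectation of [f] at the state of round [i]. *)

(** * Frobenius inner product and averages *)

(** [P] is a supremum over [y] and is never differentiated: its descent is proved up to an arbitrary
    [eps], at a nearly stationary point of the ascent path. In the potential, the weight 1/16 lets
    the descent of [P] pay for what the move in [x] costs [J]; the gap is then absorbed if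
    [272 (L^2/nu) etax <= etay nu], where 272 = 2 * 16 * (17/16) * 8. This is why [etax] is smaller
    than [etay] by the factor [272 kappa^2]. Estimation errors and displacements bound each other,
    and the loop is closed by the smallness of [L etay]: the summed gradient errors contain 50 times
    [L^2] times the squared displacement of the averages, and under [80 L c <= 1] its product with
    [etay] is at most half of the descent, because 50/80^2 = 1/128 is half of 1/64. The squared bias
    [tau] accumulates over [T] rounds, and the prescribed [deltax], [deltay] make [tau T] equal to
    [1/(1-lambda)^2]: this is the 1 added to [Delta_0']. *)

Section FrobeniusProduct.
Variable R : realType.
Implicit Types (m n K : nat) (a b c l t : R).

Definition dotm m n (A B : 'M[R]_(m, n)) : R :=
  \sum_(i < m) \sum_(j < n) A i j * B i j.

Lemma dot0m m n (B : 'M[R]_(m, n)) : dotm 0 B = 0.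
Proof. by rewrite /dotm big1 // => i _; rewrite big1 // => j _; rewrite mxE mul0r. Qed.

Lemma sqnormE m n (A : 'M[R]_(m, n)) : sqnorm A = dotm A A.
Proof.
by rewrite /sqnorm /dotm; apply: eq_bigr => i _; apply: eq_bigr => j _; rewrite expr2.
Qed.

Lemma dotmC m n (A B : 'M[R]_(m, n)) : dotm A B = dotm B A.
Proof. by apply: eq_bigr => i _; apply: eq_bigr => j _; rewrite mulrC. Qed.

Lemma dotmDl m n (A B C : 'M[R]_(m, n)) : dotm (A + B) C = dotm A C + dotm B C.
Proof.
rewrite /dotm -big_split /=; apply: eq_bigr => i _.
by rewrite -big_split /=; apply: eq_bigr => j _; rewrite mxE mulrDl.
Qed.

Lemma dotmZl m n c (A C : 'M[R]_(m, n)) : dotm (c *: A) C = c * dotm A C.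
Proof.
rewrite /dotm mulr_sumr; apply: eq_bigr => i _.
by rewrite mulr_sumr; apply: eq_bigr => j _; rewrite mxE mulrA.
Qed.

Lemma dotmNl m n (A C : 'M[R]_(m, n)) : dotm (- A) C = - dotm A C.
Proof. by rewrite -scaleN1r dotmZl mulN1r. Qed.

Lemma dotmBl m n (A B C : 'M[R]_(m, n)) : dotm (A - B) C = dotm A C - dotm B C.
Proof. by rewrite dotmDl dotmNl. Qed.

Lemma dotmDr m n (A B C : 'M[R]_(m, n)) : dotm A (B + C) = dotm A B + dotm A C.
Proof. by rewrite dotmC dotmDl !(dotmC A). Qed.

Lemma dotmZr m n c (A B : 'M[R]_(m, n)) : dotm A (c *: B) = c * dotm A B.
Proof. by rewrite dotmC dotmZl dotmC. Qed.

Lemma dotmNr m n (A B : 'M[R]_(m, n)) : dotm A (- B) = - dotm A B.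
Proof. by rewrite dotmC dotmNl dotmC. Qed.

Lemma dotm_suml m n (I : Type) (r : seq I) (P : pred I) (F : I -> 'M[R]_(m, n)) C :
  dotm (\sum_(i <- r | P i) F i) C = \sum_(i <- r | P i) dotm (F i) C.
Proof.
apply: (big_morph (fun A => dotm A C)); first by move=> A B; rewrite dotmDl.
exact: dot0m.
Qed.

Lemma dotm_sumr m n (I : Type) (r : seq I) (P : pred I) (F : I -> 'M[R]_(m, n)) C :
  dotm C (\sum_(i <- r | P i) F i) = \sum_(i <- r | P i) dotm C (F i).
Proof. by rewrite dotmC dotm_suml; apply: eq_bigr => i _; rewrite dotmC. Qed.

Lemma sqnorm_ge0 m n (A : 'M[R]_(m, n)) : 0 <= sqnorm A.
Proof. by apply: sumr_ge0 => i _; apply: sumr_ge0 => j _; apply: sqr_ge0. Qed.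

Lemma sqnorm0 m n : sqnorm (0 : 'M[R]_(m, n)) = 0.
Proof. by rewrite /sqnorm big1 // => i _; rewrite big1 // => j _; rewrite mxE expr0n. Qed.

Lemma sqnormZ m n c (A : 'M[R]_(m, n)) : sqnorm (c *: A) = c ^+ 2 * sqnorm A.
Proof. by rewrite !sqnormE dotmZl dotmZr; ring. Qed.

Lemma sqnormN m n (A : 'M[R]_(m, n)) : sqnorm (- A) = sqnorm A.
Proof. by rewrite -scaleN1r sqnormZ sqrrN expr1n mul1r. Qed.

Lemma sqnormD m n (A B : 'M[R]_(m, n)) :
  sqnorm (A + B) = sqnorm A + 2 * dotm A B + sqnorm B.
Proof. by rewrite !sqnormE dotmDl !dotmDr (dotmC B A); ring. Qed.

Lemma sqnormB m n (A B : 'M[R]_(m, n)) :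
  sqnorm (A - B) = sqnorm A - 2 * dotm A B + sqnorm B.
Proof. by rewrite sqnormD sqnormN dotmNr; ring. Qed.

Lemma sqnormBC m n (A B : 'M[R]_(m, n)) : sqnorm (A - B) = sqnorm (B - A).
Proof. by rewrite -sqnormN opprB. Qed.

Lemma dotm_young m n t (A B : 'M[R]_(m, n)) : 0 < t ->
  2 * dotm A B <= t * sqnorm A + t^-1 * sqnorm B.
Proof.
move=> t0; have := sqnorm_ge0 (t *: A - B); rewrite sqnormB sqnormZ dotmZl => h.
rewrite -(ler_pM2l t0).
suff -> : t * (t * sqnorm A + t^-1 * sqnorm B) = t ^+ 2 * sqnorm A + sqnorm B by nra.
by field; apply/lt0r_neq0.
Qed.

Lemma dotm_le m n (A B : 'M[R]_(m, n)) : 2 * dotm A B <= sqnorm A + sqnorm B.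
Proof. by have := @dotm_young _ _ 1 A B ltr01; rewrite invr1 !mul1r. Qed.

Lemma sqnormD_le m n (A B : 'M[R]_(m, n)) :
  sqnorm (A + B) <= 2 * sqnorm A + 2 * sqnorm B.
Proof. by rewrite sqnormD; have := dotm_le A B; lra. Qed.

Lemma sqnormB_le m n (A B : 'M[R]_(m, n)) :
  sqnorm (A - B) <= 2 * sqnorm A + 2 * sqnorm B.
Proof. by rewrite -(sqnormN B) sqnormD_le. Qed.

Lemma sqnormD3_le m n (A B C : 'M[R]_(m, n)) :
  sqnorm (A + B + C) <= 3 * (sqnorm A + sqnorm B + sqnorm C).
Proof.
rewrite !sqnormD dotmDl.
by have := dotm_le A B; have := dotm_le A C; have := dotm_le B C; lra.
Qed.

Lemma sqnorm_eq0 m n (A : 'M[R]_(m, n)) : sqnorm A <= 0 -> A = 0.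
Proof.
move=> h; apply/matrixP => i j; rewrite mxE.
have : sqnorm A == 0 by rewrite eq_le h sqnorm_ge0.
rewrite psumr_eq0; last by move=> k _; apply: sumr_ge0 => l _; apply: sqr_ge0.
move=> /allP/(_ i); rewrite mem_index_enum => /(_ isT)/implyP/(_ isT).
rewrite psumr_eq0; last by move=> k _; apply: sqr_ge0.
move=> /allP/(_ j); rewrite mem_index_enum => /(_ isT)/implyP/(_ isT).
by rewrite sqrf_eq0 => /eqP.
Qed.

(** Young's inequality with weight [t = (1 - l) / l], for which [1 + t = 1 / l] and
    [1 + 1 / t = 1 / (1 - l)]. For [l = 0] this weight is undefined, but then [A = 0]. *)
Lemma sqnorm_contract m n l c (A B : 'M[R]_(m, n)) : 0 <= l -> l < 1 ->
  sqnorm A <= l ^+ 2 * c -> sqnorm (A + B) <= l * c + (1 - l)^-1 * sqnorm B.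
Proof.
move=> l0 l1 hA; have l1' : 0 < 1 - l by lra.
have [le0|lgt0] := leP l 0.
  have ll : l = 0 by lra.
  rewrite ll expr0n mul0r in hA; rewrite (sqnorm_eq0 hA) add0r ll mul0r add0r.
  by rewrite subr0 invr1 mul1r.
have t0 : 0 < (1 - l) / l by rewrite divr_gt0.
have := dotm_young A B t0; rewrite invf_div sqnormD => h.
have e1 : sqnorm A + (1 - l) / l * sqnorm A = l^-1 * sqnorm A by field; lra.
have e2 : l / (1 - l) * sqnorm B + sqnorm B = (1 - l)^-1 * sqnorm B by field; lra.
have : l^-1 * sqnorm A <= l * c.
  by rewrite ler_pdivrMl // mulrA -expr2.
by lra.
Qed.

Lemma sqnorm_rows m n (A : 'M[R]_(m, n)) : sqnorm A = \sum_(k < m) sqnorm (row k A).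
Proof.
apply: eq_bigr => k _; rewrite /sqnorm big_ord1.
by apply: eq_bigr => j _; rewrite mxE.
Qed.

Lemma sqnorm_rV n (v : 'rV[R]_n) : sqnorm v = \sum_(j < n) v 0 j ^+ 2.
Proof. by rewrite /sqnorm big_ord1. Qed.

Definition nrm m n (A : 'M[R]_(m, n)) : R := Num.sqrt (sqnorm A).

Lemma nrm_ge0 m n (A : 'M[R]_(m, n)) : 0 <= nrm A.
Proof. exact: sqrtr_ge0. Qed.

Lemma nrm_sqr m n (A : 'M[R]_(m, n)) : nrm A ^+ 2 = sqnorm A.
Proof. by rewrite sqr_sqrtr // sqnorm_ge0. Qed.

(** Cauchy-Schwarz, from Young's inequality with the balancing weight [nrm B / nrm A]; a matrix of
    norm zero is zero. *)
Lemma dotm_nrm m n (A B : 'M[R]_(m, n)) : dotm A B <= nrm A * nrm B.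
Proof.
have [B0|] := eqVneq (nrm B) 0.
  have : sqnorm B <= 0 by rewrite -nrm_sqr B0 expr0n.
  move=> /sqnorm_eq0 ->; rewrite dotmC dot0m.
  by rewrite mulr_ge0 // nrm_ge0.
have := nrm_ge0 B; rewrite le_eqVlt eq_sym => /orP[/eqP->|B0 _]; first by rewrite eqxx.
have [A0|] := eqVneq (nrm A) 0.
  have : sqnorm A <= 0 by rewrite -nrm_sqr A0 expr0n.
  move=> /sqnorm_eq0 ->; rewrite dot0m.
  by rewrite mulr_ge0 // nrm_ge0.
have := nrm_ge0 A; rewrite le_eqVlt eq_sym => /orP[/eqP->|A0 _]; first by rewrite eqxx.
have := @dotm_young _ _ (nrm B / nrm A) A B (divr_gt0 B0 A0).
rewrite -!nrm_sqr invf_div => h.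
have e1 : nrm B / nrm A * nrm A ^+ 2 = nrm A * nrm B by field; lra.
have e2 : nrm A / nrm B * nrm B ^+ 2 = nrm A * nrm B by field; lra.
by lra.
Qed.

Lemma nrmD m n (A B : 'M[R]_(m, n)) : nrm (A + B) <= nrm A + nrm B.
Proof.
rewrite -(@ler_pXn2r _ 2) ?nnegrE ?addr_ge0 ?nrm_ge0 // nrm_sqr sqnormD.
by rewrite -!nrm_sqr; have := dotm_nrm A B; nra.
Qed.

Lemma sqnorm_sum_le m n (I : finType) (F : I -> 'M[R]_(m, n)) :
  sqnorm (\sum_i F i) <= #|I|%:R * \sum_i sqnorm (F i).
Proof.
set S := \sum_i F i; have [I0|I0] := eqVneq #|I| 0%N.
  have -> : S = 0 by apply: big1 => i _; have := fintype0 i I0.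
  by rewrite sqnorm0 I0 mul0r.
have N0 : 0 < (#|I|%:R : R) by rewrite ltr0n lt0n.
have h : 0 <= \sum_i sqnorm (#|I|%:R *: F i - S) by apply: sumr_ge0 => i _; apply: sqnorm_ge0.
have e : \sum_i sqnorm (#|I|%:R *: F i - S) =
    #|I|%:R * (#|I|%:R * \sum_i sqnorm (F i) - sqnorm S).
  rewrite (eq_bigr (fun i => #|I|%:R ^+ 2 * sqnorm (F i)
     - 2 * #|I|%:R * dotm (F i) S + sqnorm S)); last first.
    by move=> i _; rewrite sqnormB sqnormZ dotmZl; ring.
  rewrite !big_split /= sumr_const sumrN -!mulr_sumr -dotm_suml -/S -sqnormE.
  by rewrite -(mulr_natr (sqnorm S)) cardT -cardE; ring.
by move: h; rewrite e pmulr_rge0 // subr_ge0.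
Qed.

Lemma rmean_ge0 N (f : 'I_N -> R) : (forall s, 0 <= f s) -> 0 <= rmean f.
Proof. by move=> h; rewrite mulr_ge0 ?invr_ge0 ?ler0n // sumr_ge0. Qed.

Lemma rmean_le N (f g : 'I_N -> R) : (forall s, f s <= g s) -> rmean f <= rmean g.
Proof. by move=> h; rewrite ler_wpM2l ?invr_ge0 ?ler0n // ler_sum. Qed.

Lemma rmeanD N (f g : 'I_N -> R) : rmean (fun s => f s + g s) = rmean f + rmean g.
Proof. by rewrite /rmean big_split mulrDr. Qed.

Lemma rmeanZ N c (f : 'I_N -> R) : rmean (fun s => c * f s) = c * rmean f.
Proof. by rewrite /rmean -mulr_sumr; ring. Qed.

Lemma rmean_cst N c : (0 < N)%N -> rmean (fun _ : 'I_N => c) = c.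
Proof.
move=> N0; rewrite /rmean sumr_const card_ord -(mulr_natr c) mulrCA mulVf ?mulr1 //.
by rewrite pnatr_eq0 -lt0n.
Qed.

Lemma eq_rmean N (f g : 'I_N -> R) : f =1 g -> rmean f = rmean g.
Proof. by move=> h; rewrite /rmean (eq_bigr _ (fun i _ => h i)). Qed.

Lemma eq_mean (V : lmodType R) N (f g : 'I_N -> V) : f =1 g -> mean f = mean g.
Proof. by move=> h; rewrite /mean (eq_bigr _ (fun i _ => h i)). Qed.

Lemma meanD (V : lmodType R) N (f g : 'I_N -> V) :
  mean (fun s => f s + g s) = mean f + mean g.
Proof. by rewrite /mean big_split scalerDr. Qed.

Lemma meanB (V : lmodType R) N (f g : 'I_N -> V) :
  mean (fun s => f s - g s) = mean f - mean g.
Proof. by rewrite /mean big_split sumrN scalerDr scalerN. Qed.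

Lemma mean_cst (V : lmodType R) N (v : V) : (0 < N)%N -> mean (fun _ : 'I_N => v) = v.
Proof.
move=> N0; rewrite /mean sumr_const card_ord -(scaler_nat N v) scalerA mulVf ?scale1r //.
by rewrite pnatr_eq0 -lt0n.
Qed.

Lemma meanZ (V : lmodType R) N c (f : 'I_N -> V) :
  mean (fun s => c *: f s) = c *: mean f.
Proof. by rewrite /mean -scaler_sumr !scalerA mulrC. Qed.

Lemma dotm_meanl m n N (f : 'I_N -> 'M[R]_(m, n)) B :
  dotm (mean f) B = rmean (fun s => dotm (f s) B).
Proof. by rewrite /mean dotmZl dotm_suml. Qed.

Lemma sqnorm_mean_le m n N (f : 'I_N -> 'M[R]_(m, n)) :
  sqnorm (mean f) <= rmean (fun s => sqnorm (f s)).
Proof.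
have [N0|N0] := posnP N.
  by move: f; rewrite N0 => f; rewrite /mean /rmean !big_ord0 scaler0 mulr0 sqnorm0.
have N0' : 0 < (N%:R : R) by rewrite ltr0n.
rewrite /mean /rmean sqnormZ; have := sqnorm_sum_le f; rewrite card_ord => h.
apply: le_trans (_ : N%:R^-1 ^+ 2 * (N%:R * \sum_i sqnorm (f i)) <= _).
  by rewrite ler_pM2l // exprn_gt0 // invr_gt0.
by rewrite le_eqVlt; apply/orP; left; apply/eqP; field; lra.
Qed.

(** Bias-variance decomposition. It is applied with [A] the mean of the exact gradients, to bound
    the variance of an oracle, and with [A = 0], to bound centered noise. *)
Lemma sqnorm_mean_minimal m n N (f : 'I_N -> 'M[R]_(m, n)) A :
  rmean (fun s => sqnorm (f s - mean f)) <= rmean (fun s => sqnorm (f s - A)).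
Proof.
have [N0|N0] := posnP N.
  by move: f; rewrite N0 => f; rewrite /rmean !big_ord0.
suff -> : rmean (fun s => sqnorm (f s - A)) =
  rmean (fun s => sqnorm (f s - mean f)) + sqnorm (mean f - A).
  by rewrite lerDl sqnorm_ge0.
rewrite (eq_rmean (g := fun s => sqnorm (f s - mean f) +
   (2 * dotm (f s - mean f) (mean f - A) + sqnorm (mean f - A)))); last first.
  by move=> s; rewrite addrA -sqnormD addrA subrK.
rewrite rmeanD rmeanD rmean_cst // rmeanZ -dotm_meanl meanB mean_cst // subrr.
by rewrite dot0m; ring.
Qed.

End FrobeniusProduct.

(** * Gradients and coordinate-wise differences *)

Section Smooth.
Variable R : realType.

Lemma derive_grad n (f : 'rV[R]_n -> R) (x v : 'rV[R]_n) :
  differentiable f x -> 'D_v f x = dotm (grad f x) v.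
Proof.
move=> df; rewrite deriveE // {1}[v]row_sum_delta linear_sum /dotm big_ord1.
apply: eq_bigr => j _; rewrite linearZ /= mxE deriveE // mulrC.
by [].
Qed.

Lemma is_derive_line n (f : 'rV[R]_n -> R) (x v : 'rV[R]_n) (t : R) :
  differentiable f (x + t *: v) ->
  is_derive t 1 (fun u : R => f (x + u *: v)) (dotm (grad f (x + t *: v)) v).
Proof.
move=> df; have dv : derivable f (x + t *: v) v by exact: diff_derivable.
have e : (fun h : R =>
    h^-1 *: (((fun u : R => f (x + u *: v)) \o shift t) (h *: 1) - f (x + t *: v)))
  = (fun h : R => h^-1 *: ((f \o shift (x + t *: v)) (h *: v) - f (x + t *: v))).
  by apply/funext => h /=; rewrite -[h%:A]/(h * 1) mulr1 scalerDl addrCA.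
apply: DeriveDef; first by rewrite /derivable e.
by rewrite -derive_grad // /derive e.
Qed.

Lemma mvt_line n (f : 'rV[R]_n -> R) (x v : 'rV[R]_n) (a b : R) :
  a <= b -> (forall z, differentiable f z) ->
  exists2 c : R, a <= c <= b &
    f (x + b *: v) - f (x + a *: v) = (b - a) * dotm (grad f (x + c *: v)) v.
Proof.
move=> ab df; pose g (u : R) := f (x + u *: v).
have dg (u : R) : is_derive u 1 g (dotm (grad f (x + u *: v)) v).
  exact: is_derive_line.
have [|c cab e] := @MVT_segment R g _ a b ab (fun u _ => dg u).
  apply: derivable_within_continuous => u _; exact: ex_derive.
exists c; first by rewrite in_itv /= in cab.
by rewrite -/(g b) -/(g a) e mulrC.
Qed.

Definition smooth_grad n (f : 'rV[R]_n -> R) (L : R) :=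
  forall x x', sqnorm (grad f x - grad f x') <= L ^+ 2 * sqnorm (x - x').

(** The constant is [L] and not [L / 2], since the gradient is compared at a single mean value point
    instead of being integrated along the segment. *)
Lemma smooth_descent n (f : 'rV[R]_n -> R) (L : R) (x v : 'rV[R]_n) :
  0 <= L -> (forall z, differentiable f z) -> smooth_grad f L ->
  `|f (x + v) - f x - dotm (grad f x) v| <= L * sqnorm v.
Proof.
move=> L0 df sf; have [c /andP[c0 c1]] := @mvt_line n f x v 0 1 ler01 df.
rewrite scale1r scale0r addr0 subr0 mul1r => ->; rewrite -dotmBl.
have h : sqnorm (grad f (x + c *: v) - grad f x) <= L ^+ 2 * sqnorm v.
  apply: le_trans (sf _ _) _; rewrite ler_wpM2l ?sqr_ge0 //.
  rewrite addrAC subrr add0r sqnormZ ler_piMl ?sqnorm_ge0 //.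
  by rewrite expr_le1.
set w := _ - _ in h *.
have hn : nrm w <= L * nrm v.
  rewrite -(@ler_pXn2r _ 2) ?nnegrE ?mulr_ge0 ?nrm_ge0 //.
  by rewrite exprMn !nrm_sqr.
have key (s : 'rV[R]_n) : nrm s <= L * nrm v -> dotm s v <= L * sqnorm v.
  move=> hs; apply: le_trans (dotm_nrm _ _) _.
  by rewrite -nrm_sqr expr2 mulrA ler_wpM2r // nrm_ge0.
rewrite ler_norml key // andbT lerNl -dotmNl key //.
by rewrite /nrm sqnormN.
Qed.


Lemma differentiable_lincomb n N (c : 'I_N -> R) (f : 'I_N -> 'rV[R]_n -> R) x :
  (forall s, differentiable (f s) x) ->
  differentiable (fun z => \sum_s c s * f s z) x.
Proof.
move=> df.
have -> : (fun z => \sum_s c s * f s z) = \sum_s (c s *: f s).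
  by apply/funext => z; rewrite fct_sumE.
by apply: differentiable_sum => s; apply: differentiableZ.
Qed.

Lemma grad_lincomb n N (c : 'I_N -> R) (f : 'I_N -> 'rV[R]_n -> R) x :
  (forall s, differentiable (f s) x) ->
  grad (fun z => \sum_s c s * f s z) x = \sum_s c s *: grad (f s) x.
Proof.
move=> df; apply/rowP => j; rewrite mxE summxE.
have -> : (fun z => \sum_s c s * f s z) = \sum_s (c s *: f s).
  by apply/funext => z; rewrite fct_sumE.
rewrite derive_sum; last by move=> s; apply: derivableZ; exact: diff_derivable.
apply: eq_bigr => s _; rewrite deriveZ; last exact: diff_derivable.
by rewrite !mxE.
Qed.

(* The mean value theorem is applied to the single function [\sum_s u_s f_s],
   where [u] is the vector of the errors: a separate intermediate point for
   each [s] would not let the averaged smoothness hypothesis be used. *)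
Lemma cw_bias n N (f : 'I_N -> 'rV[R]_n -> R) (L delta : R) x :
  0 < delta -> (forall s z, differentiable (f s) z) ->
  (forall z z', rmean (fun s => sqnorm (grad (f s) z - grad (f s) z'))
                  <= L ^+ 2 * sqnorm (z - z')) ->
  rmean (fun s => sqnorm (cw delta (f s) x - grad (f s) x))
    <= n%:R * (L ^+ 2 * delta ^+ 2).
Proof.
move=> d0 df sf.
suff h (j : 'I_n) : rmean (fun s => (cw delta (f s) x 0 j - grad (f s) x 0 j) ^+ 2)
    <= L ^+ 2 * delta ^+ 2.
  rewrite /rmean; under eq_bigr do rewrite sqnorm_rV.
  rewrite exchange_big mulr_sumr /=.
  have -> : n%:R * (L ^+ 2 * delta ^+ 2) = \sum_(j < n) L ^+ 2 * delta ^+ 2.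
    by rewrite sumr_const card_ord mulr_natl.
  apply: ler_sum => j _; apply: le_trans (h j).
  by rewrite le_eqVlt; apply/orP; left; apply/eqP/eq_rmean => s; rewrite !mxE.
pose u s := cw delta (f s) x 0 j - grad (f s) x 0 j.
pose e : 'rV[R]_n := delta_mx 0 j.
have dotme (w : 'rV[R]_n) : dotm w e = w 0 j.
  rewrite /dotm big_ord1 (bigD1 j) //= mxE !eqxx mulr1 big1 ?addr0 // => i ij.
  by rewrite mxE (negPf ij) andbF mulr0.
have [||c /andP[c1 c2]] := @mvt_line _ (fun z => \sum_s u s * f s z) x e (- delta) delta.
- by lra.
- by move=> z; apply: differentiable_lincomb => s; exact: df.
rewrite grad_lincomb; last by move=> s; exact: df.
rewrite dotme summxE -sumrB => mvt.
pose D s := grad (f s) (x + c *: e) 0 j - grad (f s) x 0 j.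
(* [D] is the increment of the gradients at the common mean value point. Once [sum u^2 = sum u D] is
   known, expanding [sum (D - u)^2 >= 0] gives [sum u^2 <= sum D^2]. *)
have uu : \sum_s u s * u s = \sum_s u s * D s.
  transitivity (\sum_s (u s * cw delta (f s) x 0 j) - \sum_s u s * grad (f s) x 0 j).
    by rewrite -sumrB; apply: eq_bigr => s _; rewrite -mulrBr.
  transitivity (\sum_s u s * grad (f s) (x + c *: e) 0 j - \sum_s u s * grad (f s) x 0 j);
    last by rewrite -sumrB; apply: eq_bigr => s _; rewrite -mulrBr.
  congr (_ - _).
  transitivity ((2 * delta)^-1
      * \sum_s (u s * f s (x + delta *: e) - u s * f s (x + - delta *: e))).
    rewrite mulr_sumr; apply: eq_bigr => s _.
    by rewrite /cw mxE scaleNr -/e; field; lra.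
  rewrite mvt; under [in LHS]eq_bigr do rewrite mxE.
  by field; lra.
have hD : rmean (fun s => D s ^+ 2) <= L ^+ 2 * delta ^+ 2.
  apply: le_trans (_ : L ^+ 2 * sqnorm (x + c *: e - x) <= _).
    apply: le_trans (sf _ _); apply: rmean_le => s.
    have -> : D s = (grad (f s) (x + c *: e) - grad (f s) x) 0 j by rewrite /D !mxE.
    by rewrite sqnorm_rV (bigD1 j) //= lerDl sumr_ge0 // => i _; exact: sqr_ge0.
  rewrite ler_wpM2l ?sqr_ge0 // addrAC subrr add0r sqnormZ sqnormE dotme mxE !eqxx mulr1.
  by nra.
apply: le_trans hD; rewrite /rmean ler_wpM2l ?invr_ge0 ?ler0n // -subr_ge0.
have : 0 <= \sum_s (D s - u s) ^+ 2 by apply: sumr_ge0 => s _; exact: sqr_ge0.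
suff -> : \sum_s (D s - u s) ^+ 2 =
    \sum_i D i ^+ 2 - \sum_i (cw delta (f i) x 0 j - grad (f i) x 0 j) ^+ 2 by [].
transitivity (\sum_i D i ^+ 2 - 2 * \sum_s u s * D s + \sum_s u s * u s).
  rewrite mulr_sumr -sumrN -!big_split /=.
  by apply: eq_bigr => s _; move: (D s) (u s) => a b; ring.
have -> : \sum_i (cw delta (f i) x 0 j - grad (f i) x 0 j) ^+ 2 = \sum_s u s * u s.
  by apply: eq_bigr => s _; rewrite expr2.
by rewrite -uu; ring.
Qed.

End Smooth.

(** * Descent under the Polyak-Lojasiewicz condition *)

Section PolyakLojasiewicz.
Variable R : realType.

(* Gradient ascent with step 1/(2L): the square root of the gap decreases by at
   least [sqrt (2 nu) / 4] times the length of each step, so that the length of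
   the whole path is bounded by the initial gap. *)
Lemma PL_ascent n (f : 'rV[R]_n -> R) (L nu P : R) (y : 'rV[R]_n) (eps : R) :
  0 < L -> 0 < nu -> (forall z, differentiable f z) -> smooth_grad f L ->
  (forall z, f z <= P) -> (forall z, 2 * nu * (P - f z) <= sqnorm (grad f z)) ->
  0 < eps ->
  exists2 y', sqnorm (grad f y') <= eps & sqnorm (y' - y) <= 8 / nu * (P - f y).
Proof.
move=> L0 nu0 df sf fP PL eps0.
pose step z := z + (2 * L)^-1 *: grad f z.
pose it k := iter k step y.
pose r z := Num.sqrt (P - f z).
have r0 z : 0 <= r z by exact: sqrtr_ge0.
have r2 z : r z ^+ 2 = P - f z by rewrite sqr_sqrtr // subr_ge0.
pose mu := Num.sqrt (2 * nu).
have mu0 : 0 < mu by rewrite sqrtr_gt0 mulr_gt0.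
have mu2 : mu ^+ 2 = 2 * nu by rewrite sqr_sqrtr // ltW // mulr_gt0.
(* A step [1 / (2 L)] gains [1 / (2 L) - L / (2 L)^2 = 1 / (4 L)] times the squared gradient. *)
have gain z : (4 * L)^-1 * sqnorm (grad f z) <= f (step z) - f z.
  have := smooth_descent z ((2 * L)^-1 *: grad f z) (ltW L0) df sf.
  rewrite -/(step z) dotmZr -sqnormE sqnormZ ler_norml => /andP[+ _].
  set g := sqnorm _; have -> : L * ((2 * L)^-1 ^+ 2 * g) = (4 * L)^-1 * g by field; lra.
  have -> : (2 * L)^-1 * g = 2 * ((4 * L)^-1 * g) by field; lra.
  by lra.
have len z : nrm (step z - z) <= 4 / mu * (r z - r (step z)).
  have -> : nrm (step z - z) = (2 * L)^-1 * nrm (grad f z).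
    rewrite /nrm addrAC subrr add0r sqnormZ sqrtrM ?sqr_ge0 // sqrtr_sqr ger0_norm //.
    by rewrite invr_ge0; lra.
  set g := nrm _; have g0 : 0 <= g by exact: nrm_ge0.
  have hg : (4 * L)^-1 * g ^+ 2 <= r z ^+ 2 - r (step z) ^+ 2.
    by rewrite nrm_sqr !r2; have := gain z; lra.
  have hmu : mu * r z <= g.
    rewrite -(@ler_pXn2r _ 2) ?nnegrE ?mulr_ge0 ?(ltW mu0) //.
    by rewrite exprMn mu2 r2 nrm_sqr.
  have Li0 : 0 < (4 * L)^-1 by rewrite invr_gt0; lra.
  have e : (2 * L)^-1 = 2 * (4 * L)^-1 by field; lra.
  have := r0 z; have := r0 (step z); rewrite e; move: Li0 hg hmu g0.
  set l := (4 * L)^-1; move: (r z) (r (step z)) g => a b g {e} l0 hg hmu g0 b0 a0.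
  have ba : b <= a by rewrite -(@ler_pXn2r _ 2) ?nnegrE //; nra.
  rewrite -ler_pdivrMl ?divr_gt0 // invf_div.
  have [az|az] := leP a 0.
    have -> : g = 0; last by lra.
    have : l * g ^+ 2 <= 0 by nra.
    by rewrite pmulr_rle0 // => gg; apply/eqP; rewrite -sqrf_eq0 eq_le gg sqr_ge0.
  (* Since [a^2 - b^2 <= 2 a (a - b)] and, by PL, [mu a <= g], dividing by [a] turns the decrease of
     the gap into a decrease of its square root, which telescopes. *)
  have h1 : l * g ^+ 2 <= (a - b) * (2 * a) by nra.
  have h2 : l * g * (mu * a) <= l * g ^+ 2.
    by rewrite expr2 (mulrA l g g) ler_wpM2l // mulr_ge0 // ltW.
  rewrite -(ler_pM2r (_ : 0 < 2 * a)); last by lra.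
  by apply: le_trans h1; apply: le_trans h2; rewrite le_eqVlt; apply/orP; left; apply/eqP; field.
have path k : nrm (it k - y) <= 4 / mu * (r y - r (it k)).
  elim: k => [|k IH]; first by rewrite /it /= !subrr mulr0 /nrm sqnorm0 sqrtr0.
  have -> : it k.+1 - y = (step (it k) - it k) + (it k - y) by rewrite addrA subrK.
  apply: le_trans (nrmD _ _) _; have := len (it k); rewrite -[it k.+1]/(step (it k)).
  by rewrite !mulrBr in IH *; lra.
have dist k : sqnorm (it k - y) <= 8 / nu * (P - f y).
  rewrite -nrm_sqr -r2.
  have -> : 8 / nu * r y ^+ 2 = (4 / mu * r y) ^+ 2.
    by rewrite exprMn exprMn exprVn mu2; field; lra.
  rewrite ler_pXn2r ?nnegrE ?nrm_ge0 ?mulr_ge0 ?invr_ge0 ?(ltW mu0) //.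
  apply: le_trans (path k) _; rewrite ler_wpM2l ?divr_ge0 ?(ltW mu0) //.
  by have := r0 (it k); lra.
(* No limit of the path is taken: if every iterate had squared gradient above [eps], [f] would grow
   by at least [eps / (4 L)] per step and exceed [P]. *)
have [[k hk]|H] := pselect (exists k, sqnorm (grad f (it k)) <= eps).
  by exists (it k).
exfalso.
have dec k : k%:R * ((4 * L)^-1 * eps) <= f (it k) - f y.
  elim: k => [|k IH]; first by rewrite mul0r subrr.
  have : eps < sqnorm (grad f (it k)) by rewrite ltNge; apply/negP => hk; apply: H; exists k.
  have := gain (it k); rewrite -[it k.+1]/(step (it k)).
  have -> q : k.+1%:R * q = k%:R * q + q :> R by rewrite -natr1 mulrDl mul1r.
  have Li0 : 0 < (4 * L)^-1 by rewrite invr_gt0; lra.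
  move=> h1 h2; rewrite -(ltr_pM2l Li0) in h2; lra.
have q0 : 0 < (4 * L)^-1 * eps by rewrite mulr_gt0 // invr_gt0; lra.
have [k hk] : exists k : nat, (P - f y) / ((4 * L)^-1 * eps) < k%:R.
  exists (Num.bound ((P - f y) / ((4 * L)^-1 * eps))).
  by apply: archi_boundP; rewrite divr_ge0 ?(ltW q0) // subr_ge0.
by move: hk; rewrite ltr_pdivrMr //; have := dec k; have := fP (it k); lra.
Qed.

Variables (d1 d2 : nat) (J : 'rV[R]_d1 -> 'rV[R]_d2 -> R) (P : 'rV[R]_d1 -> R).
Variables (L nu : R).
Hypotheses (nu0 : 0 < nu) (nuL : nu <= L).
Hypothesis dJx : forall y z, differentiable (J ^~ y) z.
Hypothesis dJy : forall x z, differentiable (J x) z.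
Hypothesis smx : forall x y x' y',
  sqnorm (gradx J x y - gradx J x' y') <= L ^+ 2 * (sqnorm (x - x') + sqnorm (y - y')).
Hypothesis smy : forall x y x' y',
  sqnorm (grady J x y - grady J x' y') <= L ^+ 2 * (sqnorm (x - x') + sqnorm (y - y')).
Hypothesis JP : forall x y, J x y <= P x.
Hypothesis PL : forall x y, 2 * nu * (P x - J x y) <= sqnorm (grady J x y).

Let L0 : 0 < L. Proof. by have := nu0; have := nuL; lra. Qed.

Let smgx y : smooth_grad (J ^~ y) L.
Proof. by move=> x x'; have := smx x y x' y; rewrite subrr sqnorm0 addr0. Qed.

Let smgy x : smooth_grad (J x) L.
Proof. by move=> y y'; have := smy x y x y'; rewrite subrr sqnorm0 add0r. Qed.

(** Let [yt] be reached by ascent from [y] in the fibre over [x]. At the new point [P] is compared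
    with [J] at [yt] by the PL inequality, [J] varies smoothly in [x], and [J x yt <= P x]. Using
    the gradient at [y] instead of [yt] costs [L^2] times the squared distance to [yt], hence the
    gap [P x - J x y]. *)
Lemma primal_step x y gx etax : 0 < etax -> 8 * (L ^+ 2 / nu) * etax <= 1 ->
  P (x - etax *: gx) <= P x - etax / 4 * sqnorm gx
    + 8 * etax * (L ^+ 2 / nu) * (P x - J x y) + etax * sqnorm (gx - gradx J x y).
Proof.
move=> eta0 etale; apply/ler_addgt0Pr => eps eps0.
have e1 : 0 < nu * eps by rewrite mulr_gt0.
have [yt grad_yt dist_yt] := PL_ascent y L0 nu0 (dJy x) (smgy x) (JP x) (PL x) e1.
pose v := - (etax *: gx).
have nv : sqnorm v = etax ^+ 2 * sqnorm gx by rewrite sqnormN sqnormZ.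
have hJ : J (x + v) yt <= J x yt + dotm (gradx J x yt) v + L * sqnorm v.
  have := smooth_descent x v (ltW L0) (dJx yt) (smgx yt).
  by rewrite ler_norml => /andP[_]; rewrite /gradx; lra.
(* [yt] remains nearly stationary when [x] moves by [v], so the PL inequality at the new point
   bounds its gap. *)
have hP : nu * (P (x + v) - J (x + v) yt) <= nu * eps + L ^+ 2 * sqnorm v.
  have := PL (x + v) yt; have := sqnormD_le (grady J x yt) (grady J (x + v) yt - grady J x yt).
  rewrite addrC subrK; have := smy (x + v) yt x yt.
  by rewrite subrr sqnorm0 addr0 addrAC subrr add0r; lra.
have hP' : P (x + v) - J (x + v) yt <= eps + L ^+ 2 / nu * sqnorm v.
  rewrite -(ler_pM2l nu0); apply: le_trans hP _.
  by rewrite mulrDr mulrA (mulrC nu (_ / _)) divfK // lt0r_neq0.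
have hd : 2 * dotm (gradx J x yt) v <= - etax * sqnorm gx
    + 2 * etax * (8 * (L ^+ 2 / nu) * (P x - J x y)) + 2 * etax * sqnorm (gx - gradx J x y).
  clear hJ hP hP' grad_yt e1 nv etale.
  have -> : 2 * dotm (gradx J x yt) v = - etax * sqnorm gx - etax * sqnorm (gradx J x yt)
      + etax * sqnorm (gx - gradx J x yt).
    by rewrite sqnormB dotmNr dotmZr (dotmC gx); ring.
  have := sqnormD_le (gx - gradx J x y) (gradx J x y - gradx J x yt).
  rewrite addrA subrK; have := smx x y x yt.
  rewrite subrr sqnorm0 add0r (sqnormBC y) => h1 h2.
  have h3 : L ^+ 2 * sqnorm (yt - y) <= 8 * (L ^+ 2 / nu) * (P x - J x y).
    apply: le_trans (_ : L ^+ 2 * (8 / nu * (P x - J x y)) <= _).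
      by rewrite ler_wpM2l // sqr_ge0.
    by rewrite le_eqVlt; apply/orP; left; apply/eqP; field; exact: lt0r_neq0.
  have h4 : sqnorm (gx - gradx J x yt) <= 2 * sqnorm (gx - gradx J x y)
      + 2 * (8 * (L ^+ 2 / nu) * (P x - J x y)).
    by apply: le_trans h2 _; rewrite lerD2l ler_pM2l //; exact: le_trans h1 h3.
  rewrite -(ler_pM2l eta0) in h4.
  rewrite -[X in _ <= X]addrA; apply: lerD.
    by rewrite lerBlDr lerDl mulr_ge0 ?sqnorm_ge0 // ltW.
  by apply: le_trans h4 _; rewrite mulrDr addrC !(mulrCA etax 2) !(mulrA 2 etax).
(* As [nu <= L], both second order terms fit in [2 L^2/nu]; the step size condition then makes them
   at most a quarter of [etax * sqnorm gx]. *)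
have hL : L <= L ^+ 2 / nu by rewrite ler_pdivlMr // expr2 ler_pM2l.
have hv : (L + L ^+ 2 / nu) * sqnorm v <= etax / 4 * sqnorm gx.
  rewrite nv; apply: le_trans (_ : (2 * (L ^+ 2 / nu)) * (etax ^+ 2 * sqnorm gx) <= _).
    by rewrite ler_wpM2r ?mulr_ge0 ?sqnorm_ge0 ?sqr_ge0 //; lra.
  by have := ler_wpM2r (mulr_ge0 (ltW eta0) (sqnorm_ge0 gx)) etale; lra.
by have := JP x yt; rewrite -/v; lra.
Qed.

(** The move is split: first [x], at a cost proportional to [etax], then [y], whose gain is driven
    by the gradient at the intermediate point. Comparing that gradient with the one at the start
    produces the terms in [L^2 etax^2], which the step sizes make small. *)
Lemma ascent_step x y gx gy etax etay :
  0 < etax -> 0 < etay -> 8 * L * etax <= 1 -> 8 * L * etay <= 1 ->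
  J x y - 7 / 4 * etax * sqnorm gx - etax / 2 * sqnorm (gx - gradx J x y)
    + etay * nu / 2 * (P x - J x y) + etay / 4 * sqnorm gy
    - etay * sqnorm (gy - grady J x y)
  <= J (x - etax *: gx) (y + etay *: gy).
Proof.
move=> ex0 ey0 exL eyL.
pose v := - (etax *: gx).
have nv : sqnorm v = etax ^+ 2 * sqnorm gx by rewrite sqnormN sqnormZ.
have h1 : J x y + dotm (gradx J x y) v - L * sqnorm v <= J (x + v) y.
  have := smooth_descent x v (ltW L0) (dJx y) (smgx y).
  by rewrite ler_norml => /andP[+ _]; rewrite /gradx; lra.
have h2 : J (x + v) y + etay * dotm (grady J (x + v) y) gy - L * (etay ^+ 2 * sqnorm gy)
    <= J (x + v) (y + etay *: gy).
  have := smooth_descent y (etay *: gy) (ltW L0) (dJy (x + v)) (smgy (x + v)).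
  by rewrite ler_norml sqnormZ dotmZr => /andP[+ _]; rewrite /grady; lra.
have h3 : - (3 / 2 * sqnorm gx + 1 / 2 * sqnorm (gx - gradx J x y)) <= - dotm (gradx J x y) gx.
  have -> : dotm (gradx J x y) gx = sqnorm gx - dotm (gx - gradx J x y) gx.
    by rewrite dotmBl -sqnormE; ring.
  have := dotm_le (- (gx - gradx J x y)) gx; rewrite dotmNl sqnormN.
  by have := sqnorm_ge0 gx; lra.
have h3' : - (3 / 2 * (etax * sqnorm gx) + 1 / 2 * (etax * sqnorm (gx - gradx J x y)))
    <= dotm (gradx J x y) v.
  rewrite dotmNr dotmZr.
  by move: h3; rewrite -(ler_pM2l ex0); lra.
set A := grady J (x + v) y in h2.
have hA : sqnorm (A - grady J x y) <= L ^+ 2 * (etax ^+ 2 * sqnorm gx).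
  have := smy (x + v) y x y.
  by rewrite subrr sqnorm0 addr0 addrAC subrr add0r nv.
have h4 : nu * (P x - J x y) - L ^+ 2 * (etax ^+ 2 * sqnorm gx) <= sqnorm A.
  have := sqnormD_le A (grady J x y - A); rewrite addrC subrK (sqnormBC _ A).
  by have := PL x y; lra.
have h5 : sqnorm (A - gy) <= 2 * sqnorm (gy - grady J x y)
    + 2 * (L ^+ 2 * (etax ^+ 2 * sqnorm gx)).
  have := sqnormB_le (A - grady J x y) (gy - grady J x y).
  by rewrite opprB addrA subrK; lra.
(* Polarization: [|A|^2 / 2] feeds the PL inequality, [|gy|^2 / 2] is the gain that will absorb
   displacements, and [|A - gy|^2 / 2] is the estimation error. *)
have h6 : nu / 2 * (P x - J x y) + sqnorm gy / 2 - sqnorm (gy - grady J x y)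
    - 3 / 2 * (L ^+ 2 * (etax ^+ 2 * sqnorm gx)) <= dotm A gy.
  by have := sqnormB A gy; lra.
have h6' := h6; rewrite -(ler_pM2l ey0) in h6'.
have q1 : L * (etay ^+ 2 * sqnorm gy) <= etay * sqnorm gy / 8.
  have : 0 <= etay * sqnorm gy by rewrite mulr_ge0 ?sqnorm_ge0 // ltW.
  by move=> h; have := ler_wpM2r h eyL; lra.
have q0 : 0 <= etax * sqnorm gx by rewrite mulr_ge0 ?sqnorm_ge0 // ltW.
have q2 : L * sqnorm v <= etax * sqnorm gx / 8.
  by rewrite nv; have := ler_wpM2r q0 exL; lra.
have q3 : etay * (L ^+ 2 * (etax ^+ 2 * sqnorm gx)) <= etax * sqnorm gx / 64.
  have -> : etay * (L ^+ 2 * (etax ^+ 2 * sqnorm gx))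
      = (8 * L * etay) * ((8 * L * etax) * (etax * sqnorm gx)) / 64.
    by field.
  have p1 := ler_wpM2r q0 exL.
  have p2 : 0 <= 8 * L * etax * (etax * sqnorm gx).
    by rewrite mulr_ge0 // mulr_ge0 ?(ltW ex0) // mulr_ge0 // ltW.
  by have := ler_wpM2r p2 eyL; lra.
have := mulr_ge0 (ltW ey0) (sqnorm_ge0 gy).
by rewrite -/v; lra.
Qed.

(** Of the [17/64 etax |gx|^2] gained through [P], the term in [J] consumes [7/64]. The gap has
    coefficient [17/16 * 8 etax L^2/nu - etay nu / 32], which the last hypothesis makes
    nonpositive. *)
Lemma potential_step x y gx gy etax etay :
  0 < etax -> 0 < etay -> 8 * (L ^+ 2 / nu) * etax <= 1 -> 8 * L * etay <= 1 ->
  272 * (L ^+ 2 / nu) * etax <= etay * nu ->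
  let Phi x y := P x + (P x - J x y) / 16 in
  Phi (x - etax *: gx) (y + etay *: gy) <= Phi x y
    - etax / 8 * sqnorm gx - etay / 64 * sqnorm gy
    + 2 * etax * sqnorm (gx - gradx J x y) + etay * sqnorm (gy - grady J x y).
Proof.
move=> ex0 ey0 hx hy hxy /=.
have hL : L <= L ^+ 2 / nu by rewrite ler_pdivlMr // expr2 ler_pM2l // L0.
have hx' : 8 * L * etax <= 1.
  by apply: le_trans hx; rewrite ler_pM2r // ler_pM2l.
have := primal_step x y gx ex0 hx; have := ascent_step x y gx gy ex0 ey0 hx' hy.
have a0 : 0 <= P x - J x y by rewrite subr_ge0.
have := ler_wpM2r a0 hxy.
have := mulr_ge0 (ltW ex0) (sqnorm_ge0 gx).
have := mulr_ge0 (ltW ey0) (sqnorm_ge0 (gy - grady J x y)).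
have := mulr_ge0 (ltW ex0) (sqnorm_ge0 (gx - gradx J x y)).
by lra.
Qed.

End PolyakLojasiewicz.

(** * Spectral gap of the gossip matrix *)

Section Gossip.
Variables (R : realType) (K : nat).
Implicit Types (W Y : 'M[R]_K) (v : 'rV[R]_K).

Lemma stochastic_expr W m : doubly_stochastic W ->
  (forall i, \sum_j (W ^+ m) i j = 1) /\ (forall j, \sum_i (W ^+ m) i j = 1).
Proof.
move=> [_ hr hc]; elim: m => [|m [IHr IHc]].
  rewrite expr0; split=> i; rewrite (bigD1 i) //= mxE eqxx big1 ?addr0 // => j ij.
    by rewrite mxE eq_sym (negPf ij).
  by rewrite mxE (negPf ij).
rewrite exprS -mulmxE; split=> i; under eq_bigr do rewrite mxE; rewrite exchange_big /=.
  by under eq_bigr do rewrite -mulr_sumr IHr mulr1; exact: hr.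
by under eq_bigr do rewrite -mulr_suml hc mul1r; exact: IHc.
Qed.

(** With nonnegative weights the left side is nonnegative, which bounds eigenvalues by 1; with
    positive weights it vanishes only on constant vectors. This takes the place of
    Perron-Frobenius. *)
Lemma dirichlet_form Y v :
  (forall i, \sum_j Y i j = 1) -> (forall j, \sum_i Y i j = 1) ->
  \sum_i \sum_j Y i j * (v 0 i - v 0 j) ^+ 2
    = 2 * (sqnorm v - dotm (v *m Y) v).
Proof.
move=> hr hc.
transitivity (\sum_i \sum_j (Y i j * v 0 i ^+ 2 + Y i j * v 0 j ^+ 2
    - 2 * (v 0 i * Y i j * v 0 j))).
  by apply: eq_bigr => i _; apply: eq_bigr => j _; ring.
under eq_bigr do rewrite !big_split /= sumrN.
rewrite !big_split /= sumrN.
have -> : \sum_i \sum_j Y i j * v 0 i ^+ 2 = sqnorm v.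
  by rewrite sqnorm_rV; apply: eq_bigr => i _; rewrite -mulr_suml hr mul1r.
have -> : \sum_i \sum_j Y i j * v 0 j ^+ 2 = sqnorm v.
  by rewrite exchange_big sqnorm_rV; apply: eq_bigr => i _; rewrite -mulr_suml hc mul1r.
have -> : \sum_i \sum_j 2 * (v 0 i * Y i j * v 0 j) = 2 * dotm (v *m Y) v.
  rewrite exchange_big /dotm big_ord1 mulr_sumr; apply: eq_bigr => j _.
  by rewrite mxE mulr_suml mulr_sumr.
by ring.
Qed.

Lemma stochastic_eigenvalue_le1 W v a : doubly_stochastic W ->
  v *m W = a *: v -> v != 0 -> a <= 1.
Proof.
move=> [h0 hr hc] hv v0; have := dirichlet_form v hr hc.
rewrite hv dotmZl -sqnormE => e.
have : 0 <= 2 * (sqnorm v - a * sqnorm v).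
  rewrite -e; apply: sumr_ge0 => i _; apply: sumr_ge0 => j _.
  by rewrite mulr_ge0 // sqr_ge0.
have sv : 0 < sqnorm v.
  rewrite lt_def sqnorm_ge0 andbT; apply: contra v0 => /eqP s0.
  by apply/eqP/sqnorm_eq0; rewrite s0.
by move=> h; rewrite -(ler_pM2r sv); lra.
Qed.

(** [v] is also fixed by the positive power [W ^+ m], whose Dirichlet form at [v] is therefore zero,
    term by term. *)
Lemma primitive_fixed_const W v : doubly_stochastic W -> primitive W ->
  v *m W = v -> forall i j, v 0 i = v 0 j.
Proof.
move=> ds [m Wm] hv i j.
have hvm : v *m (W ^+ m) = v.
  elim: (m) => [|k IH]; first by rewrite expr0 mulmx1.
  by rewrite exprS -mulmxE mulmxA hv.
have [hr hc] := stochastic_expr m ds.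
have := dirichlet_form v hr hc; rewrite hvm -sqnormE subrr mulr0 => /eqP.
have p i' j' : 0 <= (W ^+ m) i' j' * (v 0 i' - v 0 j') ^+ 2.
  by rewrite mulr_ge0 ?sqr_ge0 ?ltW.
rewrite psumr_eq0; last by move=> i' _; apply: sumr_ge0 => j' _.
move=> /allP/(_ i); rewrite mem_index_enum => /(_ isT)/implyP/(_ isT).
rewrite psumr_eq0; last by move=> j' _.
move=> /allP/(_ j); rewrite mem_index_enum => /(_ isT)/implyP/(_ isT).
by rewrite mulf_eq0 gt_eqF //= sqrf_eq0 subr_eq0 => /eqP.
Qed.

End Gossip.

Section SpectralGap.
Import complex.
Variables (R : realType) (K : nat) (W : 'M[R]_K) (lambda : R).
Hypotheses (K2 : (2 <= K)%N) (netW : network_assumption W lambda).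
Hypothesis psdW : possemidef W.

(** [W] is complexified in order to diagonalize it as a normal matrix: the rows of the unitary [P]
    are left eigenvectors and [D] lists their eigenvalues. *)
Let C := R[i].
Let inC : {rmorphism R -> C} := real_complex R.
Let Wc : 'M[C]_K := map_mx inC W.
Let P := spectralmx Wc.
Let D := spectral_diag Wc.

Let Wc_normal : Wc \is normalmx.
Proof.
have [WT _ _ _] := netW.
apply: symmetric_normalmx.
  by apply/is_hermitianmxP; rewrite expr0 scale1r map_mx_id // /Wc map_trmx WT.
apply/mxOverP => i j; rewrite mxE.
by rewrite complex_real eqxx.
Qed.

Let WcE : Wc = invmx P *m diag_mx D *m P.
Proof. exact/orthomx_spectralP. Qed.

Let PWc : P *m Wc = diag_mx D *m P.
Proof. by rewrite {1}WcE -mulmxA mulKVmx // spectral_unit. Qed.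

(** Ties [D] to the list of eigenvalues that defines [lambda]: both are the roots, with
    multiplicity, of the same characteristic polynomial. *)
Let char_Wc : char_poly Wc = \prod_(a <- [seq D 0 i | i : 'I_K]) ('X - a%:P).
Proof.
have e : char_poly Wc = char_poly (diag_mx D).
  have Pu : \det (map_mx polyC P) != 0.
    by rewrite det_map_mx polyC_eq0 -unitfE -unitmxE spectral_unit.
  apply: (mulfI Pu); rewrite [RHS]mulrC /char_poly -!det_mulmx /char_poly_mx.
  rewrite mulmxBr mulmxBl -!map_mxM PWc.
  by congr (\det (_ - _)); rewrite scalar_mxC.
rewrite e char_poly_trig; last exact: diag_mx_is_trig.
rewrite big_image.
by apply: eq_bigr => i _; rewrite mxE eqxx.
Qed.

(** The real and imaginary parts of such a row are each fixed by the real matrix [W], hence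
    constant. *)
Let row_P_const i : D 0 i = 1 -> forall j k, P i j = P i k.
Proof.
move=> Di; have [_ ds pr _] := netW.
have fix_row : row i P *m Wc = row i P.
  by rewrite -row_mul PWc row_mul row_diag_mx Di scale1r -rowE.
have re_const : forall j k, Re (P i j) = Re (P i k).
  have hv : \row_j Re (P i j) *m W = \row_j Re (P i j).
    apply/rowP => j; rewrite !mxE.
    have /rowP/(_ j) := fix_row; rewrite !mxE => <-; rewrite raddf_sum.
    apply: eq_bigr => k _; rewrite !mxE; case: (P i k) => a b /=.
    by rewrite mulr0 subr0.
  by move=> j k; have := primitive_fixed_const ds pr hv j k; rewrite !mxE.
have im_const : forall j k, Im (P i j) = Im (P i k).
  have hv : \row_j Im (P i j) *m W = \row_j Im (P i j).
    apply/rowP => j; rewrite !mxE.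
    have /rowP/(_ j) := fix_row; rewrite !mxE => <-; rewrite raddf_sum.
    apply: eq_bigr => k _; rewrite !mxE; case: (P i k) => a b /=.
    by rewrite mulr0 add0r.
  by move=> j k; have := primitive_fixed_const ds pr hv j k; rewrite !mxE.
by move=> j k; have := re_const j k; have := im_const j k;
  case: (P i j) (P i k) => a b [c d] /= -> ->.
Qed.

(** Two constant rows with distinct indices would be proportional, which is impossible in the
    invertible matrix [P]. *)
Let simple1 i j : D 0 i = 1 -> D 0 j = 1 -> i = j.
Proof.
move=> /row_P_const ci /row_P_const cj; apply/eqP/negPn/negP => ij.
have k0 : 'I_K := i.
have h : P j k0 *: row i P = P i k0 *: row j P.
  by apply/rowP => k; rewrite !mxE (ci k k0) (cj k k0) mulrC.
have : row i P *m invmx P = delta_mx 0 i by rewrite -row_mul mulmxV ?spectral_unit // row1.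
have : row j P *m invmx P = delta_mx 0 j by rewrite -row_mul mulmxV ?spectral_unit // row1.
move=> ej ei.
have /rowP hi : P j k0 *: (delta_mx 0 i : 'rV_K) = P i k0 *: delta_mx 0 j.
  by rewrite -ei -ej !scalemxAl h.
have := hi j; rewrite !mxE eqxx [j == i]eq_sym (negPf ij) !eqxx mulr0 mulr1 => Pi0.
have /rowP/(_ i) := ei; rewrite !mxE !eqxx big1; last first.
  by move=> k _; rewrite mxE (ci k k0) -Pi0 mul0r.
by move/eqP; rewrite eq_sym oner_eq0.
Qed.

(** Positive semidefiniteness puts all eigenvalues in [0, 1], so the head of the list sorted by
    magnitude is the eigenvalue 1. It is simple, so the next entry, [lambda], is below 1 and bounds
    all the others. *)
Lemma spectral_gap :
  0 <= lambda < 1 /\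
  forall i, D 0 i = 1 \/ exists2 t : R, D 0 i = inC t & 0 <= t <= lambda.
Proof.
have [WT ds pr [s [chs sorts ls]]] := netW.
have ps : perm_eq [seq inC a | a <- s] [seq D 0 i | i : 'I_K].
  apply: prod_XsubC_eq; rewrite -char_Wc big_map -map_prod_XsubC -chs.
  exact: map_char_poly.
have szs : size s = K by have := perm_size ps; rewrite size_map size_image card_ord.
have s01 a : a \in s -> 0 <= a <= 1.
  move=> sa; have : eigenvalue W a by rewrite eigenvalue_root_char chs root_prod_XsubC.
  move=> /eigenvalueP [v hv v0]; rewrite (stochastic_eigenvalue_le1 ds hv v0) andbT.
  have := psdW v; rewrite hv -scalemxAl mxE.
  have -> : (v *m v^T) 0 0 = sqnorm v.
    by rewrite sqnorm_rV mxE; apply: eq_bigr => k _; rewrite mxE expr2.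
  rewrite pmulr_lge0 // lt_def sqnorm_ge0 andbT; apply: contra v0 => /eqP e.
  by apply/eqP/sqnorm_eq0; rewrite e.
have one_s : 1 \in s.
  rewrite -root_prod_XsubC -chs -eigenvalue_root_char; apply/eigenvalueP.
  exists (const_mx 1).
    rewrite scale1r; apply/rowP => j; rewrite !mxE; case: ds => _ _ /(_ j) hj; rewrite -[RHS]hj.
    by apply: eq_bigr => k _; rewrite mxE mul1r.
  apply/negP => /eqP/rowP/(_ (Ordinal (ltnW K2))); rewrite !mxE => /eqP.
  by rewrite oner_eq0.
(* With at least two agents the entry of [s] at position 1 is genuine and not the default 0. *)
have sz2 : (2 <= size s)%N by rewrite szs.
move: sz2 ps sorts ls s01 one_s {chs szs}.
case: s => [//|s0 [//|s1 s']] /= _.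
move=> ps /andP[s10 ss'] -> s01 one_s.
have tr : transitive (fun a b : R => `|b| <= `|a|) by move=> a b c h1 h2; apply: le_trans h1.
have le_s1 a : a \in s1 :: s' -> a <= s1.
  rewrite inE => /orP[/eqP -> //|sa].
  have /allP/(_ a sa) := order_path_min tr ss'.
  have /andP[p1 _] : 0 <= s1 <= 1 by apply: s01; rewrite !inE eqxx orbT.
  have /andP[p2 _] : 0 <= a <= 1 by apply: s01; rewrite !inE sa !orbT.
  by rewrite !ger0_norm.
have s00 : s0 = 1.
  move: one_s; rewrite inE => /orP[/eqP // | one_t].
  have h1 := le_s1 _ one_t.
  have /andP[p1 p2] := s01 s0 (mem_head _ _).
  have /andP[p3 p4] : 0 <= s1 <= 1 by apply: s01; rewrite !inE eqxx orbT.
  move: s10; rewrite !ger0_norm // => p5; apply/eqP; rewrite eq_le p2 /=.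
  exact: le_trans h1 p5.
have s1lt : s1 < 1.
  have /andP[_ p4] : 0 <= s1 <= 1 by apply: s01; rewrite !inE eqxx orbT.
  rewrite lt_def p4 andbT; apply/negP => /eqP s11.
  (* Otherwise 1 would occur twice in the list, hence at two indices of [D]. *)
  have : (1 < count_mem (inC 1%R) [seq inC a | a <- [:: s0, s1 & s']])%N.
    by rewrite /= s00 -s11 !eqxx.
  move/permP: ps => ->; rewrite count_map -sum1_count big_enum_cond /= => cnt.
  have : (1 < #|[pred i | D 0%R i == inC 1%R]|)%N.
    by rewrite -sum1_card; apply: leq_trans cnt _.
  case/card_gt1P => i [j [/eqP hi /eqP hj /negP]]; apply.
  by apply/eqP; apply: simple1; rewrite ?hi ?hj rmorph1.
split.
  have /andP[-> _] : 0 <= s1 <= 1 by apply: s01; rewrite !inE eqxx orbT.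
  exact: s1lt.
move=> i; have /mapP[t st ->] : D 0 i \in [seq inC a | a <- [:: s0, s1 & s']].
  by rewrite (perm_mem ps); apply: (map_f (fun j => D 0 j)); rewrite mem_enum.
move: (st); rewrite inE => /orP[/eqP ->|st']; first by left; rewrite s00 rmorph1.
right; exists t => //; rewrite le_s1 // andbT.
by case/andP: (s01 t st).
Qed.

(** Multiplication by the unitary [P] preserves the Frobenius norm, and in these coordinates each
    row is multiplied by its eigenvalue. *)
Lemma gossip_contraction n (V : 'M[R]_(K, n)) :
  \sum_k row k V = 0 -> sqnorm (W *m V) <= lambda ^+ 2 * sqnorm V.
Proof.
move=> V0; have [/andP[l0 l1] hD] := spectral_gap.
pose Vc := map_mx inC V.
have unitP : P \is unitarymx by exact: spectral_unitarymx.
have nrmE m p (A : 'M[R]_(m, p)) : inC (sqnorm A) = \sum_i \sum_j `|map_mx inC A i j| ^+ 2.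
  rewrite rmorph_sum; apply: eq_bigr => i _; rewrite rmorph_sum; apply: eq_bigr => j _.
  by rewrite mxE real_normK ?rmorphXn //= complex_real eqxx.
have trE (A : 'M[C]_(K, n)) : \sum_i \sum_j `|A i j| ^+ 2 = \tr ((A ^t*)%sesqui *m A).
  rewrite exchange_big; apply: eq_bigr => j _; rewrite mxE; apply: eq_bigr => i _.
  by rewrite !mxE normCK mulrC.
have nrmP (A : 'M[C]_(K, n)) : \sum_i \sum_j `|(P *m A) i j| ^+ 2 = \sum_i \sum_j `|A i j| ^+ 2.
  rewrite !trE trmx_mul map_mxM !mulmxA -(mulmxA _ _ P).
  by have /unitarymxP/mulmx1C -> := unitP; rewrite mulmx1.
rewrite -(lecR) -[X in X <= _]/(inC _) -[X in _ <= X]/(inC _) rmorphM !nrmE.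
rewrite -nrmP map_mxM mulmxA PWc -mulmxA -/Vc -(nrmP Vc) mulr_sumr ler_sum // => i _.
rewrite mulr_sumr ler_sum // => j _.
rewrite mul_diag_mx mxE; have [Di|[t -> /andP[t0 tl]]] := hD i.
  (* A row of [P] for the eigenvalue 1 is constant, so this entry is a multiple of a column sum of
     [V]. *)
  have -> : (P *m Vc) i j = 0.
    rewrite mxE (eq_bigr (fun k => P i i * inC (V k j))); last first.
      by move=> k _; rewrite mxE (row_P_const Di k i).
    rewrite -mulr_sumr -rmorph_sum /=.
    have -> : \sum_k V k j = (\sum_k row k V) 0 j.
      by rewrite summxE; apply: eq_bigr => k _; rewrite mxE.
    by rewrite V0 mxE rmorph0 mulr0.
  by rewrite mulr0 normr0 expr0n mulr0.
rewrite normrM exprMn ler_wpM2r ?exprn_ge0 //.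
rewrite real_normK; last by rewrite complex_real eqxx.
by rewrite -rmorphXn /= lecR ler_pXn2r ?nnegrE.
Qed.

End SpectralGap.

(** * Reduction of expectations to finite sums *)

Section FiniteOutcomes.
Variables (R : realType) (disp : measure_display) (Om : measurableType disp).
Variable Pr : probability Om R.

Lemma Ex_finite (T : finType) (X : Om -> T) (G : T -> R) (q : T -> R) :
  (forall t, measurable (X @^-1` [set t])) ->
  (forall t, Pr (X @^-1` [set t]) = (q t)%:E) ->
  Ex Pr (fun w => G (X w)) = \sum_t G t * q t.
Proof.
move=> mX hq.
pose F t : Om -> R := G t \o* \1_(X @^-1` [set t]).
have indL t : (\1_(X @^-1` [set t]) : Om -> R) \in Lfun Pr 1.
  by apply/Lfun1_integrable; exact: integrable_indic.
have -> : (fun w => G (X w)) = \sum_(f <- [seq F t | t : T]) f.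
  apply/funext => w; rewrite big_image /= fct_sumE (bigD1 (X w)) //= big1 ?addr0.
    by rewrite /F /= indicE mem_set // mul1r.
  by move=> t tw; rewrite /F /= indicE memNset ?mul0r // => /= /eqP; rewrite eq_sym (negPf tw).
rewrite /Ex expectation_sum; last first.
  by move=> f /mapP[t _ ->]; apply: Lfun_scale.
rewrite big_image /= -[RHS]/(fine (\sum_t G t * q t)%:E) -sumEFin; congr fine.
apply: eq_bigr => t _.
by rewrite /F expectationZl // expectation_indic // hq EFinM.
Qed.

End FiniteOutcomes.

Section FiniteModel.
Variables (R : realType) (K N b : nat) (p : R).

(** Only [b] draws per agent are recorded, and batches have size [N]. The same type serves for round
    0, where the coin and the batches are ignored. *)
Definition outcome : finType :=
  (bool * {ffun 'I_K * 'I_b -> 'I_N} * {ffun 'I_K -> {ffun 'I_N -> 'I_N}})%type.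

Definition coin_prob (c : bool) : R := if c then p else 1 - p.

Definition batch_prob (f : {ffun 'I_N -> 'I_N}) : R :=
  if f \in injections N N then #|injections N N|%:R^-1 else 0.

Definition law (x : outcome) : R :=
  coin_prob x.1.1 * \prod_(t : 'I_K * 'I_b) N%:R^-1 * \prod_(k < K) batch_prob (x.2 k).

(** The last round is summed innermost, so that the inner sum is the conditional expectation given
    the history [h]. *)
Fixpoint EE (n : nat) (F : seq outcome -> R) : R :=
  if n is n'.+1 then EE n' (fun h => \sum_x law x * F (rcons h x)) else F [::].

Variables (disp : measure_display) (Om : measurableType disp).
Variables (Pr : probability Om R) (S : sampler K N N Om).
Hypothesis hS : sampling_scheme Pr p S.

Definition observe (i : nat) (w : Om) : outcome :=
  (coin S i w, [ffun t : 'I_K * 'I_b => draw S t.1 i t.2 w], [ffun k => batch S k i w]).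

Let index : eqType := (nat + 'I_K * nat * nat + 'I_K * nat)%type.

Definition round_vars (i : nat) : seq index :=
  inl (inl i) :: [seq inl (inr (t.1, i, nat_of_ord t.2)) | t : 'I_K * 'I_b]
  ++ [seq inr (k, i) | k : 'I_K].

Let round (t : index) : nat :=
  match t with inl (inl i) => i | inl (inr (_, i, _)) => i | inr (_, i) => i end.

Let round_vars_round i t : t \in round_vars i -> round t = i.
Proof.
rewrite inE mem_cat => /or3P[/eqP -> //|/mapP[? _ -> //]|/mapP[? _ -> //]].
Qed.

Let uniq_round_vars i : uniq (round_vars i).
Proof.
rewrite /= mem_cat; apply/andP; split.
  by apply/negP => /orP[/mapP[? _]|/mapP[? _]].
rewrite cat_uniq; apply/and3P; split.
- rewrite map_inj_uniq ?enum_uniq // => -[k1 j1] [k2 j2] [-> e].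
  by congr pair; apply: val_inj.
- by apply/hasP => -[t /mapP[k _ ->] /mapP[? _]].
- by rewrite map_inj_uniq ?enum_uniq // => k1 k2 [->].
Qed.

Fixpoint history_vars (n : nat) : seq index :=
  if n is n'.+1 then history_vars n' ++ round_vars n' else [::].

Let history_vars_round n t : t \in history_vars n -> (round t < n)%N.
Proof.
elim: n => // n IH; rewrite mem_cat => /orP[/IH h|/round_vars_round -> //].
exact: leqW.
Qed.

Let uniq_history_vars n : uniq (history_vars n).
Proof.
elim: n => // n IH; rewrite [history_vars _]/= cat_uniq IH uniq_round_vars andbT andTb.
apply/hasP => -[t /round_vars_round e /history_vars_round].
by rewrite e ltnn.
Qed.

(* The [j]-th draw of a round is only recorded for [j < b]; for [j >= b] the
   condition is void. *)
Definition cylinder (x : nat -> outcome) (t : index) : set Om :=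
  match t with
  | inl (inl i) => [set w | coin S i w = (x i).1.1]
  | inl (inr (k, i, j)) =>
      [set w | forall j' : 'I_b, nat_of_ord j' = j -> draw S k i j w = (x i).1.2 (k, j')]
  | inr (k, i) => [set w | batch S k i w = (x i).2 k]
  end.

Let cylinder_event x t : sampler_events S t (cylinder x t).
Proof.
case: t => [[i|[[k i] j]]|[k i]] /=.
- by exists [set c | c = (x i).1.1].
- by exists [set s | forall j' : 'I_b, nat_of_ord j' = j -> s = (x i).1.2 (k, j')].
- by exists [set f | f = (x i).2 k].
Qed.

Let cylinder_roundP x i w :
  (forall t, t \in round_vars i -> cylinder x t w) <-> observe i w = x i.
Proof.
split=> [h|e t]; last first.
  rewrite inE mem_cat => /or3P[/eqP ->|/mapP[[k j] _ ->]|/mapP[k _ ->]] /=; rewrite -e /=.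
  - by [].
  - by move=> j' /val_inj ->; rewrite ffunE.
  - by rewrite ffunE.
rewrite [x i]surjective_pairing [(x i).1]surjective_pairing /observe.
congr (_, _, _).
- by apply: (h (inl (inl i))); rewrite mem_head.
- apply/ffunP => -[k j]; rewrite ffunE /=.
  have := h (inl (inr (k, i, nat_of_ord j))); apply => //.
  rewrite inE mem_cat; apply/or3P/Or32.
  apply: (map_f (fun t : 'I_K * 'I_b => inl (inr (t.1, i, nat_of_ord t.2)) : index)
    (_ : (k, j) \in _)).
  by rewrite mem_enum.
- apply/ffunP => k; rewrite ffunE.
  have := h (inr (k, i)); apply => //.
  rewrite inE mem_cat; apply/or3P/Or33.
  by apply: (map_f (fun k => inr (k, i) : index)); rewrite mem_enum.
Qed.

Let cylinder_historyP x n w :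
  (forall t, t \in history_vars n -> cylinder x t w)
    <-> mkseq (observe ^~ w) n = mkseq x n.
Proof.
elim: n => [|n IH] /=; first by split.
rewrite /mkseq -addn1 iotaD !map_cat /= !cats1 add0n.
split=> [h|/rcons_inj [e1 e2] t].
  congr rcons; first by apply/IH => t tn; apply: h; rewrite mem_cat tn.
  by apply/cylinder_roundP => t tn; apply: h; rewrite mem_cat tn orbT.
rewrite mem_cat => /orP[tn|tn].
  by move/IH: e1; apply.
by move/cylinder_roundP: e2; apply.
Qed.

Let Pr_round x i : (\prod_(t <- round_vars i) Pr (cylinder x t) = (law (x i))%:E)%E.
Proof.
rewrite big_cons big_cat !big_image /law -mulrA !EFinM -!prodEFin; congr (_ * (_ * _))%E.
- rewrite /coin_prob /=; case: (x i).1.1; first exact: (coin_law hS).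
  have -> : [set w | coin S i w = false] = ~` [set w | coin S i w = true].
    by apply/seteqP; split => w /=; case: (coin S i w).
  rewrite probability_setC ?(coin_law hS) // .
  apply: (sampling_measurable hS (t := inl (inl i))).
  by exists [set c | c = true].
- apply: eq_bigr => -[k j] _ /=.
  rewrite -(draw_law hS k i j ((x i).1.2 (k, j))); congr (Pr _).
  apply/seteqP; split => w /= h; first exact: h.
  by move=> j' /val_inj ->.
- by apply: eq_bigr => k _ /=; rewrite (batch_law hS).
Qed.

Let history_event x n :
  [set w | mkseq (observe ^~ w) n = mkseq x n]
    = \bigcap_(t in [set` history_vars n]) cylinder x t.
Proof.
apply/seteqP; split => w /=; first by move/cylinder_historyP.
by move=> h; apply/cylinder_historyP.
Qed.

Lemma measurable_history x n :
  measurable [set w | mkseq (observe ^~ w) n = mkseq x n].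
Proof.
rewrite history_event; apply: fin_bigcap_measurable; first exact: finite_seq.
by move=> t _; apply: (sampling_measurable hS (t := t)).
Qed.

(** Mutual independence is applied once, to the list of all variables of the first [n] rounds; the
    product is then regrouped by rounds. *)
Lemma Pr_history x n :
  Pr [set w | mkseq (observe ^~ w) n = mkseq x n] = (\prod_(i < n) law (x i))%:E.
Proof.
rewrite history_event (sampling_independent hS); first last.
- by move=> t _; exact: cylinder_event.
- exact: uniq_history_vars.
elim: n => [|n IH]; first by rewrite big_nil big_ord0.
by rewrite big_cat /= IH Pr_round -EFinM big_ord_recr.
Qed.

Lemma EE_tuple n F : EE n F = \sum_(h : n.-tuple outcome) F h * \prod_(x <- h) law x.
Proof.
elim: n F => [|n IH] F /=.
  rewrite (big_pred1 [tuple]) ?big_nil ?mulr1 // => h.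
  by apply/esym/eqP; exact: tuple0.
rewrite IH; pose f (hx : n.-tuple outcome * outcome) := [tuple of rcons hx.1 hx.2].
have f_bij : bijective f.
  apply: inj_card_bij; last first.
    apply: eq_leq; apply: etrans (card_tuple n.+1 outcome) _.
    by rewrite expnSr -(card_tuple n outcome); apply/esym; exact: card_prod.
  move=> [h1 x1] [h2 x2] /(congr1 val) /= /rcons_inj [e1 e2].
  by congr (_, _) => //; apply: val_inj.
rewrite (reindex f) /=; last exact: onW_bij.
rewrite -(pair_bigA _ (fun (h : n.-tuple outcome) (x : outcome) => 
  F (rcons h x) * \prod_(y <- rcons h x) law y)) /=.
apply: eq_bigr => h _; rewrite mulr_suml; apply: eq_bigr => x _.
by rewrite -cats1 big_cat big_seq1 /=; ring.
Qed.

Lemma Ex_history n (F : seq outcome -> R) :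
  Ex Pr (fun w => F (mkseq (observe ^~ w) n)) = EE n F.
Proof.
pose X w : n.-tuple outcome := [tuple of mkseq (observe ^~ w) n].
have evE (h : n.-tuple outcome) w0 :
    X @^-1` [set h] = [set w | mkseq (observe ^~ w) n = mkseq (nth (observe 0 w0) h) n].
  have e : mkseq (nth (observe 0 w0) h) n = h.
    by rewrite -[in RHS](mkseq_nth (observe 0 w0) h) size_tuple.
  apply/seteqP; split => w /=; rewrite e; first by move=> /(congr1 val).
  by move=> ew; apply: val_inj.
(* A point of [Om] provides the default value for [nth]; it exists because [Pr] has total mass 1. *)
have [w0 _] : [set: Om] !=set0.
  apply/set0P/negP => /eqP e; have := probability_setT Pr; rewrite e measure0 => /eqP.
  by rewrite eq_sym onee_eq0.
rewrite -[LHS]/(Ex Pr (fun w => (fun h : n.-tuple outcome => F h) (X w))).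
rewrite (@Ex_finite _ _ _ Pr _ X _ (fun h => \prod_(x <- h) law x)); first by rewrite EE_tuple.
- by move=> h; rewrite (evE h w0); apply: measurable_history.
- move=> h; rewrite (evE h w0) Pr_history; congr EFin.
  by rewrite (big_nth (observe 0 w0)) size_tuple big_mkord.
Qed.

Lemma eq_EE n F G : (forall h, size h = n -> F h = G h) -> EE n F = EE n G.
Proof.
by move=> FG; rewrite !EE_tuple; apply: eq_bigr => h _; rewrite FG // size_tuple.
Qed.

End FiniteModel.

(** * Expectations over one round *)

Section OutcomeExpectation.
Variables (R : realType) (K N b : nat) (p : R).
Hypotheses (N0 : (0 < N)%N) (p0 : 0 <= p) (p1 : p <= 1).

Let outc := outcome K N b.
Let draws : finType := {ffun 'I_K * 'I_b -> 'I_N}.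

Definition Elaw (f : outcome K N b -> R) : R := \sum_x law p x * f x.

Definition Edraw (f : {ffun 'I_K * 'I_b -> 'I_N} -> R) : R :=
  \sum_D (\prod_(t : 'I_K * 'I_b) N%:R^-1) * f D.

Lemma sum_batch_prob : \sum_f @batch_prob R N f = 1.
Proof.
rewrite /batch_prob -big_mkcond /= sumr_const -(mulr_natr (_^-1)) mulVf //.
rewrite pnatr_eq0 -lt0n card_gt0; apply/set0Pn; exists [ffun i => i].
by rewrite inE; apply/injectiveP => i j; rewrite !ffunE.
Qed.

Lemma law_ge0 (x : outc) : 0 <= law p x.
Proof.
rewrite /law !mulr_ge0 //.
- by rewrite /coin_prob; case: ifP => // _; rewrite subr_ge0.
- by apply: prodr_ge0 => t _; rewrite invr_ge0 ler0n.
- by apply: prodr_ge0 => k _; rewrite /batch_prob; case: ifP => // _; rewrite invr_ge0 ler0n.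
Qed.

Lemma law_batch_injective (x : outc) : law p x != 0 -> forall k, injective (x.2 k).
Proof.
rewrite /law !mulf_eq0 !negb_or => /andP[_ /prodf_neq0 h] k.
have := h k isT; rewrite /batch_prob; case: ifP; last by rewrite eqxx.
by rewrite inE => /injectiveP.
Qed.

(** The batches are summed out. Agreement is asked only where [law] is nonzero: there the batches
    are injective, and a round with coin 1 has a result that does not depend on them. *)
Lemma Elaw_coin (f : outc -> R) (g : bool -> draws -> R) :
  (forall x, law p x != 0 -> f x = g x.1.1 x.1.2) ->
  Elaw f = p * Edraw (g true) + (1 - p) * Edraw (g false).
Proof.
move=> hf.
pose u : R := \prod_(t : 'I_K * 'I_b) N%:R^-1.
have sum_batches : \sum_(f : {ffun 'I_K -> {ffun 'I_N -> 'I_N}})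
    \prod_(k < K) @batch_prob R N (f k) = 1.
  rewrite -(bigA_distr_bigA (fun (_ : 'I_K) f => @batch_prob R N f)).
  by rewrite big1 // => k _; exact: sum_batch_prob.
transitivity (\sum_(y : bool * draws) \sum_(z : {ffun 'I_K -> {ffun 'I_N -> 'I_N}})
    (coin_prob p y.1 * (u * g y.1 y.2)) * \prod_(k < K) @batch_prob R N (z k)).
  rewrite pair_bigA; apply: eq_bigr => -[[c D] z] _ /=.
  have [l0|l0] := eqVneq (law p ((c, D), z)) 0.
    rewrite l0 mul0r; move: l0; rewrite /law /= -/u => l0.
    transitivity (g c D * (coin_prob p c * u * \prod_(k < K) @batch_prob R N (z k))).
      by rewrite l0 mulr0.
    by ring.
  by rewrite (hf _ l0) /law /= -/u; ring.
under eq_bigr do rewrite -mulr_sumr sum_batches mulr1.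
rewrite -(pair_bigA _ (fun (c : bool) (D : draws) => coin_prob p c * (u * g c D))) /=.
have e c : \sum_D coin_prob p c * (u * g c D) = coin_prob p c * Edraw (g c).
  by rewrite mulr_sumr.
by rewrite big_bool !e.
Qed.

Let Edraw_prod (F : 'I_K * 'I_b -> 'I_N -> R) :
  Edraw (fun D => \prod_t F t (D t)) = \prod_t rmean (F t).
Proof.
rewrite /Edraw /rmean; under [in RHS]eq_bigr do rewrite mulr_sumr.
by rewrite bigA_distr_bigA; apply: eq_bigr => D _; rewrite big_split.
Qed.

Let rmean1 : rmean (fun=> 1 : R) = 1 :> R := rmean_cst 1 N0.

Lemma Edraw1 : Edraw (fun=> 1) = 1.
Proof.
have e := Edraw_prod (fun _ _ => 1).
rewrite [X in _ = X]big1 in e; last by move=> t _; exact: rmean1.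
by rewrite -[RHS]e; apply: eq_bigr => D _; congr (_ * _); rewrite big1.
Qed.

Lemma Edraw_coord (f : 'I_N -> R) t : Edraw (fun D => f (D t)) = rmean f.
Proof.
pose F u s : R := if u == t then f s else 1.
transitivity (Edraw (fun D => \prod_u F u (D u))).
  apply: eq_bigr => D _; congr (_ * _); rewrite (bigD1 t) //= {1}/F eqxx big1 ?mulr1 //.
  by move=> u ut; rewrite /F (negPf ut).
rewrite Edraw_prod (bigD1 t) //= {1}/F eqxx big1 ?mulr1 // => u ut.
by rewrite /F (negPf ut).
Qed.

Lemma Edraw_coord2 (f g : 'I_N -> R) t u : t != u ->
  Edraw (fun D => f (D t) * g (D u)) = rmean f * rmean g.
Proof.
move=> tu; have ut : u != t by rewrite eq_sym.
pose F v s : R := if v == t then f s else if v == u then g s else 1.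
transitivity (Edraw (fun D => \prod_v F v (D v))).
  apply: eq_bigr => D _; congr (_ * _); rewrite (bigD1 t) //= (bigD1 u) //= big1; last first.
    by move=> v /andP[vt vu]; rewrite /F (negPf vt) (negPf vu).
  by rewrite /F eqxx (negPf ut) eqxx mulr1.
rewrite Edraw_prod (bigD1 t) //= (bigD1 u) //= big1; last first.
  by move=> v /andP[vt vu]; rewrite /F (negPf vt) (negPf vu).
by rewrite /F eqxx (negPf ut) eqxx mulr1.
Qed.

Lemma EdrawD f g : Edraw (fun D => f D + g D) = Edraw f + Edraw g.
Proof. by rewrite /Edraw -big_split; apply: eq_bigr => D _; rewrite mulrDr. Qed.

Lemma EdrawZ c f : Edraw (fun D => c * f D) = c * Edraw f.
Proof. by rewrite /Edraw mulr_sumr; apply: eq_bigr => D _; ring. Qed.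

Lemma Edraw_cst c : Edraw (fun=> c) = c.
Proof. by have := EdrawZ c (fun=> 1); rewrite Edraw1 mulr1. Qed.

Lemma Edraw_sum (I : finType) (F : I -> draws -> R) :
  Edraw (fun D => \sum_i F i D) = \sum_i Edraw (F i).
Proof. by rewrite /Edraw exchange_big; apply: eq_bigr => D _; rewrite mulr_sumr. Qed.

Lemma Edraw_le f g : (forall D, f D <= g D) -> Edraw f <= Edraw g.
Proof.
move=> fg; apply: ler_sum => D _; rewrite ler_wpM2l //.
by apply: prodr_ge0 => t _; rewrite invr_ge0 ler0n.
Qed.

Lemma Edraw_dotm n (u v : 'I_N -> 'rV[R]_n) t t' : t != t' ->
  Edraw (fun D => dotm (u (D t)) (v (D t'))) = dotm (mean u) (mean v).
Proof.
move=> tt; rewrite /dotm big_ord1.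
transitivity (Edraw (fun D => \sum_j u (D t) 0 j * v (D t') 0 j)).
  by apply: eq_bigr => D _; rewrite big_ord1.
rewrite Edraw_sum; apply: eq_bigr => j _.
rewrite (Edraw_coord2 (fun s => u s 0 j) (fun s => v s 0 j) tt).
by rewrite /mean !mxE !summxE.
Qed.

(** The draws are independent and centered, so all cross terms vanish, those with [C] included. *)
Lemma Edraw_variance n (C : 'rV[R]_n) (a : R) (u : 'I_K * 'I_b -> 'I_N -> 'rV[R]_n) :
  (forall t, mean (u t) = 0) ->
  Edraw (fun D => sqnorm (C + a *: \sum_t u t (D t)))
    = sqnorm C + a ^+ 2 * \sum_t rmean (fun s => sqnorm (u t s)).
Proof.
move=> u0.
transitivity (Edraw (fun D => sqnorm C + ((2 * a) * (\sum_t dotm C (u t (D t)))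
    + a ^+ 2 * (\sum_t \sum_t' dotm (u t (D t)) (u t' (D t')))))).
  apply: eq_bigr => D _; congr (_ * _).
  rewrite sqnormD dotmZr dotm_sumr sqnormZ (sqnormE (\sum_t _)) dotm_suml.
  under [X in _ = _ + (_ + _ * X)]eq_bigr do rewrite -dotm_sumr.
  by ring.
rewrite EdrawD Edraw_cst EdrawD !EdrawZ !Edraw_sum big1 ?mulr0 ?add0r; last first.
  by move=> t _; rewrite (Edraw_coord (fun s => dotm C (u t s)));
    rewrite (eq_rmean (fun s => dotmC C (u t s))) -dotm_meanl u0 dot0m.
congr (_ + _ * _); apply: eq_bigr => t _; rewrite Edraw_sum (bigD1 t) //= big1 ?addr0.
  rewrite (Edraw_coord (fun s => dotm (u t s) (u t s))).
  by apply: eq_rmean => s; rewrite sqnormE.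
by move=> t' tt; rewrite Edraw_dotm 1?eq_sym // u0 dot0m.
Qed.

Lemma ElawD f g : Elaw (fun x => f x + g x) = Elaw f + Elaw g.
Proof. by rewrite /Elaw -big_split; apply: eq_bigr => D _; rewrite mulrDr. Qed.

Lemma ElawZ c f : Elaw (fun x => c * f x) = c * Elaw f.
Proof. by rewrite /Elaw mulr_sumr; apply: eq_bigr => D _; ring. Qed.

Lemma Elaw_cst c : Elaw (fun=> c) = c.
Proof.
by rewrite (@Elaw_coin _ (fun _ _ => c)) // !Edraw_cst; ring.
Qed.

Lemma Elaw_le f g : (forall x, f x <= g x) -> Elaw f <= Elaw g.
Proof. by move=> fg; apply: ler_sum => x _; rewrite ler_wpM2l // law_ge0. Qed.

End OutcomeExpectation.

(** * Error recursions of the variance-reduced estimators *)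

Section Estimator.
Variables (R : realType) (K N b d1 d2 : nat) (p : R).
Hypotheses (K0 : (0 < K)%N) (N0 : (0 < N)%N) (b0 : (0 < b)%N).
Hypotheses (p0 : 0 <= p) (p1 : p <= 1).
Variables (ex ey dx dy : R).

Let outc := outcome K N b.
Let h := Params p 0 ex ey dx dy b b.

(** Lets the estimators of the algorithm be evaluated on a single outcome: the round index is
    ignored, and draws beyond the recorded [b] get a default that an estimator with batch size [b]
    never reads. *)
Definition round_sampler : sampler K N N (outcome K N b) :=
  Sampler (fun _ (x : outcome K N b) => x.1.1)
    (fun k _ j (x : outcome K N b) =>
       if insub j is Some j' then x.1.2 (k, j' : 'I_b) else Ordinal N0)
    (fun k _ (x : outcome K N b) => x.2 k).

Lemma averageD n (A B : 'M[R]_(K, n)) : average (A + B) = average A + average B.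
Proof. by rewrite -meanD; apply: eq_mean => k; rewrite raddfD. Qed.

Lemma averageB n (A B : 'M[R]_(K, n)) : average (A - B) = average A - average B.
Proof. by rewrite -meanB; apply: eq_mean => k; rewrite raddfB. Qed.

Lemma averageZ n c (A : 'M[R]_(K, n)) : average (c *: A) = c *: average A.
Proof. by rewrite -meanZ; apply: eq_mean => k; rewrite linearZ. Qed.

Lemma average0 n : average (0 : 'M[R]_(K, n)) = 0.
Proof. by rewrite -(subrr (0 : 'M[R]_(K, n))) averageB subrr. Qed.

Variables (n : nat) (q : 'I_K -> 'I_N -> 'rV[R]_d1 -> 'rV[R]_d2 -> 'rV[R]_n).

Definition full_batch (X : 'M[R]_(K, d1)) (Y : 'M[R]_(K, d2)) : 'M[R]_(K, n) :=
  \matrix_(k < K) mean (fun s => q k s (row k X) (row k Y)).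

Section Noise.
Variable u : 'I_K -> 'I_N -> 'rV[R]_n.
Hypothesis u0 : forall k, mean (u k) = 0.

Definition noise (D : {ffun 'I_K * 'I_b -> 'I_N}) : 'M[R]_(K, n) :=
  \matrix_(k < K) mean (fun j : 'I_b => u k (D (k, j))).

Let bR : 0 < (b%:R : R). Proof. by rewrite ltr0n. Qed.
Let KR : 0 < (K%:R : R). Proof. by rewrite ltr0n. Qed.

(** Draws are independent across agents as well as within a minibatch, so averaging over the network
    divides the variance by [K b] and not only by [b]. *)
Lemma Edraw_noise_average (C : 'M[R]_(K, n)) :
  Edraw (fun D => sqnorm (average (C + noise D))) = sqnorm (average C)
    + (K%:R * b%:R)^-1 * rmean (fun k => rmean (fun s => sqnorm (u k s))).
Proof.
transitivity (Edraw (fun D => sqnorm (average C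
    + (K%:R * b%:R)^-1 *: \sum_(t : 'I_K * 'I_b) u t.1 (D t)))).
  apply: eq_bigr => D _; congr (_ * sqnorm _); rewrite averageD; congr (_ + _).
  have -> : \sum_(t : 'I_K * 'I_b) u t.1 (D t) = \sum_k \sum_j u k (D (k, j)).
    by rewrite pair_bigA; apply: eq_bigr => -[k j].
  rewrite /average /mean.
  rewrite invfM -scalerA; congr (_ *: _); rewrite scaler_sumr; apply: eq_bigr => k _.
  by rewrite rowK.
rewrite (Edraw_variance N0 _ _ (u := fun t => u t.1)) //; congr (_ + _).
rewrite -(pair_bigA _ (fun k (_ : 'I_b) => rmean (fun s => sqnorm (u k s)))) /=.
under eq_bigr do rewrite sumr_const card_ord -[_ *+ b]mulr_natr.
rewrite -mulr_suml /rmean.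
by move: (\sum_i _) => z; field; rewrite !gt_eqF.
Qed.

Lemma Edraw_noise (C : 'M[R]_(K, n)) :
  Edraw (fun D => sqnorm (C + noise D)) = sqnorm C
    + K%:R / b%:R * rmean (fun k => rmean (fun s => sqnorm (u k s))).
Proof.
have rowE k : Edraw (fun D => sqnorm (row k (C + noise D))) =
    sqnorm (row k C) + b%:R^-1 * rmean (fun s => sqnorm (u k s)).
  (* Row [k] sees only the draws of agent [k]; the others are masked by 0 to fit the variance
     formula over all pairs. *)
  pose v (t : 'I_K * 'I_b) (s : 'I_N) : 'rV[R]_n := if t.1 == k then u k s else 0.
  have pairs (V : zmodType) (F : 'I_b -> V) :
      \sum_(t : 'I_K * 'I_b) (if t.1 == k then F t.2 else 0) = \sum_j F j.
    rewrite -(pair_bigA _ (fun k' j => if k' == k then F j else 0)) /=.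
    rewrite (bigD1 k) //= eqxx [X in _ + X]big1 ?addr0 // => k' /negPf kk.
    by rewrite kk big1.
  transitivity (Edraw (fun D => sqnorm (row k C + b%:R^-1 *: \sum_t v t (D t)))).
    apply: eq_bigr => D _; congr (_ * sqnorm _); rewrite raddfD /= rowK /mean.
    congr (_ + _ *: _); rewrite -(pairs _ (fun j => u k (D (k, j)))).
    by apply: eq_bigr => -[k' j] _; rewrite /v /=; case: eqP => // ->.
  rewrite Edraw_variance //; last first.
    move=> t; rewrite /v; case: (t.1 == k) => //.
    exact: mean_cst.
  congr (_ + _).
  rewrite (eq_bigr (fun t => if t.1 == k then rmean (fun s => sqnorm (u k s)) else 0)).
    rewrite (pairs _ (fun _ => rmean (fun s => sqnorm (u k s)))) sumr_const card_ord.
    by rewrite -[_ *+ b]mulr_natr; move: (rmean _) => z; field; rewrite gt_eqF.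
  move=> t _; rewrite /v; case: (t.1 == k) => //.
  by under eq_rmean do rewrite sqnorm0; exact: rmean_cst.
transitivity (Edraw (fun D => \sum_k sqnorm (row k (C + noise D)))).
  by apply: eq_bigr => D _; rewrite -sqnorm_rows.
rewrite Edraw_sum (eq_bigr _ (fun k _ => rowE k)) big_split /= -sqnorm_rows.
rewrite -mulr_sumr /rmean; congr (_ + _).
by move: (\sum_i _) => z; field; rewrite !gt_eqF.
Qed.

End Noise.

Let centered (a : 'I_K -> 'I_N -> 'rV[R]_n) k s := a k s - mean (a k).

Let mean_centered a k : mean (centered a k) = 0.
Proof. by rewrite /centered meanB mean_cst // subrr. Qed.

Let centered_le a :
  rmean (fun k => rmean (fun s => sqnorm (centered a k s)))
    <= rmean (fun k => rmean (fun s => sqnorm (a k s))).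
Proof.
apply: rmean_le => k; apply: le_trans (sqnorm_mean_minimal (a k) 0) _.
by apply: rmean_le => s; rewrite subr0.
Qed.

Lemma init_variance X Y :
  let V := rmean (fun k => rmean (fun s => sqnorm
     (q k s (row k X) (row k Y) - mean (fun s => q k s (row k X) (row k Y))))) in
  let G := estimator_init h round_sampler q X Y in
  Elaw p (fun x => sqnorm (average (G x - full_batch X Y))) = (K%:R * b%:R)^-1 * V /\
  Elaw p (fun x => sqnorm (G x - full_batch X Y)) = K%:R / b%:R * V.
Proof.
move=> V G; pose a k s := q k s (row k X) (row k Y).
have e x : G x - full_batch X Y = 0 + noise (centered a) x.1.2.
  rewrite add0r; apply/row_matrixP => k; rewrite raddfB /= !rowK meanB mean_cst //.
  congr (_ - _); apply: eq_mean => j /=.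
  by rewrite (valK (j : 'I_b)).
split.
  rewrite (Elaw_coin (g := fun _ D => sqnorm (average (0 + noise (centered a) D)))).
    rewrite Edraw_noise_average ?average0 ?sqnorm0; last exact: mean_centered.
    by rewrite -mulrDl addrC subrK mul1r add0r.
  by move=> x _; rewrite e.
rewrite (Elaw_coin (g := fun _ D => sqnorm (0 + noise (centered a) D))).
  rewrite Edraw_noise ?sqnorm0; last exact: mean_centered.
  by rewrite -mulrDl addrC subrK mul1r add0r.
by move=> x _; rewrite e.
Qed.

Section Step.
Variables (X X' : 'M[R]_(K, d1)) (Y Y' : 'M[R]_(K, d2)) (G : 'M[R]_(K, n)).

Let next x := estimator_step h round_sampler q 0 X X' Y Y' G x.
Let M := full_batch X Y.
Let M' := full_batch X' Y'.
Let dif k s := q k s (row k X') (row k Y') - q k s (row k X) (row k Y).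
Let dq := rmean (fun k => rmean (fun s => sqnorm (dif k s))).

(** A batch of size [N] drawn without replacement is a permutation of the samples. *)
Let next_full x : law p x != 0 -> x.1.1 -> next x = M'.
Proof.
move=> lx cx; apply/row_matrixP => k; rewrite !rowK /= cx.
have bij : bijective (x.2 k) by apply: injF_bij; exact: (law_batch_injective lx).
by rewrite /mean [in RHS](reindex (x.2 k)) //=; exact: onW_bij.
Qed.

Let next_diff x : ~~ x.1.1 -> next x = G + noise dif x.1.2.
Proof.
move=> /negPf cx; apply/row_matrixP => k; rewrite raddfD /= !rowK /= cx.
rewrite subr0 scale1r -addrA; congr (_ + _).
rewrite addrC -meanB; apply: eq_mean => j.
by rewrite /= (valK (j : 'I_b)).
Qed.

(** The sampled differences have mean [M' - M]; subtracting it turns the error against [M'] into the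
    old error [G - M] plus centered noise. *)
Let next_centered x : ~~ x.1.1 -> next x - M' = (G - M) + noise (centered dif) x.1.2.
Proof.
move=> cx; have -> : noise (centered dif) x.1.2 = noise dif x.1.2 - (M' - M).
  apply/row_matrixP => k; rewrite /M' /M /noise /full_batch !raddfB /= !rowK.
  have md : mean (dif k) = mean (fun s => q k s (row k X') (row k Y'))
    - mean (fun s => q k s (row k X) (row k Y)) by exact: meanB.
  rewrite [LHS]meanB mean_cst // md; congr (_ + _).
  by rewrite opprB opprK addrC.
rewrite next_diff // opprB !addrA (addrAC _ _ M) subrK.
by rewrite addrAC.
Qed.

Let dq_ge0 : 0 <= dq.
Proof. by apply: rmean_ge0 => k; apply: rmean_ge0 => s; exact: sqnorm_ge0. Qed.

(** Coin 1 erases the error; coin 0 adds independent centered noise to it, whose variance is at most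
    the second moment [dq] of the differences. *)
Lemma step_average_error :
  Elaw p (fun x => sqnorm (average (next x - M')))
    <= (1 - p) * sqnorm (average (G - M)) + (K%:R * b%:R)^-1 * dq.
Proof.
rewrite (Elaw_coin (g := fun c D =>
  if c then 0 else sqnorm (average ((G - M) + noise (centered dif) D)))); last first.
  move=> x lx; case: ifPn => cx; last by rewrite next_centered.
  by rewrite next_full // subrr average0 sqnorm0.
rewrite Edraw_cst // Edraw_noise_average; last exact: mean_centered.
rewrite mulr0 add0r mulrDr lerD2l.
have h1 : 0 <= (K%:R * b%:R)^-1 :> R by rewrite invr_ge0 mulr_ge0 ?ler0n.
apply: le_trans (_ : (1 - p) * ((K%:R * b%:R)^-1 * dq) <= _).
  by rewrite ler_wpM2l ?subr_ge0 // ler_wpM2l // centered_le.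
by apply: ler_piMl; [exact: mulr_ge0 | rewrite lerBlDr lerDl].
Qed.

Lemma step_error :
  Elaw p (fun x => sqnorm (next x - M'))
    <= (1 - p) * sqnorm (G - M) + K%:R / b%:R * dq.
Proof.
rewrite (Elaw_coin (g := fun c D =>
  if c then 0 else sqnorm ((G - M) + noise (centered dif) D))); last first.
  move=> x lx; case: ifPn => cx; last by rewrite next_centered.
  by rewrite next_full // subrr sqnorm0.
rewrite Edraw_cst // Edraw_noise; last exact: mean_centered.
rewrite mulr0 add0r mulrDr lerD2l.
have h1 : 0 <= K%:R / b%:R :> R by rewrite divr_ge0 ?ler0n.
apply: le_trans (_ : (1 - p) * (K%:R / b%:R * dq) <= _).
  by rewrite ler_wpM2l ?subr_ge0 // ler_wpM2l // centered_le.
by apply: ler_piMl; [exact: mulr_ge0 | rewrite lerBlDr lerDl].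
Qed.

Let KdqE : K%:R * dq = \sum_k rmean (fun s => sqnorm (dif k s)).
Proof. rewrite -[dq]/(K%:R^-1 * \sum_k rmean (fun s => sqnorm (dif k s))).
by rewrite mulrA divff ?mul1r // pnatr_eq0 -lt0n. Qed.

Let full_diff_le : sqnorm (M' - M) <= K%:R * dq.
Proof.
rewrite sqnorm_rows KdqE ler_sum // => k _.
by rewrite raddfB /= !rowK -meanB sqnorm_mean_le.
Qed.

Let noise_le : Edraw (fun D => sqnorm (noise dif D)) <= K%:R * dq.
Proof.
apply: le_trans (_ : Edraw (fun D =>
    \sum_k rmean (fun j : 'I_b => sqnorm (dif k (D (k, j))))) <= _).
  apply: Edraw_le => D; rewrite sqnorm_rows ler_sum // => k _.
  by rewrite rowK sqnorm_mean_le.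
rewrite Edraw_sum KdqE.
rewrite ler_sum // => k _; rewrite EdrawZ Edraw_sum.
rewrite (eq_bigr (fun=> rmean (fun s => sqnorm (dif k s)))); last first.
  by move=> j _; rewrite (Edraw_coord N0 (fun s => sqnorm (dif k s))).
rewrite sumr_const card_ord -(mulr_natl (rmean _) b) mulrA mulVf ?mul1r //.
by rewrite pnatr_eq0 -lt0n.
Qed.

(** Coin 0 moves [G] by sampled differences alone, so the old error [G - M] is paid only when coin 1
    makes [G] jump to the full gradient. *)
Lemma step_increment :
  Elaw p (fun x => sqnorm (next x - G)) <= 2 * (K%:R * dq) + 2 * p * sqnorm (G - M).
Proof.
apply: le_trans (_ : p * (2 * (K%:R * dq) + 2 * sqnorm (G - M))
    + (1 - p) * (2 * (K%:R * dq)) <= _); last first.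
  by rewrite le_eqVlt; apply/orP; left; apply/eqP; ring.
rewrite (Elaw_coin (g := fun c D =>
  if c then sqnorm (M' - G) else sqnorm (noise dif D))); last first.
  move=> x lx; case: ifPn => cx; first by rewrite next_full.
  by rewrite next_diff // addrAC subrr add0r.
rewrite Edraw_cst //; apply: lerD; rewrite ler_wpM2l ?subr_ge0 //.
  have := sqnormD_le (M' - M) (M - G); rewrite addrA subrK (sqnormBC M G).
  by have := full_diff_le; lra.
have : 0 <= K%:R * dq by rewrite mulr_ge0 // ler0n.
by have := noise_le; lra.
Qed.

End Step.

End Estimator.

(** * Consensus errors of gradient tracking *)

Section Consensus.
Variables (R : realType) (K : nat).
Hypothesis K0 : (0 < K)%N.

Let KR : (K%:R : R) != 0. Proof. by rewrite pnatr_eq0 -lt0n. Qed.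
Let J : 'M[R]_K := const_mx K%:R^-1.

Definition dev n (A : 'M[R]_(K, n)) : 'M[R]_(K, n) := A - J *m A.

Lemma row_mean_mx n (A : 'M[R]_(K, n)) k : row k (J *m A) = average A.
Proof.
apply/rowP => j; rewrite /average /mean !mxE summxE mulr_sumr.
by apply: eq_bigr => i _; rewrite !mxE.
Qed.

Lemma row_dev n (A : 'M[R]_(K, n)) k : row k (dev A) = row k A - average A.
Proof. by rewrite raddfB /= row_mean_mx. Qed.

Lemma sum_row_dev n (A : 'M[R]_(K, n)) : \sum_k row k (dev A) = 0.
Proof.
under eq_bigr do rewrite row_dev.
rewrite big_split /= sumrN sumr_const card_ord /average /mean.
by rewrite -(scaler_nat K (_ *: _)) scalerA divff // scale1r subrr.
Qed.

Lemma devD n (A B : 'M[R]_(K, n)) : dev (A + B) = dev A + dev B.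
Proof. by rewrite /dev mulmxDr opprD addrACA. Qed.

Lemma devZ n a (A : 'M[R]_(K, n)) : dev (a *: A) = a *: dev A.
Proof. by rewrite /dev scalerBr -scalemxAr. Qed.

Lemma devB n (A B : 'M[R]_(K, n)) : dev (A - B) = dev A - dev B.
Proof. by rewrite devD -scaleN1r devZ scaleN1r. Qed.

Lemma sqnorm_dev n (A : 'M[R]_(K, n)) :
  sqnorm A = sqnorm (dev A) + K%:R * sqnorm (average A).
Proof.
have e k : sqnorm (row k A) = sqnorm (row k (dev A)) + 2 * dotm (row k (dev A)) (average A)
    + sqnorm (average A).
  by rewrite -sqnormD row_dev subrK.
rewrite (sqnorm_rows A) (eq_bigr _ (fun k _ => e k)) !big_split /= -sqnorm_rows.
rewrite sumr_const card_ord -[sqnorm _ *+ K]mulr_natl -mulr_sumr -dotm_suml sum_row_dev.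
by rewrite dot0m mulr0 addr0.
Qed.

Lemma sqnorm_dev_le n (A : 'M[R]_(K, n)) : sqnorm (dev A) <= sqnorm A.
Proof. by rewrite (sqnorm_dev A) lerDl mulr_ge0 ?ler0n ?sqnorm_ge0. Qed.

Variables (W : 'M[R]_K) (lambda : R).
Hypotheses (dsW : doubly_stochastic W) (l0 : 0 <= lambda) (l1 : lambda < 1).
Hypothesis contractW : forall n (V : 'M[R]_(K, n)),
  \sum_k row k V = 0 -> sqnorm (W *m V) <= lambda ^+ 2 * sqnorm V.

Let JW : J *m W = J.
Proof.
have [_ _ hc] := dsW; apply/matrixP => i j; rewrite !mxE.
by under eq_bigr do rewrite mxE; rewrite -mulr_sumr hc mulr1.
Qed.

Let WJ : W *m J = J.
Proof.
have [_ hr _] := dsW; apply/matrixP => i j; rewrite !mxE.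
by under eq_bigr do rewrite mxE; rewrite -mulr_suml hr mul1r.
Qed.

Lemma dev_gossip n (A : 'M[R]_(K, n)) : dev (W *m A) = W *m dev A.
Proof. by rewrite /dev mulmxBr !mulmxA JW WJ. Qed.

Lemma average_gossip n (A : 'M[R]_(K, n)) : average (W *m A) = average A.
Proof. by rewrite -!(row_mean_mx _ (Ordinal K0)) mulmxA JW. Qed.

Lemma gossip_le n (A : 'M[R]_(K, n)) : sqnorm (W *m dev A) <= lambda ^+ 2 * sqnorm (dev A).
Proof. exact/contractW/sum_row_dev. Qed.

Section Block.
Variables (n : nat) (eta : R).

(** The ascent block for [y] is the case of a negative [eta]. *)
Definition tracking_step (X D G : 'M[R]_(K, n)) : 'M[R]_(K, n) :=
  netA (atc_gt W) *m (netC (atc_gt W) *m X - eta *: G) - netB (atc_gt W) *m D.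

(* Eliminating [D], the iterates of a block satisfy
   [X'' - W X' = W (X' - W X) - eta W^2 (G' - G)]. *)
Definition residual (X D G : 'M[R]_(K, n)) : 'M[R]_(K, n) :=
  tracking_step X D G - W *m X.

Lemma tracking_average X D G :
  average (tracking_step X D G) = average X - eta *: average G.
Proof.
rewrite /tracking_step /= averageB -mulmxA !average_gossip averageB averageZ mul1mx.
rewrite mulmxBl mul1mx averageB average_gossip subrr subr0.
by [].
Qed.

Lemma residual_step X D G G' :
  let X' := tracking_step X D G in
  residual X' (D + netB (atc_gt W) *m X') G'
    = W *m residual X D G - eta *: (W *m (W *m (G' - G))).
Proof.
move=> X'; rewrite /residual.
(* The definition of [X'], read as an equation for [(I - W) D], the only combination in which the
   dual variable occurs below. *)
have e : D - W *m D = W *m (W *m X) - eta *: (W *m (W *m G)) - X'.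
  rewrite /X' /tracking_step /= !mul1mx mulmxBl mul1mx -!mulmxA !mulmxBr -!scalemxAr.
  by rewrite subKr.
have e2 (Z : 'M[R]_(K, n)) : (1%:M - W) *m Z = Z - W *m Z by rewrite mulmxBl mul1mx.
rewrite -/X' {1}/tracking_step /= mul1mx (mulmxDr _ D) !e2 e -!mulmxA !mulmxBr -!scalemxAr.
move: (W *m (W *m X')) (W *m (W *m X)) (W *m X') (W *m (W *m G')) (W *m (W *m G)).
move=> a a1 a2 a3 a4; rewrite !scalerBr.
apply/matrixP => i j; rewrite !mxE; ring.
Qed.

Lemma consensus_step X D G :
  sqnorm (dev (tracking_step X D G))
    <= lambda * sqnorm (dev X) + (1 - lambda)^-1 * sqnorm (dev (residual X D G)).
Proof.
have -> : tracking_step X D G = W *m X + residual X D G by rewrite addrC subrK.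
rewrite devD dev_gossip; apply: sqnorm_contract => //; last exact: gossip_le.
Qed.

Lemma residual_contract X D G G' :
  sqnorm (dev (residual (tracking_step X D G)
      (D + netB (atc_gt W) *m tracking_step X D G) G'))
    <= lambda * sqnorm (dev (residual X D G)) + (1 - lambda)^-1 * (eta ^+ 2 * sqnorm (G' - G)).
Proof.
rewrite residual_step devB dev_gossip.
apply: le_trans (sqnorm_contract _ l0 l1 (gossip_le _)) _.
rewrite lerD2l ler_wpM2l ?invr_ge0 ?subr_ge0 ?(ltW l1) //.
rewrite sqnormN devZ sqnormZ ler_wpM2l ?sqr_ge0 //.
have le1 : lambda ^+ 2 <= 1 by rewrite expr_le1 // ltW.
have gle (A : 'M[R]_(K, n)) : sqnorm (W *m dev A) <= sqnorm (dev A).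
  by apply: le_trans (gossip_le A) _; rewrite ler_piMl ?sqnorm_ge0.
rewrite dev_gossip; apply: le_trans (gle _) _.
by rewrite dev_gossip; apply: le_trans (gle _) _; exact: sqnorm_dev_le.
Qed.

(** The mean moves by [eta] times the mean estimator; the rest of the displacement is a difference
    of two consensus errors. *)
Lemma move_le X D G :
  sqnorm (tracking_step X D G - X) <= K%:R * (eta ^+ 2 * sqnorm (average G))
    + 2 * (sqnorm (dev (tracking_step X D G)) + sqnorm (dev X)).
Proof.
rewrite sqnorm_dev averageB tracking_average (addrAC (average X)) subrr add0r sqnormN sqnormZ.
by rewrite devB; have := sqnormB_le (dev (tracking_step X D G)) (dev X); lra.
Qed.

(** Starting from consensus with no dual term, the residual is [- eta W^2 G] up to a consensus
    component: this is how [zeta_0] enters. *)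
Lemma residual_init (x : 'rV[R]_n) D G : netB (atc_gt W) *m D = 0 ->
  let X := \matrix_(k < K) x in
  dev X = 0 /\
  sqnorm (dev (residual X D G)) = eta ^+ 2 * sqnorm (mix_deviation (netA (atc_gt W)) G).
Proof.
move=> D0 X; have dX : dev X = 0.
  apply/row_matrixP => k; rewrite row_dev row0 rowK.
  by rewrite /average (eq_mean (g := fun=> x)) ?mean_cst ?subrr // => i; rewrite rowK.
split=> //; rewrite /residual /tracking_step D0 subr0 /= mul1mx.
rewrite devB -mulmxA !dev_gossip devB dX mulmx0 subr0 sub0r devZ -scaleNr -!scalemxAr.
rewrite sqnormZ sqrrN; congr (_ * sqnorm _).
by rewrite /mix_deviation /dev mulmxBl !mulmxBr !mulmxA -(mulmxA W W J) !WJ.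
Qed.

End Block.
End Consensus.

(** * Summation of the recursions *)

Section Recursions.
Variable R : realType.

Lemma contraction_sum (r : R) (a d : nat -> R) (T : nat) :
  (forall i, 0 <= a i) -> (forall i, a i.+1 <= r * a i + d i) ->
  (1 - r) * \sum_(i < T) a i <= a 0%N - a T + \sum_(i < T) d i.
Proof.
move=> a0 rec; elim: T => [|T IH]; first by rewrite !big_ord0 mulr0 subrr add0r.
by rewrite !big_ord_recr /= mulrDr; have := rec T; lra.
Qed.

Lemma contraction_sum_le (r : R) (a d : nat -> R) (T : nat) :
  (forall i, 0 <= a i) -> (forall i, a i.+1 <= r * a i + d i) ->
  (1 - r) * \sum_(i < T) a i <= a 0%N + \sum_(i < T) d i.
Proof. by move=> a0 rec; have := contraction_sum T a0 rec; have := a0 T; lra. Qed.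

(** The left sum has one term more, because the displacement in round [i] involves the consensus
    error of round [i + 1]. *)
Lemma contraction_sum_succ (r : R) (a d : nat -> R) (T : nat) : 0 <= r ->
  (forall i, 0 <= a i) -> (forall i, a i.+1 <= r * a i + d i) ->
  (1 - r) * \sum_(i < T.+1) a i <= a 0%N + \sum_(i < T) d i.
Proof.
move=> r0 a0 rec; rewrite big_ord_recr /= mulrDr.
by have := contraction_sum T a0 rec; have := mulr_ge0 r0 (a0 T); lra.
Qed.

(** Here [m] is the displacement term, [a] its part due to the averaged estimators and [k] the
    consensus term. As [k] is bounded by a small multiple of [m] plus constants, [m] is bounded by
    [a] and constants. *)
Lemma aggregate_errors (tT V Z B0 Del a m k Sx Sy Rx Ry : R) :
  0 <= tT -> 0 <= V -> 0 <= Z -> B0 = Z + 4 * V + 48 * tT -> Del = 3 * m + 6 * tT ->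
  0 <= a -> 0 <= m -> 0 <= k -> Sx <= 2 * (V + Del) -> Sy <= 2 * (V + Del) ->
  k <= 6400^-1 * (B0 + 24 * m) -> m <= a + 4 * k ->
  Rx <= 2 * Sx + (4 * tT + 4 * k) -> Ry <= 2 * Sy + (4 * tT + 4 * k) ->
  Rx + Ry <= 5 * B0 + 50 * a.
Proof. by move=> *; lra. Qed.

(** [Gx], [Rx], [Sx], [Mv], [C] are sums over the rounds of squared averaged estimators, gradient
    errors, estimator errors, displacements and consensus errors; [tT] is the accumulated bias. *)
Lemma aggregate_bound (etax etay L c tT V Z Del Mv C Gx Gy Rx Ry Sx Sy Phi0 : R) :
  0 < etax -> 272 * etax <= etay -> 80 * (L * etay) <= 1 -> 0 <= L * c ->
  80 * (L * c) <= 1 -> 0 < L -> 0 <= tT -> 0 <= V -> 0 <= Z -> 0 <= Mv -> 0 <= C ->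
  0 <= Gx -> 0 <= Gy -> Del = 3 * L ^+ 2 * Mv + 6 * tT ->
  Sx <= 2 * (V + Del) -> Sy <= 2 * (V + Del) -> C <= c ^+ 2 * (Z + 4 * V + 8 * Del) ->
  Mv <= etax ^+ 2 * Gx + etay ^+ 2 * Gy + 4 * C ->
  Rx <= 2 * Sx + (4 * tT + 4 * (L ^+ 2 * C)) -> Ry <= 2 * Sy + (4 * tT + 4 * (L ^+ 2 * C)) ->
  etax / 8 * Gx + etay / 64 * Gy <= Phi0 + etay * (Rx + Ry) ->
  2 * (Gx + Gy) + 2 * (Rx + Ry) <= 48 / etax * Phi0
    + (240 * (etay / etax) + 10) * (Z + 4 * V + 48 * tT).
Proof.
move=> ex0 exy ey1 Lc0 cL L0 tT0 V0 Z0 Mv0 C0 Gx0 Gy0 DelE hSx hSy hC hMv hRx hRy hG.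
have ey0 : 0 < etay by clear -ex0 exy; lra.
pose a := L ^+ 2 * (etax ^+ 2 * Gx + etay ^+ 2 * Gy).
pose m := L ^+ 2 * Mv; pose k := L ^+ 2 * C.
pose B0 := Z + 4 * V + 48 * tT; rewrite -/B0.
have L2 : 0 < L ^+ 2 by rewrite exprn_gt0.
have a0 : 0 <= a by rewrite mulr_ge0 ?(ltW L2) // addr_ge0 // mulr_ge0 ?sqr_ge0.
have m0 : 0 <= m by rewrite mulr_ge0 // ltW.
have k0 : 0 <= k by rewrite mulr_ge0 // ltW.
have B00 : 0 <= B0 by rewrite /B0; clear -Z0 V0 tT0; lra.
have Lc : L ^+ 2 * c ^+ 2 <= 6400^-1.
  by rewrite -exprMn; move: (L * c) Lc0 cL => v; clear; move=> *; nra.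
have DelE' : Del = 3 * m + 6 * tT by rewrite DelE /m; ring.
have hk : k <= 6400^-1 * (B0 + 24 * m).
  apply: le_trans (_ : L ^+ 2 * (c ^+ 2 * (B0 + 24 * m)) <= _).
    by rewrite ler_pM2l // (_ : B0 + _ = Z + 4 * V + 8 * Del) // /B0 DelE'; ring.
  rewrite mulrA ler_wpM2r // addr_ge0 // mulr_ge0 //.
have hm : m <= a + 4 * k.
  by move: hMv; rewrite -(ler_pM2l L2) mulrDr (mulrCA (L ^+ 2) 4).
have hR : Rx + Ry <= 5 * B0 + 50 * a.
  exact: (aggregate_errors tT0 V0 Z0 (erefl B0) DelE' a0 m0 k0 hSx hSy hk hm hRx hRy).
have qx : 0 <= etax * Gx by rewrite mulr_ge0 // ltW.
have qy : 0 <= etay * Gy by rewrite mulr_ge0 // ltW.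
have Lex : 80 * (L * etax) <= 1.
  apply: le_trans ey1; rewrite ler_pM2l // ler_pM2l //.
  by clear -exy ex0; lra.
have Lexy : L * etay * (L * etax) <= (272 * 6400)^-1.
  have : 272 * (L * etax) <= L * etay by clear -exy L0; nra.
  have : 0 <= L * etax by rewrite mulr_ge0 // ltW.
  by move: (L * etax) (L * etay) ey1 => u v; clear; move=> *; nra.
have Leyy : L * etay * (L * etay) <= 6400^-1.
  have : 0 <= L * etay by rewrite mulr_ge0 // ltW.
  by move: (L * etay) ey1 => v; clear; move=> *; nra.
have hea : etay * a <= etax * Gx / (272 * 6400) + etay * Gy / 6400.
  have -> : etay * a = L * etay * (L * etax) * (etax * Gx) + L * etay * (L * etay) * (etay * Gy).
    by rewrite /a; ring.
  have h1 := ler_wpM2r qx Lexy; have h2 := ler_wpM2r qy Leyy.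
  by clear -h1 h2; lra.
have hG2 : etax / 16 * Gx + etay / 128 * Gy <= Phi0 + 5 * (etay * B0).
  have := ler_wpM2l (ltW ey0) hR; rewrite mulrDr => h.
  by clear -h hea hG qx qy; lra.
have ha : a <= (Gx + Gy) / 6400.
  have q1 : L * etax * (L * etax) <= 6400^-1.
    have : 0 <= L * etax by rewrite mulr_ge0 // ltW.
    by move: (L * etax) Lex => v; clear; move=> *; nra.
  have -> : a = L * etax * (L * etax) * Gx + L * etay * (L * etay) * Gy by rewrite /a; ring.
  have h1 := ler_wpM2r Gx0 q1; have h2 := ler_wpM2r Gy0 Leyy; clear -h1 h2; lra.
(* Since [etay >= 272 etax], the coefficient [etax / 16] serves for both sums. *)
have hGG : Gx + Gy <= 16 / etax * (Phi0 + 5 * (etay * B0)).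
  rewrite mulrAC ler_pdivlMr //.
  have : 16 * etax * Gy <= etay * Gy by rewrite ler_wpM2r //; clear -exy ex0; lra.
  have := qy; clear -hG2; lra.
have -> : 48 / etax * Phi0 + (240 * (etay / etax) + 10) * B0
   = 3 * (16 / etax * (Phi0 + 5 * (etay * B0))) + 10 * B0 by field; rewrite gt_eqF.
by move: (16 / etax * _) hGG => u hGG; clear -hGG hR ha Gx0 Gy0; lra.
Qed.

(** Expectations by round, all of squared quantities except [Phi]: [s] error of the averaged
    estimator, [f] error per agent, [c] consensus error, [u] residual, [mv] displacement, [g]
    averaged estimator, [r] its distance to the gradient, [n] gradient. The second letter names the
    block. *)
Variables (sx sy fx fy cx cy ux uy mv gx gy rx ry Phi nx ny : nat -> R).
Variables (p lam K b L tau V zx zy etax etay c : R).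
Let del i := 3 * L ^+ 2 * mv i + 6 * tau.
Hypotheses (p0 : 0 < p) (l0 : 0 <= lam) (l1 : lam < 1) (K0 : 0 < K) (b1 : 1 <= b).
Hypothesis Kbp : 1 <= 2 * (K * b * p).
Hypotheses (L0 : 0 < L) (tau0 : 0 <= tau) (V0 : 0 <= V) (zx0 : 0 <= zx) (zy0 : 0 <= zy).
Hypotheses (ex0 : 0 < etax) (exy : 272 * etax <= etay).
Hypotheses (etayE : etay = c * (1 - lam) ^+ 2) (cL : 80 * (L * c) <= 1).
Hypotheses (sx_ge0 : forall i, 0 <= sx i) (sy_ge0 : forall i, 0 <= sy i).
Hypotheses (fx_ge0 : forall i, 0 <= fx i) (fy_ge0 : forall i, 0 <= fy i).
Hypotheses (cx_ge0 : forall i, 0 <= cx i) (cy_ge0 : forall i, 0 <= cy i).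
Hypotheses (ux_ge0 : forall i, 0 <= ux i) (uy_ge0 : forall i, 0 <= uy i).
Hypotheses (gx_ge0 : forall i, 0 <= gx i) (gy_ge0 : forall i, 0 <= gy i).
Hypotheses (rx_ge0 : forall i, 0 <= rx i) (ry_ge0 : forall i, 0 <= ry i).
Hypotheses (mv_ge0 : forall i, 0 <= mv i) (Phi_ge0 : forall i, 0 <= Phi i).
Hypothesis sxS : forall i, sx i.+1 <= (1 - p) * sx i + (K * b)^-1 * del i.
Hypothesis syS : forall i, sy i.+1 <= (1 - p) * sy i + (K * b)^-1 * del i.
Hypothesis fxS : forall i, fx i.+1 <= (1 - p) * fx i + b^-1 * del i.
Hypothesis fyS : forall i, fy i.+1 <= (1 - p) * fy i + b^-1 * del i.
Hypothesis uxS : forall i,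
  ux i.+1 <= lam * ux i + (1 - lam)^-1 * (etax ^+ 2 * (2 * del i + 2 * p * fx i)).
Hypothesis uyS : forall i,
  uy i.+1 <= lam * uy i + (1 - lam)^-1 * (etay ^+ 2 * (2 * del i + 2 * p * fy i)).
Hypothesis cxS : forall i, cx i.+1 <= lam * cx i + (1 - lam)^-1 * ux i.
Hypothesis cyS : forall i, cy i.+1 <= lam * cy i + (1 - lam)^-1 * uy i.
Hypothesis mvE : forall i, mv i <= etax ^+ 2 * gx i + etay ^+ 2 * gy i
  + 2 * (cx i.+1 + cx i) + 2 * (cy i.+1 + cy i).
Hypothesis rxE : forall i, rx i <= 2 * sx i + 2 * (2 * tau + 2 * (L ^+ 2 * (cx i + cy i))).
Hypothesis ryE : forall i, ry i <= 2 * sy i + 2 * (2 * tau + 2 * (L ^+ 2 * (cx i + cy i))).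
Hypothesis PhiS : forall i, Phi i.+1 <= Phi i - etax / 8 * gx i - etay / 64 * gy i
  + 2 * etax * rx i + etay * ry i.
Hypotheses (sx_init : sx 0%N <= (K * b)^-1 * V) (sy_init : sy 0%N <= (K * b)^-1 * V).
Hypotheses (fx_init : fx 0%N <= b^-1 * V) (fy_init : fy 0%N <= b^-1 * V).
Hypotheses (ux_init : ux 0%N = etax ^+ 2 * zx) (uy_init : uy 0%N = etay ^+ 2 * zy).
Hypotheses (cx_init : cx 0%N = 0) (cy_init : cy 0%N = 0).
Hypothesis nxE : forall i, nx i <= 2 * gx i + 2 * rx i.
Hypothesis nyE : forall i, ny i <= 2 * gy i + 2 * ry i.

Variable T : nat.
Let S (F : nat -> R) : R := \sum_(i < T) F i.
Let B0 := (1 - lam) * (zx + zy) + 4 * V + 48 * (tau * T%:R).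

Let SD F G : S (fun i => F i + G i) = S F + S G.
Proof. by rewrite /S big_split. Qed.

Let SZ a F : S (fun i => a * F i) = a * S F.
Proof. by rewrite /S mulr_sumr. Qed.

Let Sle F G : (forall i, F i <= G i) -> S F <= S G.
Proof. by move=> h; apply: ler_sum. Qed.

Let Scst a : S (fun=> a) = a * T%:R.
Proof. by rewrite /S sumr_const card_ord mulr_natr. Qed.

Let S_ge0 F : (forall i, 0 <= F i) -> 0 <= S F.
Proof. by move=> h; apply: sumr_ge0. Qed.

Let T0 : 0 <= (T%:R : R). Proof. exact: ler0n. Qed.
Let l1' : 0 < 1 - lam. Proof. by rewrite subr_gt0. Qed.
Let exle : etax <= etay. Proof. by have := exy; have := ex0; lra. Qed.
Let ey0 : 0 < etay. Proof. exact: lt_le_trans exle. Qed.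
Let c0 : 0 < c. Proof. by move: ey0; rewrite etayE pmulr_lgt0 // exprn_gt0. Qed.
Let b0 : 0 < b. Proof. exact: lt_le_trans b1. Qed.
Let Lc0 : 0 <= L * c. Proof. by rewrite mulr_ge0 // ltW. Qed.

Let DelE : S del = 3 * L ^+ 2 * S mv + 6 * (tau * T%:R).
Proof. by rewrite /del SD SZ Scst; ring. Qed.

Let Del0 : 0 <= S del.
Proof.
apply: S_ge0 => i; apply: addr_ge0; last exact: mulr_ge0.
by apply: mulr_ge0 => //; apply: mulr_ge0 => //; exact: sqr_ge0.
Qed.

Let S_contraction r a d : (forall i, 0 <= a i) -> (forall i, a i.+1 <= r * a i + d i) ->
  (1 - r) * S a <= a 0%N + S d.
Proof. exact: contraction_sum_le. Qed.

(** The rate [p] and the factor [1 / (K b)] combine to [1 / (K b p) <= 2]. *)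
Let sum_average_error s : (forall i, 0 <= s i) ->
  (forall i, s i.+1 <= (1 - p) * s i + (K * b)^-1 * del i) ->
  s 0%N <= (K * b)^-1 * V -> S s <= 2 * (V + S del).
Proof.
move=> h1 h2 h3; have Kb0 : 0 < K * b by apply: mulr_gt0.
have := S_contraction h1 h2; rewrite SZ subKr => h4.
have h5 : p * S s <= (K * b)^-1 * (V + S del) by lra.
have h6 : K * b * p * S s <= V + S del.
  have := h5; rewrite -(ler_pM2l Kb0) (mulrA (K * b) _^-1) divff ?gt_eqF //.
  by rewrite mul1r mulrA.
by have := ler_wpM2r (S_ge0 h1) Kbp; lra.
Qed.

(** The factor [p] stays on the left, in the form in which increments see this error; so
    [1 / b <= 1] suffices and nothing is divided by [p]. *)
Let sum_error f : (forall i, 0 <= f i) ->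
  (forall i, f i.+1 <= (1 - p) * f i + b^-1 * del i) ->
  f 0%N <= b^-1 * V -> p * S f <= V + S del.
Proof.
move=> h1 h2 h3; have := S_contraction h1 h2; rewrite SZ subKr => h4.
have bi1 : b^-1 <= 1 by rewrite invf_le1.
have h5 : b^-1 * (V + S del) <= V + S del by rewrite ler_piMl // addr_ge0.
by lra.
Qed.

(** [e] is either step size. The bound uses the larger one, whose form [c (1 - lam)^2] cancels the
    factors lost in the two contractions. *)
Let sum_residual u f e z : (forall i, 0 <= u i) -> 0 <= e -> e <= etay -> 0 <= z ->
  (forall i, u i.+1 <= lam * u i + (1 - lam)^-1 * (e ^+ 2 * (2 * del i + 2 * p * f i))) ->
  u 0%N = e ^+ 2 * z -> p * S f <= V + S del -> (forall i, 0 <= f i) ->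
  (1 - lam) ^+ 2 * S u <= etay ^+ 2 * ((1 - lam) * z + 2 * V + 4 * S del).
Proof.
move=> h1 e0 ele z0 h2 h3 h4 f0; have := S_contraction h1 h2.
rewrite SZ SZ SD SZ (SZ (2 * p)) h3 => h5.
have e2 : e ^+ 2 <= etay ^+ 2 by rewrite ler_pXn2r ?nnegrE // ltW.
have pf0 : 0 <= p * S f by rewrite mulr_ge0 ?S_ge0 // ltW.
have h6 := h5; rewrite -(ler_pM2l l1') in h6.
have e3 : (1 - lam) * (e ^+ 2 * z + (1 - lam)^-1 * (e ^+ 2 * (2 * S del + 2 * p * S f)))
    = e ^+ 2 * ((1 - lam) * z + (2 * S del + 2 * p * S f)) by field; rewrite gt_eqF.
rewrite e3 mulrA -expr2 in h6; apply: le_trans h6 _.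
have q0 : 0 <= (1 - lam) * z by rewrite mulr_ge0 // ltW.
have D0 := Del0; apply: ler_pM; [exact: sqr_ge0 | | exact: e2 | ].
  by clear h1 h2 h3 h5 e2 e3; lra.
by clear h1 h2 h3 h5 e2 e3; lra.
Qed.

Let Sx := sum_average_error sx_ge0 sxS sx_init.
Let Sy := sum_average_error sy_ge0 syS sy_init.
Let Sux := sum_residual ux_ge0 (ltW ex0) exle zx0 uxS ux_init
  (sum_error fx_ge0 fxS fx_init) fx_ge0.
Let Suy := sum_residual uy_ge0 (ltW ey0) (lexx _) zy0 uyS uy_init
  (sum_error fy_ge0 fyS fy_init) fy_ge0.

Let C : R := \sum_(i < T.+1) (cx i + cy i).

Let sum_consensus : C <= c ^+ 2 * ((1 - lam) * (zx + zy) + 4 * V + 8 * S del).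
Proof.
have C_cx : (1 - lam) * \sum_(i < T.+1) cx i <= (1 - lam)^-1 * S ux.
  by have := contraction_sum_succ T l0 cx_ge0 cxS; rewrite cx_init add0r -mulr_sumr.
have C_cy : (1 - lam) * \sum_(i < T.+1) cy i <= (1 - lam)^-1 * S uy.
  by have := contraction_sum_succ T l0 cy_ge0 cyS; rewrite cy_init add0r -mulr_sumr.
have h : (1 - lam) * C <= (1 - lam)^-1 * (S ux + S uy).
  by rewrite /C big_split mulrDr [X in _ <= X]mulrDr; exact: lerD.
have l4 : 0 < (1 - lam) ^+ 4 by rewrite exprn_gt0.
rewrite -(ler_pM2l l4); rewrite -(ler_pM2l (exprn_gt0 3 l1')) in h.
have e1 : (1 - lam) ^+ 3 * ((1 - lam) * C) = (1 - lam) ^+ 4 * C by ring.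
have e2 : (1 - lam) ^+ 3 * ((1 - lam)^-1 * (S ux + S uy)) = (1 - lam) ^+ 2 * (S ux + S uy).
  by field; rewrite gt_eqF.
rewrite e1 e2 mulrDr in h; apply: le_trans h (le_trans (lerD Sux Suy) _).
by rewrite le_eqVlt; apply/orP; left; apply/eqP; rewrite etayE; ring.
Qed.

Let C_ge0 : 0 <= C.
Proof. by apply: sumr_ge0 => i _; exact: addr_ge0. Qed.

Let SC : S (fun i => cx i + cy i) <= C.
Proof. by rewrite /C big_ord_recr /= lerDl addr_ge0. Qed.

Let SC' : S (fun i => cx i.+1 + cy i.+1) <= C.
Proof. by rewrite /C big_ord_recl /= lerDr addr_ge0. Qed.

Let sum_moves : S mv <= etax ^+ 2 * S gx + etay ^+ 2 * S gy + 4 * C.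
Proof.
apply: (le_trans (y := S (fun i => (etax ^+ 2 * gx i + etay ^+ 2 * gy i)
    + (2 * (cx i.+1 + cy i.+1) + 2 * (cx i + cy i))))).
  by apply: Sle => i; have := mvE i; lra.
by rewrite !SD !SZ !SD; have := SC; have := SC'; rewrite !SD; lra.
Qed.

Let sum_gradient_error s r :
  (forall i, r i <= 2 * s i + 2 * (2 * tau + 2 * (L ^+ 2 * (cx i + cy i)))) ->
  S r <= 2 * S s + (4 * (tau * T%:R) + 4 * (L ^+ 2 * C)).
Proof.
move=> h.
apply: (le_trans (y := S (fun i => 2 * s i + (4 * tau + (4 * L ^+ 2) * (cx i + cy i))))).
  by apply: Sle => i; have := h i; lra.
have r3 : L ^+ 2 * S (fun i => cx i + cy i) <= L ^+ 2 * C by rewrite ler_pM2l // exprn_gt0.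
by rewrite SD SZ SD Scst (SZ (4 * L ^+ 2)); lra.
Qed.

Let telescope n : Phi n <= Phi 0%N + \sum_(i < n) (2 * etax * rx i + etay * ry i
  - etax / 8 * gx i - etay / 64 * gy i).
Proof.
elim: n => [|n IH]; first by rewrite big_ord0 addr0.
by rewrite big_ord_recr /=; have := PhiS n; lra.
Qed.

Let sum_descent : etax / 8 * S gx + etay / 64 * S gy <= Phi 0%N + etay * (S rx + S ry).
Proof.
have := telescope T; rewrite !big_split /= !sumrN -!mulr_sumr -!/(S _).
have q1 := Phi_ge0 T; have : (2 * etax) * S rx <= etay * S rx.
  by apply: ler_wpM2r; [exact: S_ge0 | have := exy; have := ex0; lra].
by lra.
Qed.

Lemma sum_gradients_le :
  \sum_(i < T) (nx i + ny i) <= 48 / etax * Phi 0%N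
    + (240 * (etay / etax) + 10)
      * ((1 - lam) * (zx + zy) + 4 * V + 48 * (tau * T%:R)).
Proof.
have ey1 : 80 * (L * etay) <= 1.
  have h : (1 - lam) ^+ 2 <= 1 by rewrite expr_le1 ?(ltW l1') // lerBlDr lerDl.
  by rewrite etayE; apply: le_trans cL; rewrite ler_pM2l // mulrA ler_piMr.
have hN : S (fun i => nx i + ny i) <= 2 * (S gx + S gy) + 2 * (S rx + S ry).
  apply: (le_trans (y := S (fun i => (2 * gx i + 2 * gy i) + (2 * rx i + 2 * ry i)))).
    by apply: Sle => i; rewrite addrACA; exact: lerD.
  by rewrite !SD !SZ !mulrDr.
apply: le_trans hN _.
apply: (aggregate_bound _ _ ey1 Lc0 _ _ _ _ _ _ C_ge0 _ _ DelE Sx Sy sum_consensus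
  sum_moves (sum_gradient_error rxE) (sum_gradient_error ryE) sum_descent) => //.
- exact: mulr_ge0.
- by apply: mulr_ge0; [exact: ltW | exact: addr_ge0].
- exact: S_ge0.
- exact: S_ge0.
- exact: S_ge0.
Qed.

End Recursions.

(** * Bias and smoothness of the oracles *)

Section Oracle.
Variables (R : realType) (K N d1 d2 n : nat).
Hypotheses (K0 : (0 < K)%N) (N0 : (0 < N)%N).
Variables (q g : 'I_K -> 'I_N -> 'rV[R]_d1 -> 'rV[R]_d2 -> 'rV[R]_n).
Variables (L sigma tau : R).
Hypothesis bias : forall k x y, rmean (fun s => sqnorm (q k s x y - g k s x y)) <= tau.
Hypothesis smooth : forall k x y x' y',
  rmean (fun s => sqnorm (g k s x y - g k s x' y'))
    <= L ^+ 2 * (sqnorm (x - x') + sqnorm (y - y')).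
Hypothesis variance : forall k x y,
  rmean (fun s => sqnorm (g k s x y - mean (fun s => g k s x y))) <= sigma ^+ 2.

(** Smoothness on average is available for the exact gradients [g]; passing from [q] to [g] at both
    points costs the bias twice, and three squares give the factor 3. *)
Lemma oracle_increment k x y x' y' :
  rmean (fun s => sqnorm (q k s x' y' - q k s x y))
    <= 3 * (L ^+ 2 * (sqnorm (x' - x) + sqnorm (y' - y))) + 6 * tau.
Proof.
apply: le_trans (_ : rmean (fun s => 3 * (sqnorm (q k s x' y' - g k s x' y')
    + (sqnorm (g k s x' y' - g k s x y) + sqnorm (q k s x y - g k s x y)))) <= _).
  apply: rmean_le => s; rewrite (sqnormBC (q k s x y)) addrA.
  apply: le_trans (sqnormD3_le _ _ _).
  by rewrite le_eqVlt; apply/orP; left; apply/eqP; congr sqnorm; rewrite !addrA !subrK.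
rewrite rmeanZ !rmeanD.
by have := bias k x' y'; have := bias k x y; have := smooth k x' y' x y; lra.
Qed.

Lemma oracle_variance k x y :
  rmean (fun s => sqnorm (q k s x y - mean (fun s => q k s x y))) <= 2 * sigma ^+ 2 + 2 * tau.
Proof.
apply: le_trans (sqnorm_mean_minimal (fun s => q k s x y) (mean (fun s => g k s x y))) _.
apply: le_trans (_ : rmean (fun s => 2 * sqnorm (q k s x y - g k s x y)
    + 2 * sqnorm (g k s x y - mean (fun s => g k s x y))) <= _).
  by apply: rmean_le => s; apply: le_trans (sqnormD_le _ _); rewrite addrA subrK.
by rewrite rmeanD !rmeanZ; have := bias k x y; have := variance k x y; lra.
Qed.

Definition global_gradient x y : 'rV[R]_n := mean (fun k => mean (fun s => g k s x y)).

Lemma global_gradient_smooth x y x' y' :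
  sqnorm (global_gradient x y - global_gradient x' y')
    <= L ^+ 2 * (sqnorm (x - x') + sqnorm (y - y')).
Proof.
rewrite -meanB; apply: le_trans (sqnorm_mean_le _) _.
rewrite -[X in _ <= X](rmean_cst _ K0); apply: rmean_le => k.
rewrite -meanB; apply: le_trans (sqnorm_mean_le _) _; exact: smooth.
Qed.

(** Two errors add up: finite differences replace gradients, and agents evaluate at their own points
    instead of the mean. Both are bounded agent by agent, so heterogeneity between agents does not
    enter. *)
Lemma oracle_bias (X : 'M[R]_(K, d1)) (Y : 'M[R]_(K, d2)) :
  sqnorm (average (full_batch q X Y) - global_gradient (average X) (average Y))
    <= 2 * tau + 2 * (L ^+ 2 * (K%:R^-1 * sqnorm (dev X) + K%:R^-1 * sqnorm (dev Y))).
Proof.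
pose a k s := q k s (row k X) (row k Y) - g k s (row k X) (row k Y).
pose c k s := g k s (row k X) (row k Y) - g k s (average X) (average Y).
have -> : average (full_batch q X Y) - global_gradient (average X) (average Y)
    = mean (fun k => mean (a k)) + mean (fun k => mean (c k)).
  rewrite /average /global_gradient -meanB -meanD; apply: eq_mean => k.
  rewrite rowK -meanB -meanD; apply: eq_mean => s.
  by rewrite /a /c addrA subrK.
have meanmean (u : 'I_K -> 'I_N -> 'rV[R]_n) : sqnorm (mean (fun k => mean (u k)))
    <= rmean (fun k => rmean (fun s => sqnorm (u k s))).
  apply: le_trans (sqnorm_mean_le _) _; apply: rmean_le => k; exact: sqnorm_mean_le.
apply: le_trans (sqnormD_le _ _) _; apply: lerD; rewrite ler_pM2l //.
  apply: le_trans (meanmean a) _; rewrite -[X in _ <= X](rmean_cst tau K0).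
  by apply: rmean_le => k; exact: bias.
apply: le_trans (meanmean c) _.
apply: le_trans (_ : rmean (fun k =>
    L ^+ 2 * (sqnorm (row k (dev X)) + sqnorm (row k (dev Y)))) <= _).
  by apply: rmean_le => k; rewrite !row_dev //; exact: smooth.
by rewrite rmeanZ rmeanD /rmean -!sqnorm_rows.
Qed.

End Oracle.

Section Risk.
Variables (R : realType).

Lemma differentiable_rmean n K (f : 'I_K -> 'rV[R]_n -> R) x :
  (forall k, differentiable (f k) x) -> differentiable (fun z => rmean (fun k => f k z)) x.
Proof.
move=> df; have := differentiable_lincomb (fun=> K%:R^-1) df.
by congr (differentiable _ _); apply/funext => z; rewrite /rmean mulr_sumr.
Qed.

Lemma grad_rmean n K (f : 'I_K -> 'rV[R]_n -> R) x :
  (forall k, differentiable (f k) x) ->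
  grad (fun z => rmean (fun k => f k z)) x = mean (fun k => grad (f k) x).
Proof.
move=> df; rewrite /mean scaler_sumr -(grad_lincomb (fun=> K%:R^-1) df).
by congr (grad _ _); apply/funext => z; rewrite /rmean mulr_sumr.
Qed.

Variables (K N d1 d2 : nat) (Q : losses R K N d1 d2).
Hypothesis cdQ : forall k s, continuously_differentiable (Q k s).

Lemma differentiable_loss_x k s y x : differentiable (Q k s ^~ y) x.
Proof.
have [dQ _] := cdQ k s.
apply: (differentiable_comp (f := fun x => (x, y)) (g := fun z => Q k s z.1 z.2)).
  apply: differentiable_pair => //; exact: differentiable_cst.
exact: dQ.
Qed.

Lemma differentiable_loss_y k s x y : differentiable (Q k s x) y.
Proof.
have [dQ _] := cdQ k s.
apply: (differentiable_comp (f := fun y => (x, y)) (g := fun z => Q k s z.1 z.2)).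
  apply: differentiable_pair => //; exact: differentiable_cst.
exact: dQ.
Qed.

Lemma differentiable_risk_x y x : differentiable (risk Q ^~ y) x.
Proof.
by apply: differentiable_rmean => k; apply: differentiable_rmean => s; exact: differentiable_loss_x.
Qed.

Lemma differentiable_risk_y x y : differentiable (risk Q x) y.
Proof.
by apply: differentiable_rmean => k; apply: differentiable_rmean => s; exact: differentiable_loss_y.
Qed.

Lemma gradx_risk x y : gradx (risk Q) x y = global_gradient (fun k s => gradx (Q k s)) x y.
Proof.
rewrite /gradx grad_rmean; last first.
  by move=> k; apply: differentiable_rmean => s; exact: differentiable_loss_x.
by apply: eq_mean => k; rewrite grad_rmean // => s; exact: differentiable_loss_x.
Qed.

Lemma grady_risk x y : grady (risk Q) x y = global_gradient (fun k s => grady (Q k s)) x y.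
Proof.
rewrite /grady grad_rmean; last first.
  by move=> k; apply: differentiable_rmean => s; exact: differentiable_loss_y.
by apply: eq_mean => k; rewrite grad_rmean // => s; exact: differentiable_loss_y.
Qed.

End Risk.

(** * The state process *)

Section Process.
Variables (R : realType) (K N d1 d2 b : nat) (p ex ey dx dy : R).
Hypotheses (K0 : (0 < K)%N) (N0 : (0 < N)%N) (b0 : (0 < b)%N).
Hypotheses (p0 : 0 <= p) (p1 : p <= 1).
Variables (Q : losses R K N d1 d2) (W : 'M[R]_K).
Variables (x0 : 'rV[R]_d1) (y0 : 'rV[R]_d2) (Dx0 : 'M[R]_(K, d1)) (Dy0 : 'M[R]_(K, d2)).

Let h := Params p 0 ex ey dx dy b b.
Let S1 := round_sampler K b N0.
Let st := state R K d1 d2.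

Definition next_X (s : st) := tracking_step W ex (stX s) (stDx s) (stGx s).
Definition next_Y (s : st) := tracking_step W (- ey) (stY s) (stDy s) (stGy s).

(** The estimators are given the round index 0, which [round_sampler] ignores. *)
Definition next_state (s : st) (x : outcome K N b) : st :=
  State (next_X s) (next_Y s)
    (stDx s + netB (atc_gt W) *m next_X s) (stDy s + netB (atc_gt W) *m next_Y s)
    (estimator_step h S1 (cwx Q dx) 0 (stX s) (next_X s) (stY s) (next_Y s) (stGx s) x)
    (estimator_step h S1 (cwy Q dy) 0 (stX s) (next_X s) (stY s) (next_Y s) (stGy s) x).

Definition init_state (x : outcome K N b) : st :=
  zoma Q (atc_gt W) (atc_gt W) h S1 x0 y0 Dx0 Dy0 0 x.

(** Peeling off the last round reduces a recursion between rounds to an inequality valid for every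
    state. *)
Fixpoint Est (i : nat) (f : st -> R) : R :=
  if i is i'.+1 then Est i' (fun s => Elaw p (fun x => f (next_state s x)))
  else Elaw p (fun x => f (init_state x)).

Lemma Est_le i (f g : st -> R) : (forall s, f s <= g s) -> Est i f <= Est i g.
Proof.
elim: i f g => [|i IH] f g fg /=; first by apply: Elaw_le.
by apply: IH => s; apply: Elaw_le.
Qed.

Lemma Elaw_ge0 (f : outcome K N b -> R) : (forall x, 0 <= f x) -> 0 <= Elaw p f.
Proof. by move=> f0; apply: sumr_ge0 => x _; rewrite mulr_ge0 // law_ge0. Qed.

Lemma Est_ge0 i (f : st -> R) : (forall s, 0 <= f s) -> 0 <= Est i f.
Proof.
elim: i f => [|i IH] f f0 /=; first exact: Elaw_ge0.
by apply: IH => s; exact: Elaw_ge0.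
Qed.

Lemma eq_Est i (f g : st -> R) : (forall s, f s = g s) -> Est i f = Est i g.
Proof. by move=> /funext ->. Qed.

Lemma EstD i (f g : st -> R) : Est i (fun s => f s + g s) = Est i f + Est i g.
Proof.
elim: i f g => [|i IH] f g /=; first exact: ElawD.
by rewrite -IH; apply: eq_Est => s; rewrite ElawD.
Qed.

Lemma EstZ i c (f : st -> R) : Est i (fun s => c * f s) = c * Est i f.
Proof.
elim: i f => [|i IH] f /=; first exact: ElawZ.
by rewrite -IH; apply: eq_Est => s; rewrite ElawZ.
Qed.

Lemma Est_cst i c : Est i (fun=> c) = c.
Proof.
elim: i => [|i IH] /=; first exact: Elaw_cst.
by rewrite -[RHS]IH; apply: eq_Est => s; exact: Elaw_cst.
Qed.

Variables (disp : measure_display) (Om : measurableType disp).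
Variables (Pr : probability Om R) (S : sampler K N N Om).
Hypothesis hS : sampling_scheme Pr p S.

(** The value on the empty history is arbitrary: the state of round [i] uses [i + 1] outcomes. *)
Let run (l : seq (outcome K N b)) : st :=
  if l is x :: l' then foldl next_state (init_state x) l' else State 0 0 0 0 0 0.

Let observeE i w k (j : 'I_b) : draw S1 k 0 j (observe b S i w) = draw S k i j w.
Proof. by rewrite /= (valK j) ffunE. Qed.

Let estimator_init_observe n (q : 'I_K -> 'I_N -> 'rV[R]_d1 -> 'rV[R]_d2 -> 'rV[R]_n) X Y w :
  estimator_init h S q X Y w = estimator_init h S1 q X Y (observe b S 0 w).
Proof.
apply/row_matrixP => k; rewrite !rowK; apply: eq_mean => j.
by rewrite -(observeE 0 w k j).
Qed.

Let estimator_step_observe n (q : 'I_K -> 'I_N -> 'rV[R]_d1 -> 'rV[R]_d2 -> 'rV[R]_n)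
    i X X' Y Y' G w :
  estimator_step h S q i X X' Y Y' G w
    = estimator_step h S1 q 0 X X' Y Y' G (observe b S i w).
Proof.
apply/row_matrixP => k; rewrite !rowK /=; case: ifP => _.
  by apply: eq_mean => j; rewrite ffunE.
by congr (_ *: (_ - _) + _); apply: eq_mean => j; rewrite (valK (j : 'I_b)) ffunE.
Qed.

Let run_observe i w :
  zoma Q (atc_gt W) (atc_gt W) h S x0 y0 Dx0 Dy0 i w
    = run (mkseq ((observe b S) ^~ w) i.+1).
Proof.
elim: i => [|i IH].
  by rewrite /= /init_state /= -!estimator_init_observe.
have -> : mkseq ((observe b S) ^~ w) i.+2
    = rcons (mkseq ((observe b S) ^~ w) i.+1) (observe b S i.+1 w).
  by rewrite /mkseq -[i.+2]addn1 iotaD map_cat /= cats1.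
have -> : run (rcons (mkseq ((observe b S) ^~ w) i.+1) (observe b S i.+1 w))
    = next_state (run (mkseq ((observe b S) ^~ w) i.+1)) (observe b S i.+1 w).
  by rewrite /= foldl_rcons.
rewrite -IH /next_state -!estimator_step_observe /next_X /next_Y /tracking_step scaleNr opprK.
by [].
Qed.

Let EE_run i (f : st -> R) : EE p i.+1 (fun l => f (run l)) = Est i f.
Proof.
elim: i f => [|i IH] f; first by [].
rewrite [RHS]/= -IH.
rewrite -[LHS]/(EE p i.+1 (fun l => \sum_x law p x * f (run (rcons l x)))).
apply: eq_EE => l sl.
by case: l sl => // x l _; rewrite /Elaw; apply: eq_bigr => y _; rewrite /= foldl_rcons.
Qed.

Lemma Ex_Est i (f : st -> R) :
  Ex Pr (fun w => f (zoma Q (atc_gt W) (atc_gt W) h S x0 y0 Dx0 Dy0 i w)) = Est i f.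
Proof.
rewrite -EE_run -(Ex_history hS); congr Ex; apply/funext => w.
by rewrite run_observe.
Qed.

End Process.

(** * One-round inequalities in expectation *)

Section OracleBlock.
Variables (R : realType) (K N b d1 d2 n : nat) (p ex ey dx dy : R).
Hypotheses (K0 : (0 < K)%N) (N0 : (0 < N)%N) (b0 : (0 < b)%N).
Hypotheses (p0 : 0 <= p) (p1 : p <= 1).
Variables (q g : 'I_K -> 'I_N -> 'rV[R]_d1 -> 'rV[R]_d2 -> 'rV[R]_n).
Variables (L sigma tau : R).
Hypothesis bias : forall k x y, rmean (fun s => sqnorm (q k s x y - g k s x y)) <= tau.
Hypothesis smooth : forall k x y x' y',
  rmean (fun s => sqnorm (g k s x y - g k s x' y'))
    <= L ^+ 2 * (sqnorm (x - x') + sqnorm (y - y')).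
Hypothesis variance : forall k x y,
  rmean (fun s => sqnorm (g k s x y - mean (fun s => g k s x y))) <= sigma ^+ 2.

Let h := Params p 0 ex ey dx dy b b.
Let S1 := round_sampler K b N0.
Let KR : 0 < (K%:R : R). Proof. by rewrite ltr0n. Qed.
Let bR : 0 < (b%:R : R). Proof. by rewrite ltr0n. Qed.

Variables (X X' : 'M[R]_(K, d1)) (Y Y' : 'M[R]_(K, d2)) (G : 'M[R]_(K, n)).
Let mv := K%:R^-1 * (sqnorm (X' - X) + sqnorm (Y' - Y)).
Let next x := estimator_step h S1 q 0 X X' Y Y' G x.

Let increment_le :
  rmean (fun k => rmean (fun s => sqnorm (q k s (row k X') (row k Y') - q k s (row k X) (row k Y))))
    <= 3 * L ^+ 2 * mv + 6 * tau.
Proof.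
apply: le_trans (_ : rmean (fun k =>
    3 * (L ^+ 2 * (sqnorm (row k (X' - X)) + sqnorm (row k (Y' - Y))))
    + 6 * tau) <= _).
  by apply: rmean_le => k; rewrite !raddfB; exact: (oracle_increment bias smooth).
rewrite rmeanD rmean_cst // !rmeanZ rmeanD lerD2r.
by rewrite /rmean -!sqnorm_rows -mulrDr -/mv mulrA.
Qed.

Lemma block_average_error :
  Elaw p (fun x => sqnorm (average (next x - full_batch q X' Y')))
    <= (1 - p) * sqnorm (average (G - full_batch q X Y))
       + (K%:R * b%:R)^-1 * (3 * L ^+ 2 * mv + 6 * tau).
Proof.
apply: le_trans (step_average_error K0 N0 b0 p0 p1 ex ey dx dy q X X' Y Y' G) _.
by rewrite lerD2l ler_pM2l // invr_gt0 mulr_gt0.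
Qed.

Lemma block_error :
  Elaw p (fun x => K%:R^-1 * sqnorm (next x - full_batch q X' Y'))
    <= (1 - p) * (K%:R^-1 * sqnorm (G - full_batch q X Y))
       + b%:R^-1 * (3 * L ^+ 2 * mv + 6 * tau).
Proof.
rewrite ElawZ ler_pdivrMl //.
apply: le_trans (step_error K0 N0 b0 p0 p1 ex ey dx dy q X X' Y Y' G) _.
rewrite mulrDr (mulrCA _ (1 - p)) mulVKf ?gt_eqF // lerD2l -(mulrA K%:R).
by rewrite !ler_pM2l ?invr_gt0.
Qed.

Lemma block_increment :
  Elaw p (fun x => K%:R^-1 * sqnorm (next x - G))
    <= 2 * (3 * L ^+ 2 * mv + 6 * tau)
       + 2 * p * (K%:R^-1 * sqnorm (G - full_batch q X Y)).
Proof.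
rewrite ElawZ ler_pdivrMl //.
apply: le_trans (step_increment K0 N0 b0 p0 p1 ex ey dx dy q X X' Y Y' G) _.
rewrite mulrDr (mulrCA K%:R (2 * p)) [K%:R * (_ * sqnorm (G - _))]mulVKf ?gt_eqF // lerD2r.
by rewrite (mulrCA K%:R 2) ler_pM2l // ler_pM2l.
Qed.

Lemma block_init :
  Elaw p (fun x => sqnorm (average (estimator_init h S1 q X Y x - full_batch q X Y)))
    <= (K%:R * b%:R)^-1 * (2 * sigma ^+ 2 + 2 * tau) /\
  Elaw p (fun x => K%:R^-1 * sqnorm (estimator_init h S1 q X Y x - full_batch q X Y))
    <= b%:R^-1 * (2 * sigma ^+ 2 + 2 * tau).
Proof.
have V : rmean (fun k => rmean (fun s => sqnorm
     (q k s (row k X) (row k Y) - mean (fun s => q k s (row k X) (row k Y)))))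
     <= 2 * sigma ^+ 2 + 2 * tau.
  rewrite -[X in _ <= X](rmean_cst _ K0); apply: rmean_le => k.
  exact: (oracle_variance bias variance).
have [-> e2] := init_variance p K0 N0 b0 ex ey dx dy q X Y.
split; first by rewrite ler_pM2l // invr_gt0 mulr_gt0.
have e v : K%:R^-1 * (K%:R / b%:R * v) = b%:R^-1 * v :> R by field; rewrite !gt_eqF.
by rewrite ElawZ e2 e ler_pM2l // invr_gt0.
Qed.

End OracleBlock.

Section ConsensusBlock.
Variables (R : realType) (K N b n : nat) (p eta lambda : R).
Hypotheses (K0 : (0 < K)%N) (N0 : (0 < N)%N) (p0 : 0 <= p) (p1 : p <= 1).
Variable W : 'M[R]_K.
Hypotheses (dsW : doubly_stochastic W) (l0 : 0 <= lambda) (l1 : lambda < 1).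
Hypothesis contractW : forall n (V : 'M[R]_(K, n)),
  \sum_k row k V = 0 -> sqnorm (W *m V) <= lambda ^+ 2 * sqnorm V.
Variables (X D G : 'M[R]_(K, n)).
Let X' := tracking_step W eta X D G.
Let D' := D + netB (atc_gt W) *m X'.
Let KR : 0 < (K%:R^-1 : R). Proof. by rewrite invr_gt0 ltr0n. Qed.

Lemma block_consensus :
  Elaw p (fun _ : outcome K N b => K%:R^-1 * sqnorm (dev X'))
    <= lambda * (K%:R^-1 * sqnorm (dev X))
       + (1 - lambda)^-1 * (K%:R^-1 * sqnorm (dev (residual W eta X D G))).
Proof.
(* The next iterate is determined by the current state, so the expectation is that of a constant. *)
rewrite Elaw_cst //; have := consensus_step K0 dsW l0 l1 contractW eta X D G.
rewrite -(ler_pM2l KR) => h; apply: le_trans h _.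
by rewrite le_eqVlt; apply/orP; left; apply/eqP; ring.
Qed.

Lemma block_residual (G' : outcome K N b -> 'M[R]_(K, n)) c :
  Elaw p (fun x => K%:R^-1 * sqnorm (G' x - G)) <= c ->
  Elaw p (fun x => K%:R^-1 * sqnorm (dev (residual W eta X' D' (G' x))))
    <= lambda * (K%:R^-1 * sqnorm (dev (residual W eta X D G)))
       + (1 - lambda)^-1 * (eta ^+ 2 * c).
Proof.
move=> hc; pose u := lambda * (K%:R^-1 * sqnorm (dev (residual W eta X D G))).
apply: le_trans (_ : Elaw p (fun x =>
    u + (1 - lambda)^-1 * (eta ^+ 2 * (K%:R^-1 * sqnorm (G' x - G)))) <= _).
  apply: Elaw_le => // x; rewrite /u.
  have := residual_contract K0 dsW l0 l1 contractW eta X D G (G' x).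
  rewrite -(ler_pM2l KR) => h; apply: le_trans h _.
  by rewrite le_eqVlt; apply/orP; left; apply/eqP; ring.
rewrite ElawD Elaw_cst // !ElawZ lerD2l -/(Elaw p _) ler_pM2l ?invr_gt0 ?subr_gt0 //.
by rewrite -ElawZ ler_wpM2l // sqr_ge0.
Qed.

Lemma block_move :
  K%:R^-1 * sqnorm (X' - X) <= eta ^+ 2 * sqnorm (average G)
    + 2 * (K%:R^-1 * sqnorm (dev X') + K%:R^-1 * sqnorm (dev X)).
Proof.
have := move_le K0 dsW eta X D G; rewrite -(ler_pM2l KR) => h; apply: le_trans h _.
rewrite le_eqVlt; apply/orP; left; apply/eqP.
by field; rewrite pnatr_eq0 -lt0n.
Qed.

End ConsensusBlock.

(** * Averaged gradients of the iterates *)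

Section Primal.
Variables (R : realType) (d1 d2 : nat) (J : 'rV[R]_d1 -> 'rV[R]_d2 -> R).

Lemma primal_ge x y : max_attained J -> J x y <= primal J x.
Proof.
move=> maxJ; apply: ub_le_sup; last by exists y.
by have [y' hy'] := maxJ x; exists (J x y') => _ [z _ <-]; exact: hy'.
Qed.

Lemma primal_ge_inf x : has_lbound (range (primal J)) -> primal_inf J <= primal J x.
Proof. by move=> lbJ; apply: ge_inf => //; exists x. Qed.

End Primal.

Section Analysis.
Variables (R : realType) (K N d1 d2 b : nat) (p ex ey dx dy : R).
Hypotheses (K0 : (0 < K)%N) (N0 : (0 < N)%N) (b0 : (0 < b)%N).
Hypotheses (p0 : 0 < p) (p1 : p <= 1) (Kbp : 1 <= 2 * (K%:R * b%:R * p)).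
Variables (Q : losses R K N d1 d2) (W : 'M[R]_K) (L nu sigma tau lambda c : R).
Variables (x0 : 'rV[R]_d1) (y0 : 'rV[R]_d2) (Dx0 : 'M[R]_(K, d1)) (Dy0 : 'M[R]_(K, d2)).
Hypotheses (nu0 : 0 < nu) (nuL : nu <= L) (dx0 : 0 < dx) (dy0 : 0 < dy).
Hypotheses (maxQ : max_attained (risk Q)) (lbQ : has_lbound (range (primal (risk Q)))).
Hypotheses (PLQ : PL_in_y (risk Q) nu) (esQ : expected_smoothness Q L).
Hypothesis bvQ : bounded_variance Q sigma.
Hypotheses (dsW : doubly_stochastic W) (l0 : 0 <= lambda) (l1 : lambda < 1).
Hypothesis contractW : forall n (V : 'M[R]_(K, n)),
  \sum_k row k V = 0 -> sqnorm (W *m V) <= lambda ^+ 2 * sqnorm V.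
Hypotheses (hDx : netB (atc_gt W) *m Dx0 = 0) (hDy : netB (atc_gt W) *m Dy0 = 0).
Hypotheses (tau_x : d1%:R * (L ^+ 2 * dx ^+ 2) <= tau) (tau_y : d2%:R * (L ^+ 2 * dy ^+ 2) <= tau).
Hypotheses (ex0 : 0 < ex) (exy : 272 * (L ^+ 2 / nu) * ex <= ey * nu).
Hypotheses (eyE : ey = c * (1 - lambda) ^+ 2) (cL : 80 * (L * c) <= 1).

Let J := risk Q.
Let P := primal J.
Let Pinf := primal_inf J.
Let st := state R K d1 d2.
Let E i (f : st -> R) := Est b p ex ey dx dy N0 Q W x0 y0 Dx0 Dy0 i f.
Let qx := cwx Q dx.
Let qy := cwy Q dy.
Let gx k s := gradx (Q k s).
Let gy k s := grady (Q k s).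

Let L0 : 0 < L. Proof. exact: lt_le_trans nu0 nuL. Qed.
Let KR : 0 < (K%:R : R). Proof. by rewrite ltr0n. Qed.
Let bR : 0 < (b%:R : R). Proof. by rewrite ltr0n. Qed.
Let Ki0 : 0 <= (K%:R^-1 : R). Proof. by rewrite invr_ge0 ler0n. Qed.

Let smooth_x k x y x' y' : rmean (fun s => sqnorm (gx k s x y - gx k s x' y'))
    <= L ^+ 2 * (sqnorm (x - x') + sqnorm (y - y')).
Proof. by case: esQ => _ /(_ k x y x' y') []. Qed.

Let smooth_y k x y x' y' : rmean (fun s => sqnorm (gy k s x y - gy k s x' y'))
    <= L ^+ 2 * (sqnorm (x - x') + sqnorm (y - y')).
Proof. by case: esQ => _ /(_ k x y x' y') []. Qed.

Let bias_x k x y : rmean (fun s => sqnorm (qx k s x y - gx k s x y)) <= tau.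
Proof.
apply: le_trans tau_x; have [cdQ _] := esQ.
apply: (cw_bias (f := fun s => Q k s ^~ y) x dx0).
  by move=> s z; exact: differentiable_loss_x.
by move=> z z'; have := smooth_x k z y z' y; rewrite subrr sqnorm0 addr0.
Qed.

Let bias_y k x y : rmean (fun s => sqnorm (qy k s x y - gy k s x y)) <= tau.
Proof.
apply: le_trans tau_y; have [cdQ _] := esQ.
apply: (cw_bias (f := fun s => Q k s x) y dy0).
  by move=> s z; exact: differentiable_loss_y.
by move=> z z'; have := smooth_y k x z x z'; rewrite subrr sqnorm0 add0r.
Qed.

Let variance_x k x y :
  rmean (fun s => sqnorm (gx k s x y - mean (fun s => gx k s x y))) <= sigma ^+ 2.
Proof. by have [e _ h _] := bvQ k x y; rewrite e. Qed.

Let variance_y k x y :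
  rmean (fun s => sqnorm (gy k s x y - mean (fun s => gy k s x y))) <= sigma ^+ 2.
Proof. by have [_ e _ h] := bvQ k x y; rewrite e. Qed.

Let tau_ge0 : 0 <= tau.
Proof. by apply: le_trans tau_x; rewrite mulr_ge0 // mulr_ge0 // sqr_ge0. Qed.

Let gradxJ x y : gradx J x y = global_gradient gx x y.
Proof. by apply: gradx_risk; case: esQ. Qed.

Let gradyJ x y : grady J x y = global_gradient gy x y.
Proof. by apply: grady_risk; case: esQ. Qed.

Let smooth_Jx x y x' y' : sqnorm (gradx J x y - gradx J x' y')
    <= L ^+ 2 * (sqnorm (x - x') + sqnorm (y - y')).
Proof. by rewrite !gradxJ; exact: (global_gradient_smooth K0 smooth_x). Qed.

Let smooth_Jy x y x' y' : sqnorm (grady J x y - grady J x' y')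
    <= L ^+ 2 * (sqnorm (x - x') + sqnorm (y - y')).
Proof. by rewrite !gradyJ; exact: (global_gradient_smooth K0 smooth_y). Qed.

Let le_primal x y : J x y <= P x.
Proof. exact: primal_ge. Qed.

Let primal_inf_le x : Pinf <= P x.
Proof. exact: primal_ge_inf. Qed.

(** Functions of the state whose expectations are the sequences of the summation argument. [f_mv]
    looks one round ahead, since the next iterates are already determined by the state. *)
Let xa (s : st) := average (stX s).
Let ya (s : st) := average (stY s).
Let f_sx (s : st) := sqnorm (average (stGx s - full_batch qx (stX s) (stY s))).
Let f_sy (s : st) := sqnorm (average (stGy s - full_batch qy (stX s) (stY s))).
Let f_fx (s : st) := K%:R^-1 * sqnorm (stGx s - full_batch qx (stX s) (stY s)).
Let f_fy (s : st) := K%:R^-1 * sqnorm (stGy s - full_batch qy (stX s) (stY s)).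
Let f_cx (s : st) := K%:R^-1 * sqnorm (dev (stX s)).
Let f_cy (s : st) := K%:R^-1 * sqnorm (dev (stY s)).
Let f_ux (s : st) := K%:R^-1 * sqnorm (dev (residual W ex (stX s) (stDx s) (stGx s))).
Let f_uy (s : st) := K%:R^-1 * sqnorm (dev (residual W (- ey) (stY s) (stDy s) (stGy s))).
Let f_mv (s : st) := K%:R^-1 * (sqnorm (next_X ex W s - stX s) + sqnorm (next_Y ey W s - stY s)).
Let f_gx (s : st) := sqnorm (average (stGx s)).
Let f_gy (s : st) := sqnorm (average (stGy s)).
Let f_rx (s : st) := sqnorm (average (stGx s) - gradx J (xa s) (ya s)).
Let f_ry (s : st) := sqnorm (average (stGy s) - grady J (xa s) (ya s)).
Let f_nx (s : st) := sqnorm (gradx J (xa s) (ya s)).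
Let f_ny (s : st) := sqnorm (grady J (xa s) (ya s)).
Let f_Phi (s : st) := (P (xa s) - Pinf) + (P (xa s) - J (xa s) (ya s)) / 16.
Let f_zx (s : st) := K%:R^-1 * sqnorm (mix_deviation (netA (atc_gt W)) (stGx s)).
Let f_zy (s : st) := K%:R^-1 * sqnorm (mix_deviation (netA (atc_gt W)) (stGy s)).

Let E_next i (f g : st -> R) :
  (forall s, Elaw p (fun x => f (next_state (b := b) p ex ey dx dy N0 Q W s x)) <= g s) ->
  E i.+1 f <= E i g.
Proof. by move=> h; exact: (Est_le b ex ey dx dy N0 (ltW p0) p1 Q W x0 y0 Dx0 Dy0 i h). Qed.

Let sq0 m n (A : 'M[R]_(m, n)) : 0 <= sqnorm A := sqnorm_ge0 A.
Let Ksq0 m n (A : 'M[R]_(m, n)) : 0 <= K%:R^-1 * sqnorm A.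
Proof. by rewrite mulr_ge0. Qed.
Let p0' : 0 <= p := ltW p0.

Let V := 2 * sigma ^+ 2 + 2 * tau.

Lemma average_gradient_le (T : nat) :
  \sum_(i < T) (E i f_nx + E i f_ny) <= 48 / ex * E 0 f_Phi
    + (240 * (ey / ex) + 10)
      * ((1 - lambda) * (E 0 f_zx + E 0 f_zy) + 4 * V + 48 * (tau * T%:R)).
Proof.
have E_ge0 i f : (forall s, 0 <= f s) -> 0 <= E i f by move=> h; apply: Est_ge0.
have ED i f g : E i (fun s => f s + g s) = E i f + E i g by apply: EstD.
have EZ i a f : E i (fun s => a * f s) = a * E i f by apply: EstZ.
have Ec i a : E i (fun=> a) = a by apply: Est_cst.
have Ele i f g : (forall s, f s <= g s) -> E i f <= E i g.
  by move=> h; rewrite /E; apply: Est_le.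
have eyx : 272 * ex <= ey.
  have h : 272 * (L ^+ 2 / nu) * ex <= ey * nu by [].
  rewrite -(ler_pM2r nu0); apply: le_trans h.
  have : nu <= L ^+ 2 / nu by rewrite ler_pdivlMr // expr2; apply: ler_pM => //; exact: ltW.
  by move/(ler_wpM2l (ltW ex0)); lra.
have ey0 : 0 < ey by have := ex0; lra.
have l1' : 0 < 1 - lambda by rewrite subr_gt0.
have c0 : 0 < c by move: ey0; rewrite eyE pmulr_lgt0 // exprn_gt0.
have eyL : 80 * L * ey <= 1.
  apply: le_trans cL; rewrite eyE (mulrA 80) mulrA ler_piMr //.
    by rewrite mulr_ge0 ?(ltW c0) // mulr_ge0 // ltW.
  rewrite expr_le1 ?(ltW l1') //; first by rewrite lerBlDr lerDl.
(* Linearity of the expectation in the shapes that follow, so that each recursion is checked at a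
   fixed state. *)
have lin1 i a f a' g a'' d : E i (fun s => a * f s + a' * (a'' * g s + d))
    = a * E i f + a' * (a'' * E i g + d) by rewrite ED !EZ ED EZ Ec.
have lin2 i a f a' g : E i (fun s => a * f s + a' * g s) = a * E i f + a' * E i g.
  by rewrite ED !EZ.
have lin3 i a f a' e a1 a2 g d a3 k :
    E i (fun s => a * f s + a' * (e * (a1 * (a2 * g s + d) + a3 * k s)))
      = a * E i f + a' * (e * (a1 * (a2 * E i g + d) + a3 * E i k)).
  by rewrite ED !EZ ED !EZ ED EZ Ec.
have hsx i : E i.+1 f_sx <= (1 - p) * E i f_sx
    + (K%:R * b%:R)^-1 * (3 * L ^+ 2 * E i f_mv + 6 * tau).
  rewrite -lin1; apply: E_next => s.
  exact: (block_average_error ex ey dx dy K0 N0 b0 p0' p1 bias_x smooth_x).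
have hsy i : E i.+1 f_sy <= (1 - p) * E i f_sy
    + (K%:R * b%:R)^-1 * (3 * L ^+ 2 * E i f_mv + 6 * tau).
  rewrite -lin1; apply: E_next => s.
  exact: (block_average_error ex ey dx dy K0 N0 b0 p0' p1 bias_y smooth_y).
have hfx i : E i.+1 f_fx <= (1 - p) * E i f_fx + b%:R^-1 * (3 * L ^+ 2 * E i f_mv + 6 * tau).
  rewrite -lin1; apply: E_next => s.
  exact: (block_error ex ey dx dy K0 N0 b0 p0' p1 bias_x smooth_x).
have hfy i : E i.+1 f_fy <= (1 - p) * E i f_fy + b%:R^-1 * (3 * L ^+ 2 * E i f_mv + 6 * tau).
  rewrite -lin1; apply: E_next => s.
  exact: (block_error ex ey dx dy K0 N0 b0 p0' p1 bias_y smooth_y).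
have hux i : E i.+1 f_ux <= lambda * E i f_ux + (1 - lambda)^-1
    * (ex ^+ 2 * (2 * (3 * L ^+ 2 * E i f_mv + 6 * tau) + 2 * p * E i f_fx)).
  rewrite -lin3; apply: E_next => s; apply: block_residual => //.
  exact: (block_increment ex ey dx dy K0 N0 b0 p0' p1 bias_x smooth_x).
have huy i : E i.+1 f_uy <= lambda * E i f_uy + (1 - lambda)^-1
    * (ey ^+ 2 * (2 * (3 * L ^+ 2 * E i f_mv + 6 * tau) + 2 * p * E i f_fy)).
  rewrite -lin3; apply: E_next => s; rewrite -(sqrrN ey); apply: block_residual => //.
  exact: (block_increment ex ey dx dy K0 N0 b0 p0' p1 bias_y smooth_y).
have hcx i : E i.+1 f_cx <= lambda * E i f_cx + (1 - lambda)^-1 * E i f_ux.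
  rewrite -lin2; apply: E_next => s.
  exact: (block_consensus b p ex K0 N0 dsW l0 l1 contractW).
have hcy i : E i.+1 f_cy <= lambda * E i f_cy + (1 - lambda)^-1 * E i f_uy.
  rewrite -lin2; apply: E_next => s.
  exact: (block_consensus b p (- ey) K0 N0 dsW l0 l1 contractW).
(* The consensus error of the next round, as a function of the present state, to match the
   look-ahead in [f_mv]. *)
have ncx i : E i.+1 f_cx = E i (fun s => K%:R^-1 * sqnorm (dev (next_X ex W s))).
  rewrite -[LHS]/(E i (fun s => Elaw p (fun x =>
    f_cx (next_state (b := b) p ex ey dx dy N0 Q W s x)))).
  by congr (E i _); apply/funext => s; exact: (Elaw_cst K b p N0 (K%:R^-1 * sqnorm (dev _))).
have ncy i : E i.+1 f_cy = E i (fun s => K%:R^-1 * sqnorm (dev (next_Y ey W s))).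
  rewrite -[LHS]/(E i (fun s => Elaw p (fun x =>
    f_cy (next_state (b := b) p ex ey dx dy N0 Q W s x)))).
  by congr (E i _); apply/funext => s; exact: (Elaw_cst K b p N0 (K%:R^-1 * sqnorm (dev _))).
have hmv i : E i f_mv <= ex ^+ 2 * E i f_gx + ey ^+ 2 * E i f_gy
    + 2 * (E i.+1 f_cx + E i f_cx) + 2 * (E i.+1 f_cy + E i f_cy).
  have lin f a g a' u v w z : E i (fun s => a * f s + a' * g s + 2 * (u s + v s) + 2 * (w s + z s))
      = a * E i f + a' * E i g + 2 * (E i u + E i v) + 2 * (E i w + E i z).
    by rewrite !ED !EZ !ED.
  rewrite ncx ncy -lin; apply: Ele => s; rewrite /f_mv mulrDr.
  have h1 := block_move ex K0 dsW (stX s) (stDx s) (stGx s).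
  have h2 := block_move (- ey) K0 dsW (stY s) (stDy s) (stGy s).
  rewrite sqrrN in h2; apply: le_trans (lerD h1 h2) _.
  by rewrite le_eqVlt; apply/orP; left; apply/eqP; rewrite -/(f_cx s) -/(f_cy s) /f_gx /f_gy; ring.
have linr i a f a' t a'' a3 u v : E i (fun s => a * f s + a' * (t + a'' * (a3 * (u s + v s))))
    = a * E i f + a' * (t + a'' * (a3 * (E i u + E i v))).
  by rewrite ED !EZ ED Ec !EZ ED.
have hrx i : E i f_rx <= 2 * E i f_sx + 2 * (2 * tau + 2 * (L ^+ 2 * (E i f_cx + E i f_cy))).
  rewrite -linr; apply: Ele => s.
  have := sqnormD_le (average (stGx s - full_batch qx (stX s) (stY s)))
    (average (full_batch qx (stX s) (stY s)) - gradx J (xa s) (ya s)).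
  rewrite addrA averageB subrK => h; apply: le_trans h _; rewrite /f_sx averageB lerD2l ler_pM2l //.
  by rewrite gradxJ; exact: oracle_bias.
have hry i : E i f_ry <= 2 * E i f_sy + 2 * (2 * tau + 2 * (L ^+ 2 * (E i f_cx + E i f_cy))).
  rewrite -linr; apply: Ele => s.
  have := sqnormD_le (average (stGy s - full_batch qy (stX s) (stY s)))
    (average (full_batch qy (stX s) (stY s)) - grady J (xa s) (ya s)).
  rewrite addrA averageB subrK => h; apply: le_trans h _; rewrite /f_sy averageB lerD2l ler_pM2l //.
  by rewrite gradyJ; exact: oracle_bias.
have hPhi i : E i.+1 f_Phi <= E i f_Phi - ex / 8 * E i f_gx - ey / 64 * E i f_gy
    + 2 * ex * E i f_rx + ey * E i f_ry.
  have lin f a g a' u a1 v a2 w : E i (fun s => f s - a * g s - a' * u s + a1 * v s + a2 * w s)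
      = E i f - a * E i g - a' * E i u + a1 * E i v + a2 * E i w.
    transitivity (E i (fun s => f s + - a * g s + - a' * u s + a1 * v s + a2 * w s)).
      by apply: eq_Est => s; rewrite !mulNr.
    by rewrite !ED !EZ !mulNr.
  rewrite -lin; apply: E_next => s.
  have -> : Elaw p (fun x => f_Phi (next_state (b := b) p ex ey dx dy N0 Q W s x))
      = P (xa s - ex *: average (stGx s)) - Pinf + (P (xa s - ex *: average (stGx s))
        - J (xa s - ex *: average (stGx s)) (ya s + ey *: average (stGy s))) / 16.
    rewrite -[RHS](Elaw_cst K b p N0); apply: eq_bigr => x _; congr (_ * _).
    have ex' : xa (next_state (b := b) p ex ey dx dy N0 Q W s x) = xa s - ex *: average (stGx s).
      exact: (tracking_average K0 dsW).
    have ey' : ya (next_state (b := b) p ex ey dx dy N0 Q W s x) = ya s + ey *: average (stGy s).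
      by have := tracking_average K0 dsW (- ey) (stY s) (stDy s) (stGy s); rewrite scaleNr opprK.
    by rewrite /f_Phi ex' ey'.
  (* [272 (L^2 / nu) ex <= ey nu <= ey L <= 1 / 80]. *)
  have hx : 8 * (L ^+ 2 / nu) * ex <= 1.
    have : 272 * (L ^+ 2 / nu) * ex <= ey * L by apply: le_trans exy _; rewrite ler_pM2l.
    have q : 0 < ey * L by rewrite mulr_gt0.
    by have := eyL; lra.
  have hy : 8 * L * ey <= 1 by have q : 0 < L * ey; [rewrite mulr_gt0 | have := eyL; lra].
  have [cdQ _] := esQ.
  have := @potential_step R d1 d2 J P L nu nu0 nuL (fun y z => differentiable_risk_x cdQ y z)
    (fun x z => differentiable_risk_y cdQ x z) smooth_Jx smooth_Jy le_primal PLQ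
    (xa s) (ya s) (average (stGx s)) (average (stGy s)) ex ey ex0 ey0 hx hy exy.
  by rewrite /f_Phi /f_gx /f_gy /f_rx /f_ry; lra.
have hnx i : E i f_nx <= 2 * E i f_gx + 2 * E i f_rx.
  rewrite -lin2; apply: Ele => s.
  have := sqnormB_le (average (stGx s)) (average (stGx s) - gradx J (xa s) (ya s)).
  by rewrite subKr.
have hny i : E i f_ny <= 2 * E i f_gy + 2 * E i f_ry.
  rewrite -lin2; apply: Ele => s.
  have := sqnormB_le (average (stGy s)) (average (stGy s) - grady J (xa s) (ya s)).
  by rewrite subKr.
have [isx ifx] := block_init p ex ey dx dy K0 N0 b0 bias_x variance_x
  (\matrix_(k < K) x0) (\matrix_(k < K) y0).
have [isy ify] := block_init p ex ey dx dy K0 N0 b0 bias_y variance_y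
  (\matrix_(k < K) x0) (\matrix_(k < K) y0).
have iux : E 0 f_ux = ex ^+ 2 * E 0 f_zx.
  rewrite -EZ; apply: eq_bigr => x _; congr (_ * _).
  by rewrite /f_ux /= (residual_init K0 dsW ex x0 _ hDx).2 /f_zx mulrCA.
have iuy : E 0 f_uy = ey ^+ 2 * E 0 f_zy.
  rewrite -EZ; apply: eq_bigr => x _; congr (_ * _).
  by rewrite /f_uy /= (residual_init K0 dsW (- ey) y0 _ hDy).2 /f_zy sqrrN mulrCA.
have icx : E 0 f_cx = 0.
  rewrite -[RHS](Ec 0%N); apply: eq_bigr => x _; congr (_ * _).
  have [e _] := residual_init K0 dsW ex x0
    (stGx (init_state p ex ey dx dy N0 Q W x0 y0 Dx0 Dy0 x)) hDx.
  by rewrite /f_cx /= e sqnorm0 mulr0.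
have icy : E 0 f_cy = 0.
  rewrite -[RHS](Ec 0%N); apply: eq_bigr => x _; congr (_ * _).
  have [e _] := residual_init K0 dsW ex y0
    (stGy (init_state p ex ey dx dy N0 Q W x0 y0 Dx0 Dy0 x)) hDy.
  by rewrite /f_cy /= e sqnorm0 mulr0.
have b1 : 1 <= b%:R :> R by rewrite ler1n.
apply: (@sum_gradients_le R (E^~ f_sx) (E^~ f_sy) (E^~ f_fx) (E^~ f_fy) (E^~ f_cx) (E^~ f_cy)
  (E^~ f_ux) (E^~ f_uy) (E^~ f_mv) (E^~ f_gx) (E^~ f_gy) (E^~ f_rx) (E^~ f_ry)
  (E^~ f_Phi) (E^~ f_nx) (E^~ f_ny) p lambda K%:R b%:R L tau V (E 0 f_zx) (E 0 f_zy) ex ey c)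
  => //.
1: by rewrite addr_ge0 // mulr_ge0 // sqr_ge0.
1,2: by apply: E_ge0 => s; exact: Ksq0.
all: try by move=> i; apply: E_ge0 => s; exact: Ksq0.
all: try by move=> i; apply: E_ge0 => s; exact: sq0.
- by move=> i; apply: E_ge0 => s; rewrite mulr_ge0 // addr_ge0.
- by move=> i; apply: E_ge0 => s; rewrite addr_ge0 ?divr_ge0 // subr_ge0.
Qed.

End Analysis.

(** * Complexity and step sizes *)

Section ExpectedCost.
Variables (R : realType) (K N b : nat) (p : R).
Hypothesis N0 : (0 < N)%N.
Variables (disp : measure_display) (Om : measurableType disp).
Variables (Pr : probability Om R) (S : sampler K N N Om).
Hypothesis hS : sampling_scheme Pr p S.

Let coins (l : seq (outcome K N b)) : seq bool := [seq x.1.1 | x <- l].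

(** The constant [c] is general because the induction moves the expected cost of the last round into
    it. *)
Let EE_coins (alpha beta c : R) T :
  EE p T.+1 (fun l => c + \sum_(1 <= i < T.+1) (if nth false (coins l) i then alpha else beta))
    = c + T%:R * (p * alpha + (1 - p) * beta).
Proof.
elim: T c => [|T IH] c.
  rewrite /= mul0r addr0 -[RHS](Elaw_cst K b p N0).
  by apply: eq_bigr => x _; rewrite big_geq // addr0.
rewrite -[LHS]/(EE p T.+1 (fun l => Elaw p (fun x => c
  + \sum_(1 <= i < T.+2) (if nth false (coins (rcons l x)) i then alpha else beta)))).
have -> : c + T.+1%:R * (p * alpha + (1 - p) * beta)
    = (c + (p * alpha + (1 - p) * beta)) + T%:R * (p * alpha + (1 - p) * beta).
  by rewrite -natr1; ring.
rewrite -IH; apply: eq_EE => l sl.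
have step x : c + \sum_(1 <= i < T.+2) (if nth false (coins (rcons l x)) i then alpha else beta)
    = (c + \sum_(1 <= i < T.+1) (if nth false (coins l) i then alpha else beta))
      + (if x.1.1 then alpha else beta).
  rewrite big_nat_recr //= addrA; congr (_ + _ + _).
    apply: eq_big_nat => i /andP[_ iT].
    by rewrite /coins map_rcons nth_rcons size_map sl iT.
  by rewrite /coins map_rcons nth_rcons size_map sl ltnn eqxx.
transitivity (Elaw p (fun x : outcome K N b =>
    (c + \sum_(1 <= i < T.+1) (if nth false (coins l) i then alpha else beta))
      + (if x.1.1 then alpha else beta))).
  by apply: eq_bigr => x _; rewrite step.
rewrite ElawD Elaw_cst //.
rewrite (Elaw_coin (f := fun x : outcome K N b => if x.1.1 then alpha else beta)
  (g := fun c _ => if c then alpha else beta)) //.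
by rewrite !Edraw_cst // addrAC.
Qed.

Lemma Ex_evaluations d1 d2 (ex ey dx dy : R) T :
  Ex Pr (fun w => (evaluations d1 d2 (Params p 0 ex ey dx dy b b) S T w)%:R)
    = query_cost (d1 + d2) p N%:R b%:R b%:R T%:R.
Proof.
pose alpha : R := (N * (2 * (d1 + d2)))%:R; pose beta : R := (b * (4 * (d1 + d2)))%:R.
pose F l : R := (b * (2 * (d1 + d2)))%:R
  + \sum_(1 <= i < T.+1) (if nth false (coins l) i then alpha else beta).
transitivity (Ex Pr (fun w => F (mkseq ((observe b S) ^~ w) T.+1))).
  congr Ex; apply/funext => w; rewrite /evaluations /F natrD natr_sum; congr (_ + _).
  apply: eq_big_nat => i /andP[_ iT].
  rewrite /coins (nth_map (observe b S 0 w)) ?size_mkseq // nth_mkseq //=.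
  by case: ifP.
rewrite (Ex_history hS) EE_coins /query_cost /alpha /beta !natrM.
by ring.
Qed.

End ExpectedCost.

Section StepSizes.
Variable R : realType.

(** [2 b >= b + 1 > r], using [b >= 1]. *)
Lemma rounding_ge_half (r : R) b : 0 <= r -> rounding r b -> r <= 2 * b%:R.
Proof.
move=> r0 [b0]; rewrite ltr_norml => /andP[h _].
have : 1 <= b%:R :> R by rewrite ler1n.
by lra.
Qed.

End StepSizes.

(** [k] stands for [kappa^2], [a] for [1 / (1 - lambda)^2], [s] for [sigma^2], [t] for the bias per
    round. As [k] and [a] are at least 1, all constants fit under [k a (D + 1)]; 56 is 48 plus 8
    from [t <= a]. *)
Lemma collect_constants (R : realFieldType) (m c k a D Phi z s t : R) :
  0 <= m -> 10 <= c -> 1 <= k -> 1 <= a -> 0 <= D -> Phi <= D -> 0 <= z -> 0 <= s -> t <= a ->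
  m * (k * a) * Phi + ((c - 10) * k + 10) * (z + 4 * (2 * s + 2 * t) + 48 * a)
    <= (m + c * 56) * (k * a * (D + 1) + k * z + k * s).
Proof.
move=> m0 c10 k1 a1 D0 PhiD z0 s0 ta.
have ka0 : 0 <= k * a by apply: mulr_ge0; lra.
have h1 : m * (k * a) * Phi <= m * (k * a) * D by rewrite ler_wpM2l // mulr_ge0.
have kz : 0 <= k * z by apply: mulr_ge0 => //; lra.
have ks : 0 <= k * s by apply: mulr_ge0 => //; lra.
have kaD : 0 <= k * a * D by apply: mulr_ge0.
have h2 : ((c - 10) * k + 10) * (z + 4 * (2 * s + 2 * t) + 48 * a)
    <= (c * k) * (z + 8 * s + 56 * a).
  apply: (le_trans (y := ((c - 10) * k + 10) * (z + 8 * s + 56 * a))).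
    apply: ler_wpM2l; last by lra.
    by apply: addr_ge0 => //; apply: mulr_ge0; lra.
  apply: ler_wpM2r; lra.
have h3 : c * (k * z + 8 * (k * s) + 56 * (k * a)) <= c * (56 * (k * a * (D + 1) + k * z + k * s)).
  apply: ler_wpM2l; lra.
have h4 : 0 <= m * (k * a + k * z + k * s) by apply: mulr_ge0 => //; lra.
by lra.
Qed.

(** * The bound for the prescribed parameters *)

Section Main.
Variables (R : realType) (L : R).
Hypothesis L0 : 0 < L.
Variables (K N d1 d2 : nat) (Q : losses R K N d1 d2) (nu sigma lambda : R).
Variables (W : 'M[R]_K) (x0 : 'rV[R]_d1) (y0 : 'rV[R]_d2).
Variables (Dx0 : 'M[R]_(K, d1)) (Dy0 : 'M[R]_(K, d2)).
Variables (disp : measure_display) (Om : measurableType disp).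
Variables (Pr : probability Om R) (S : sampler K N N Om) (b T : nat).
Hypotheses (K2 : (2 <= K)%N) (N0 : (0 < N)%N) (d10 : (0 < d1)%N) (d20 : (0 < d2)%N).
Hypotheses (T0 : (0 < T)%N) (nu0 : 0 < nu) (nuL : nu <= L).
Hypotheses (maxQ : max_attained (risk Q)) (lbQ : has_lbound (range (primal (risk Q)))).
Hypotheses (PLQ : PL_in_y (risk Q) nu) (esQ : expected_smoothness Q L).
Hypotheses (bvQ : bounded_variance Q sigma) (netW : network_assumption W lambda).
Hypothesis psdW : possemidef W.
Hypotheses (hDx : netB (atc_gt W) *m Dx0 = 0) (hDy : netB (atc_gt W) *m Dy0 = 0).
Hypothesis rb : rounding (Num.sqrt (N%:R / K%:R : R)) b.
Let kappa := L / nu.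
(** These values turn [80 L c <= 1] and [272 (L^2/nu) etax <= etay nu] into equalities. *)
Let cy := (80 * L)^-1.
Let cx := cy / 272.
Let h := page_gt_params K N d1 d2 kappa lambda cx cy L^-1 L^-1 b T.
Hypothesis hS : sampling_scheme Pr (prob h) S.
Let traj := zoma Q (atc_gt W) (atc_gt W) h S x0 y0 Dx0 Dy0.
Let avg := avg_sqgrad Pr (risk Q) traj T.
Let D0 := Delta0 Pr (risk Q) traj.
Let z0 := zeta0_sq Pr traj (atc_gt W) (atc_gt W).

(** [K sqrt(N / K) / sqrt(N K) = 1], and rounding [b] loses at most a factor 2. *)
Lemma prob_bounds :
  let p := (Num.sqrt (N%:R * K%:R))^-1 : R in
  [/\ 0 < p, p <= 1 & 1 <= 2 * (K%:R * b%:R * p)].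
Proof.
move=> p; have K0 : (0 < K)%N by exact: ltnW.
have NK1 : 1 <= N%:R * K%:R :> R by rewrite -natrM ler1n muln_gt0 N0.
have s1 : 1 <= Num.sqrt (N%:R * K%:R) :> R by rewrite -[X in X <= _]sqrtr1 ler_wsqrtr.
have s0 : 0 < Num.sqrt (N%:R * K%:R) :> R by apply: lt_le_trans s1.
split; rewrite ?invr_gt0 ?invf_le1 //.
have := rounding_ge_half (sqrtr_ge0 _) rb; set r := Num.sqrt (N%:R / K%:R) => rb2.
have KR : 0 < K%:R :> R by rewrite ltr0n.
have Krp : K%:R * r * p = 1.
  have -> : K%:R * r = Num.sqrt (N%:R * K%:R).
    rewrite /r -{1}(ger0_norm (ltW KR)) -sqrtr_sqr -sqrtrM ?sqr_ge0 //.
    by congr Num.sqrt; field; rewrite gt_eqF.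
  by rewrite mulfV // gt_eqF.
rewrite -[X in X <= _]Krp.
have -> : 2 * (K%:R * b%:R * p) = K%:R * p * (2 * b%:R) by ring.
rewrite mulrAC ler_wpM2l // mulr_ge0 ?invr_ge0 ?ltW //.
Qed.

Lemma avg_sqgrad_bound :
  [/\ 0 <= lambda < 1, 0 <= D0, 0 <= z0 &
  avg <= (48 * 272 * 80 * L + (240 * 272 + 10) * 56) *
    (kappa ^+ 2 * (D0 + 1) / ((1 - lambda) ^+ 2 * T%:R)
     + kappa ^+ 2 * (1 - lambda) * z0 / T%:R + kappa ^+ 2 * sigma ^+ 2 / T%:R)].
Proof.
have K0 : (0 < K)%N by exact: ltnW.
have [/andP[l0 l1] _] := spectral_gap K2 netW psdW.
have contractW n (V : 'M[R]_(K, n)) := @gossip_contraction _ _ _ _ K2 netW psdW n V.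
have [_ dsW _ _] := netW.
have [p0 p1 Kbp] := prob_bounds.
have [b0 _] := rb.
have l1' : 0 < 1 - lambda by rewrite subr_gt0.
have TR : 0 < T%:R :> R by rewrite ltr0n.
have kappa1 : 1 <= kappa by rewrite /kappa ler_pdivlMr // mul1r.
have kappa0 : 0 < kappa by apply: lt_le_trans kappa1.
have dlt0 d : (0 < d)%N -> 0 < L^-1 / (Num.sqrt d%:R * (1 - lambda) * Num.sqrt T%:R).
  move=> d0; rewrite divr_gt0 ?invr_gt0 // mulr_gt0 ?sqrtr_gt0 //.
  by rewrite mulr_gt0 ?sqrtr_gt0 ?ltr0n.
(* The common value of [d L^2 delta^2] in both blocks: [delta] carries [1 / sqrt d] to cancel the
   dimension. *)
pose tau := ((1 - lambda) ^+ 2 * T%:R)^-1 : R.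
have tauE d : (0 < d)%N ->
    d%:R * (L ^+ 2 * (L^-1 / (Num.sqrt d%:R * (1 - lambda) * Num.sqrt T%:R)) ^+ 2) <= tau.
  move=> d0; have dR : 0 < d%:R :> R by rewrite ltr0n.
  rewrite expr_div_n !exprMn !sqr_sqrtr ?ler0n // /tau.
  rewrite le_eqVlt; apply/orP; left; apply/eqP.
  by field; rewrite !gt_eqF.
have cy0 : 0 < cy by rewrite invr_gt0; have := L0; lra.
have cx0 : 0 < cx by rewrite /cx; lra.
have hetax : 0 < etax h by apply: mulr_gt0 => //; apply: divr_gt0; exact: exprn_gt0.
have exy : 272 * (L ^+ 2 / nu) * etax h <= etay h * nu.
  rewrite le_eqVlt; apply/orP; left; apply/eqP; rewrite /= /cx /kappa.
  by field; rewrite !gt_eqF.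
have cL : 80 * (L * cy) <= 1.
  rewrite le_eqVlt; apply/orP; left; apply/eqP; rewrite /cy.
  by field; rewrite gt_eqF.
have main := average_gradient_le (ey := etay h) (c := cy) K0 N0 b0 p0 p1 Kbp x0 y0
  nu0 nuL (dlt0 d1 d10) (dlt0 d2 d20) maxQ lbQ PLQ esQ bvQ dsW l0 l1 contractW hDx hDy
  (tauE d1 d10) (tauE d2 d20) hetax exy (erefl _) cL T.
set p := (Num.sqrt (N%:R * K%:R))^-1 in main.
pose E := Est b p (etax h) (etay h) (deltax h) (deltay h) N0 Q W x0 y0 Dx0 Dy0.
have brid i f : Ex Pr (fun w => f (traj i w)) = E i f.
  exact: (Ex_Est b (etax h) (etay h) (deltax h) (deltay h) N0 Q W x0 y0 Dx0 Dy0 hS).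
pose xa (s : state R K d1 d2) := average (stX s).
pose ya (s : state R K d1 d2) := average (stY s).
pose Pr0 s := primal (risk Q) (xa s) - primal_inf (risk Q).
pose Pr1 s := primal (risk Q) (xa s) - risk Q (xa s) (ya s).
have Pr0_ge0 s : 0 <= Pr0 s by rewrite subr_ge0 primal_ge_inf.
have Pr1_ge0 s : 0 <= Pr1 s by rewrite subr_ge0 primal_ge.
have D0E : D0 = E 0%N (fun s => Pr0 s + Pr1 s) by rewrite -brid.
have z0E : z0 = E 0%N (fun s => K%:R^-1 * sqnorm (mix_deviation (netA (atc_gt W)) (stGx s)))
    + E 0%N (fun s => K%:R^-1 * sqnorm (mix_deviation (netA (atc_gt W)) (stGy s))).
  by rewrite /E !EstZ -/E -!brid.
have D00 : 0 <= D0 by rewrite D0E; apply: Est_ge0 => //; [exact: ltW | move=> s; exact: addr_ge0].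
have z00 : 0 <= z0.
  rewrite z0E; apply: addr_ge0; apply: Est_ge0 => //; rewrite ?(ltW p0) // => s;
    by rewrite mulr_ge0 ?invr_ge0 ?ler0n ?sqnorm_ge0.
have PhiD : E 0%N (fun s => Pr0 s + Pr1 s / 16) <= D0.
  rewrite D0E; apply: Est_le => //; first exact: ltW.
  by move=> s; have := Pr1_ge0 s; lra.
have avgE : avg = T%:R^-1 * \sum_(i < T) (E i (fun s => sqnorm (gradx (risk Q) (xa s) (ya s)))
    + E i (fun s => sqnorm (grady (risk Q) (xa s) (ya s)))).
  by congr (_ * _); apply: eq_bigr => i _; rewrite -!brid.
rewrite -/E in main.
split=> //; first by rewrite l0.
have main' : \sum_(i < T) (E i (fun s => sqnorm (gradx (risk Q) (xa s) (ya s)))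
    + E i (fun s => sqnorm (grady (risk Q) (xa s) (ya s))))
    <= 48 / etax h * E 0%N (fun s => Pr0 s + Pr1 s / 16)
    + (240 * (etay h / etax h) + 10) * ((1 - lambda) * z0 + 4 * (2 * sigma ^+ 2 + 2 * tau) + 48 * (tau * T%:R)).
  by rewrite z0E; exact: main.
pose a := ((1 - lambda) ^+ 2)^-1; pose k2 := kappa ^+ 2.
have k21 : 1 <= k2 by rewrite /k2 exprn_ege1.
have a1 : 1 <= a.
  rewrite /a invf_ge1 ?exprn_gt0 // expr_le1 ?(ltW l1') //.
  by rewrite lerBlDr lerDl.
have e1 : 48 / etax h = 48 * 272 * 80 * L * (k2 * a).
  rewrite /= /cx /cy /k2 /a; field; rewrite !gt_eqF //.
have e2 : etay h / etax h = 272 * k2.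
  rewrite /= /cx /k2; field; rewrite !gt_eqF //.
have e3 : tau * T%:R = a by rewrite /tau /a; field; rewrite !gt_eqF.
have taua : tau <= a.
  by rewrite -e3 ler_peMr ?ler1n // invr_ge0 mulr_ge0 // sqr_ge0.
rewrite avgE.
have -> : kappa ^+ 2 * (D0 + 1) / ((1 - lambda) ^+ 2 * T%:R)
     + kappa ^+ 2 * (1 - lambda) * z0 / T%:R + kappa ^+ 2 * sigma ^+ 2 / T%:R
  = T%:R^-1 * (k2 * a * (D0 + 1) + k2 * ((1 - lambda) * z0) + k2 * sigma ^+ 2).
  by rewrite /k2 /a; field; rewrite !gt_eqF.
rewrite (mulrCA _ T%:R^-1) ler_pM2l ?invr_gt0 //.
apply: le_trans main' _; rewrite e1 e2 e3.
have s20 : 0 <= sigma ^+ 2 by exact: sqr_ge0.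
have z1 : 0 <= (1 - lambda) * z0 by rewrite mulr_ge0 // ltW.
have m0 : 0 <= 48 * 272 * 80 * L by have := L0; lra.
have c10 : 10 <= 240 * 272 + 10 :> R by lra.
have := collect_constants m0 c10 k21 a1 D00 PhiD z1 s20 taua.
by rewrite addrK (mulrA 240).
Qed.

End Main.

Theorem corollary4 (R : realType) (L : R) (L_gt0 : 0 < L) :
  exists (cx cy dx dy C : R) (C1 C2 : R -> R),
    [/\ 0 < cx, 0 < cy, 0 < dx, 0 < dy & 0 < C] /\
    (forall M, 0 < C1 M /\ 0 < C2 M) /\
    forall (K N d1 d2 : nat) (Q : losses R K N d1 d2) (nu sigma lambda : R)
      (W : 'M[R]_K) (x0 : 'rV[R]_d1) (y0 : 'rV[R]_d2)
      (Dx0 : 'M[R]_(K, d1)) (Dy0 : 'M[R]_(K, d2))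
      (disp : measure_display) (Om : measurableType disp)
      (Pr : probability Om R) (S : sampler K N N Om) (b T : nat),
    (2 <= K)%N -> (0 < N)%N -> (0 < d1)%N -> (0 < d2)%N -> (0 < T)%N ->
    0 < nu -> nu <= L -> 0 <= sigma ->
    max_attained (risk Q) ->
    has_lbound (range (primal (risk Q))) ->
    PL_in_y (risk Q) nu ->
    expected_smoothness Q L ->
    bounded_variance Q sigma ->
    network_assumption W lambda ->
    possemidef W ->
    netB (atc_gt W) *m Dx0 = 0 ->
    netB (atc_gt W) *m Dy0 = 0 ->
    rounding (Num.sqrt (N%:R / K%:R : R)) b ->
    let kappa := L / nu in
    let h := page_gt_params K N d1 d2 kappa lambda cx cy dx dy b T in
    sampling_scheme Pr (prob h) S ->
    let traj := zoma Q (atc_gt W) (atc_gt W) h S x0 y0 Dx0 Dy0 in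
    let avg := avg_sqgrad Pr (risk Q) traj T in
    let D0 := Delta0 Pr (risk Q) traj in
    let z0 := zeta0_sq Pr traj (atc_gt W) (atc_gt W) in
    avg <= C * (kappa ^+ 2 * (D0 + 1) / ((1 - lambda) ^+ 2 * T%:R)
                + kappa ^+ 2 * (1 - lambda) * z0 / T%:R
                + kappa ^+ 2 * lambda ^+ 4 * Num.sqrt K%:R * sigma ^+ 2
                    / (Num.sqrt N%:R * T%:R)
                + kappa ^+ 2 * sigma ^+ 2 / T%:R)
    /\
    forall M eps : R, 0 < eps ->
      (sigma <= M -> D0 <= M -> z0 <= M ^+ 2 ->
       C1 M * comm_order kappa lambda eps <= T%:R -> avg <= eps ^+ 2)
      /\
      let d := (d1 + d2)%N in
      let p := prob h in
      let bR := Num.sqrt (N%:R / K%:R : R) in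
      let FC := query_cost d p N%:R b%:R b%:R T%:R in
      let FC_ideal := query_cost d p N%:R bR bR T%:R in
      let bound := C2 M * query_order K N d kappa lambda eps in
      [/\ Ex Pr (fun w => (evaluations d1 d2 h S T w)%:R) = FC,
          T%:R <= C1 M * comm_order kappa lambda eps + 1 -> FC_ideal <= bound &
          T%:R <= C1 M * comm_order kappa lambda eps + 1 -> (K <= N)%N ->
            FC <= bound].
Proof.
pose m : R := 48 * 272 * 80 * L + (240 * 272 + 10) * 56.
have m0 : 0 < m by rewrite /m; lra.
(* When the data are bounded through [M], [T] times the bracket is at most [kappa^2 (|M| + 1 + M^2 +
   M^2) / (1 - lambda)^2]; the absolute value keeps [C1] positive for every [M]. *)
pose C1 (M : R) := m * (`|M| + 1 + 2 * M ^+ 2).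
have C10 M : 0 < C1 M.
  by rewrite mulr_gt0 // -addrA addrCA ltr_pwDl // addr_ge0 // mulr_ge0 // sqr_ge0.
(* The cost is at most [d sqrt(N/K) (10 T + 4)]. With [u = kappa^2 eps^-2 / (1 - lambda)^2] and
   [T <= 2 C1 u + 1], the last factor is at most [20 C1 u + 14], which fits under
   [(24 C1 + 16) (u + 1)]. *)
exists ((80 * L)^-1 / 272), (80 * L)^-1, L^-1, L^-1, m, C1, (fun M => 24 * C1 M + 16).
have cy0 : 0 < (80 * L)^-1 by rewrite invr_gt0; lra.
split; first by split; rewrite ?invr_gt0 //; lra.
split; first by move=> M; split=> //; rewrite addr_gt0 // mulr_gt0.
move=> K N d1 d2 Q nu sigma lambda W x0 y0 Dx0 Dy0 disp Om Pr S b T.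
move=> K2 N0 d10 d20 T0 nu0 nuL sigma0 maxQ lbQ PLQ esQ bvQ netW psdW hDx hDy rb.
move=> kappa h hS traj avg D0 z0.
have [/andP[l0 l1] D00 z00 core] := avg_sqgrad_bound L_gt0 x0 y0 K2 N0 d10 d20 T0 nu0 nuL
  maxQ lbQ PLQ esQ bvQ netW psdW hDx hDy rb hS.
rewrite -/traj -/D0 -/z0 -/avg -/kappa -/m in core D00 z00.
have l1' : 0 < 1 - lambda by rewrite subr_gt0.
have TR : 0 < T%:R :> R by rewrite ltr0n.
have KR : 0 < K%:R :> R by rewrite ltr0n ltnW.
have NR : 0 < N%:R :> R by rewrite ltr0n.
have k20 : 0 <= kappa ^+ 2 by exact: sqr_ge0.
split.
  apply: le_trans core _; rewrite ler_pM2l // lerD2r lerDl.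
  apply: divr_ge0; last by rewrite mulr_ge0 ?sqrtr_ge0 ?ler0n.
  have l4 : 0 <= lambda ^+ 4 by exact: exprn_ge0.
  by apply: mulr_ge0 (sqr_ge0 _); apply: mulr_ge0 (sqrtr_ge0 _); exact: mulr_ge0.
move=> M eps eps0.
have ei0 : 0 <= eps ^- 2 by rewrite invr_ge0 sqr_ge0.
set a := ((1 - lambda) ^+ 2)^-1.
have a1 : 1 <= a.
  by rewrite /a invf_ge1 ?exprn_gt0 // expr_le1 ?(ltW l1') // lerBlDr lerDl.
have commE : comm_order kappa lambda eps = kappa ^+ 2 * eps ^- 2 * (a + 1).
  by rewrite /comm_order mulrDr mulr1.
split.
  move=> sM DM zM CT.
  have M2 : sigma ^+ 2 <= M ^+ 2 by rewrite ler_pXn2r ?nnegrE // (le_trans sigma0).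
  have z1 : (1 - lambda) * z0 <= M ^+ 2.
    by apply: le_trans zM; rewrite ler_piMl // lerBlDr lerDl.
  have core2 : T%:R * avg <= C1 M * (kappa ^+ 2 * a).
    move: core; rewrite -(ler_pM2l TR) => core; apply: le_trans core _.
    have -> : T%:R * (m * (kappa ^+ 2 * (D0 + 1) / ((1 - lambda) ^+ 2 * T%:R)
        + kappa ^+ 2 * (1 - lambda) * z0 / T%:R + kappa ^+ 2 * sigma ^+ 2 / T%:R))
      = m * (kappa ^+ 2 * (a * (D0 + 1) + (1 - lambda) * z0 + sigma ^+ 2)).
      by rewrite /a; field; rewrite !gt_eqF.
    rewrite /C1 -(mulrA m) ler_pM2l // [X in _ <= X](mulrCA _ (kappa ^+ 2)) ler_wpM2l //.
    have h1 : M ^+ 2 <= M ^+ 2 * a by rewrite ler_peMr // sqr_ge0.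
    have h2 : a * (D0 + 1) <= a * (`|M| + 1).
      by rewrite ler_wpM2l ?(le_trans _ a1) // lerD2r (le_trans DM) // ler_norm.
    by lra.
  rewrite -(ler_pM2l TR); apply: le_trans core2 _.
  rewrite -ler_pdivrMr ?exprn_gt0 //; apply: le_trans CT.
  rewrite commE -(mulrA (C1 M)) ler_pM2l // mulrAC ler_wpM2l ?lerDl //.
  exact: mulr_ge0.
move=> d p bR FC FC_ideal bound.
have [p0 p1 _] : [/\ 0 < p, p <= 1 & 1 <= 2 * (K%:R * b%:R * p)] := prob_bounds K2 N0 rb.
have FCE : Ex Pr (fun w => (evaluations d1 d2 h S T w)%:R) = FC.
  exact: (Ex_evaluations b N0 hS d1 d2 (etax h) (etay h) (deltax h) (deltay h) T).
have bR0 : 0 < bR by rewrite sqrtr_gt0 divr_gt0.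
have s0 : 0 < Num.sqrt (N%:R * K%:R) :> R by rewrite sqrtr_gt0 mulr_gt0.
have NE : bR * Num.sqrt (N%:R * K%:R) = N%:R.
  rewrite /bR -sqrtrM ?divr_ge0 ?ler0n // (_ : _ * _ = N%:R ^+ 2); last by field; rewrite gt_eqF.
  by rewrite sqrtr_sqr ger0_norm // ler0n.
(* Full batches thus cost, on average per round, as many samples as one ideal minibatch. *)
have pN : p * N%:R = bR by rewrite -[in LHS]NE mulrCA mulVf ?mulr1 // gt_eqF.
have orderE : query_order K N d kappa lambda eps
    = d%:R * bR * (kappa ^+ 2 * eps ^- 2 * a + 1).
  rewrite /query_order /bR /a sqrtrM ?ltW // sqrtrV ?ltW //.
  by field; rewrite !gt_eqF ?sqrtr_gt0.
have dR : 0 <= d%:R :> R by exact: ler0n.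
(* Stated for any size up to twice the ideal one, to cover both the ideal and the rounded count. *)
have cost (b' : R) : 0 <= b' -> b' <= 2 * bR -> T%:R <= C1 M * comm_order kappa lambda eps + 1 ->
    query_cost d p N%:R b' b' T%:R <= bound.
  move=> b'0 b'le hT.
  have h1 : query_cost d p N%:R b' b' T%:R
      = d%:R * (2 * bR * T%:R + 2 * b' + 4 * b' * ((1 - p) * T%:R)).
    by rewrite /query_cost -(mulrA T%:R) pN; ring.
  have h2 : (1 - p) * T%:R <= T%:R by rewrite ler_piMl ?(ltW TR) //; lra.
  have h3 : 4 * b' * ((1 - p) * T%:R) <= 8 * bR * T%:R.
    apply: ler_pM => //; first exact: mulr_ge0.
      by rewrite mulr_ge0 ?subr_ge0 // ltW.
    by rewrite (_ : 8 * bR = 4 * (2 * bR)) ?ler_pM2l //; ring.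
  rewrite h1 /bound orderE -(mulrA d%:R) [X in _ <= X](mulrCA _ d%:R) ler_wpM2l //.
  have h4 : 2 * bR * T%:R + 2 * b' + 4 * b' * ((1 - p) * T%:R) <= bR * (10 * T%:R + 4) by lra.
  apply: le_trans h4 _; rewrite [X in _ <= X](mulrCA _ bR) ler_pM2l //.
  have h5 : comm_order kappa lambda eps <= 2 * (kappa ^+ 2 * eps ^- 2 * a).
    have := ler_wpM2l (mulr_ge0 k20 ei0) a1; rewrite commE.
    by move: (kappa ^+ 2 * eps ^- 2) => u; lra.
  have h6 := ler_wpM2l (ltW (C10 M)) h5.
  have h7 : 0 <= kappa ^+ 2 * eps ^- 2 * a.
    by apply: mulr_ge0 (le_trans ler01 a1); exact: mulr_ge0.
  have := C10 M; move: (kappa ^+ 2 * eps ^- 2 * a) h6 h7 => u h6 h7 c1.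
  have h8 : 0 <= C1 M * u by rewrite mulr_ge0 // ltW.
  by lra.
split=> // [hT|hT KN].
  by apply: cost => //; [exact: ltW | lra].
apply: cost => //.
(* For [K <= N] the ideal size is at least 1, so the rounded one, which exceeds it by less than 1,
   is at most its double. *)
have bR1 : 1 <= bR.
  by rewrite -[X in X <= _]sqrtr1 ler_wsqrtr // ler_pdivlMr // mul1r ler_nat.
by case: rb => _; rewrite ltr_norml => /andP[_]; rewrite -/bR; lra.
Qed.
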